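(* The lattice of coideal subalgebras of $KD(6)$, ordered by inclusion, is the following. Its elements are exactly: dimension $1$: $\mathbb{C}$; dimension $2$: $I_0,I_1,I_2,I_3,I_4$; dimension $3$: $L_1,L_3,L_5$; dimension $4$: $J_0,J_1,J_2,J_3,J_4,J_5,J_{20}$; dimension $6$: $K_1,K_{21},K_{22},K_{23},K_{24},K_{25},K_{26},K_{41},K_{42}$; dimension $8$: $K_0,K_{01},K_{02}$; dimension $12$: $K_2,K_3,K_4$; dimension $24$: $KD(6)$. Its diagram (edges joining a smaller coideal subalgebra to a larger one containing it) consists of the following edges: - $\mathbb{C}$ is joined to $I_0,I_1,I_2,I_3,I_4,L_1,L_3,L_5$; - $I_0$ is joined to $J_0,J_1,J_2,J_3,J_4,J_5,J_{20}$ and $K_1$; - $I_1$ is joined to $J_0$ and $K_{41}$; $I_2$ is joined to $J_0$ and $K_{42}$; - $I_3$ is joined to $J_{20},K_{21},K_{22},K_{23}$; $I_4$ is joined to $J_{20},K_{24},K_{25},K_{26}$; - $L_1$ and $L_5$ are joined to $K_1$; $L_3$ is joined to $K_1,K_{41},K_{42}$; - $J_0$ is joined to $K_0$ and $K_4$; $J_1$ is joined to $K_{01}$ and $K_3$; $J_2$ is joined to $K_{02}$ and $K_4$; $J_3$ is joined to $K_0$ and $K_3$; $J_4$ is joined to $K_{01}$ and $K_4$; $J_5$ is joined to $K_{02}$ and $K_3$; $J_{20}$ is joined to $K_0,K_{01},K_{02}$ and $K_2$; - $K_1$ is joined to $K_2,K_3,K_4$; $K_{21},\dots,K_{26}$ are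 joined to $K_2$; $K_{41}$ and $K_{42}$ are joined to $K_4$; - $K_0,K_{01},K_{02},K_2,K_3,K_4$ are joined to $KD(6)$.
   Context: A coideal subalgebra of a finite-dimensional Kac algebra ($C^*$-Hopf algebra) $K$ is a unital $*$-subalgebra $I$ with $\Delta(I)\subset K\otimes I$. Its Jones projection $p_I$ is the unique nonzero projection in $I$ with $yp_I=\varepsilon(y)p_I$ for all $y\in I$; $I$ is generated by $p_I$ as a coideal subalgebra. $KD(n)$ ($n\ge1$): let $D_{2n}=\langle a,b\mid a^{2n}=b^2=1,\ ba=a^{-1}b\rangle$ (order $4n$), with canonical basis $\lambda(g)$ of $\mathbb{C}[D_{2n}]$, and $\Delta_s(\lambda(g))=\lambda(g)\otimes\lambda(g)$. Put $h_1=1,h_2=a^n,h_3=b,h_4=ba^n$, $\nu=-1+2\mathrm{i}$, and $\Omega=\sum_{i,j}c_{i,j}\lambda(h_i)\otimes\lambda(h_j)$ with $$(c_{i,j})=\frac18\begin{pmatrix}5&1&1&1\\1&1&\bar\nu&\nu\\1&\nu&1&\bar\nu\\1&\bar\nu&\nu&1\end{pmatrix}.$$ $\Omega$ is unitary. $KD(n)$ is the $*$-algebra $\mathbb{C}[D_{2n}]$ with its usual counit and antipode and the coproduct $\Delta(x)=\Omega\Delta_s(x)\Omega^*$. Elements (here $n=6$): with $\epsilon=\mathrm{e}^{\mathrm{i}\pi/n}$, sums over $k=0,\dots,2n-1$, and $1\le j\le n-1$: $e_1=\frac1{4n}\sum(\lambda(a^k)+\lambda(ba^k))$, $e_2=\frac1{4n}\sum(\lambda(a^k)-\lambda(ba^k))$,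 $e_3=\frac1{4n}\sum(-1)^k(\lambda(a^k)-\lambda(ba^k))$, $e_4=\frac1{4n}\sum(-1)^k(\lambda(a^k)+\lambda(ba^k))$, $e^j_{1,1}=\frac1{2n}\sum\epsilon^{-jk}\lambda(a^k)$, $e^j_{2,2}=\frac1{2n}\sum\epsilon^{jk}\lambda(a^k)$, $e^j_{1,2}=\frac1{2n}\sum\epsilon^{jk}\lambda(ba^k)$, $e^j_{2,1}=\frac1{2n}\sum\epsilon^{-jk}\lambda(ba^k)$. Put $r^j_{1,1}=\frac12(e^j_{1,1}-\mathrm{i}e^j_{1,2}+\mathrm{i}e^j_{2,1}+e^j_{2,2})$, $r^j_{2,2}=\frac12(e^j_{1,1}+\mathrm{i}e^j_{1,2}-\mathrm{i}e^j_{2,1}+e^j_{2,2})$, $p^j_{1,1}=\frac12(e^j_{1,1}+e^j_{1,2}+e^j_{2,1}+e^j_{2,2})$, $p^j_{2,2}=\frac12(e^j_{1,1}-e^j_{1,2}-e^j_{2,1}+e^j_{2,2})$, $q(0,\beta,j)=\frac12(e^j_{1,1}+\mathrm{e}^{-\mathrm{i}\beta}e^j_{1,2}+\mathrm{e}^{\mathrm{i}\beta}e^j_{2,1}+e^j_{2,2})$. For $i=1,2$: $p_i=\sum_{j\text{ odd},1\le j\le n-1}p^j_{i,i}$, $q_i=\sum_{j\text{ even},1\le j\le n-1}p^j_{i,i}$. The named coideal subalgebras of $KD(6)$ are those with the following Jones projections. $I_0$: $e_1+e_2+e_3+e_4+q_1+q_2$; $I_1$: $e_1+e_4+q_1+p_2$;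 $I_2$: $e_1+e_4+q_1+p_1$; $I_3$: $e_1+e_2+e^4_{1,1}+e^4_{2,2}+r^1_{2,2}+r^3_{1,1}+r^5_{2,2}$; $I_4$: $e_1+e_2+e^4_{1,1}+e^4_{2,2}+r^1_{1,1}+r^3_{2,2}+r^5_{1,1}$. $L_1$: $e_1+e_2+e_3+e_4+r^1_{1,1}+r^5_{2,2}$; $L_3$: $e_1+e_2+e_3+e_4+r^3_{1,1}+r^3_{2,2}$; $L_5$: $e_1+e_2+e_3+e_4+r^5_{1,1}+r^1_{2,2}$. $J_0$: $e_1+e_4+q_1$; $J_1$: $e_1+e_3+q(0,\frac\pi3,2)+q(0,\frac{2\pi}3,4)$; $J_2$: $e_1+e_4+q(0,\frac{2\pi}3,2)+q(0,\frac{4\pi}3,4)$; $J_3$: $e_1+e_3+p^2_{2,2}+p^4_{1,1}$; $J_4$: $e_1+e_4+q(0,\frac{4\pi}3,2)+q(0,\frac{2\pi}3,4)$; $J_5$: $e_1+e_3+q(0,\frac{5\pi}3,2)+q(0,\frac{4\pi}3,4)$; $J_{20}$: $e_1+e_2+e^4_{1,1}+e^4_{2,2}$. $K_1$: $e_1+e_2+e_3+e_4$; $K_{21},K_{22},K_{23}$: $e_1+e_2+r^{j}_{1,1}$ with $j=1,3,5$ respectively; $K_{24},K_{25},K_{26}$: $e_1+e_2+r^{j}_{2,2}$ with $j=1,3,5$ respectively; $K_{41}$: $e_1+e_4+p^3_{2,2}$; $K_{42}$: $e_1+e_4+p^3_{1,1}$. $K_0$: $e_1+p^4_{1,1}$;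 $K_{01}$: $e_1+q(0,\frac{2\pi}3,4)$; $K_{02}$: $e_1+q(0,\frac{4\pi}3,4)$. $K_2$: $e_1+e_2$; $K_3$: $e_1+e_3$; $K_4$: $e_1+e_4$.
   Formalization: The printed edges contradict the Jones projections (p_{I3}p_{K21}=e_1+e_2). Corrected: I_3 is joined to J_20,K_22,K_24,K_26; I_4 to J_20,K_21,K_23,K_25; added edges: L_1 to K_21,K_26; L_3 to K_22,K_25; L_5 to K_23,K_24. *)

(* Defs.v *)
From HB Require Import structures.
From mathcomp Require Import all_boot all_order all_algebra all_fingroup all_field.
From mathcomp Require Import reals trigo.
From mathcomp Require Import complex.

Set Implicit Arguments.
Unset Strict Implicit.
Unset Printing Implicit Defensive.

Import GRing.Theory.
Local Open Scope ring_scope.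

(* The group algebra C[G], carried by the functions G -> C; its product is
   convolution, not the pointwise product that {ffun G -> C} has by default. *)
Definition galg (C : fieldType) (gT : finGroupType) : Type := {ffun gT -> C^o}.

HB.instance Definition _ (C : fieldType) (gT : finGroupType) :=
  GRing.Lmodule.copy (galg C gT) {ffun gT -> C^o}.
HB.instance Definition _ (C : fieldType) (gT : finGroupType) :=
  Vector.copy (galg C gT) {ffun gT -> C^o}.

Section GroupAlgebra.
Variables (C : fieldType) (gT : finGroupType).
Local Notation A := (galg C gT).

Definition lam (g : gT) : A := [ffun x => (x == g)%:R].

Definition galg_mul (x y : A) : A := [ffun g => \sum_h x h * y (h^-1 * g)%g].

Lemma galg_mulA : associative galg_mul.
Proof.
move=> x y z; apply/ffunP=> g; rewrite !ffunE.
under eq_bigr => h _ do rewrite ffunE big_distrr /=.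
under [RHS]eq_bigr => h _ do rewrite ffunE big_distrl /=.
rewrite [RHS]exchange_big /=; apply: eq_bigr => h _.
rewrite [RHS](reindex_inj (mulgI h)) /=; apply: eq_bigr => k _.
by rewrite mulKg invMg !mulgA mulrA.
Qed.

Lemma galg_mul1l : left_id (lam 1%g) galg_mul.
Proof.
move=> x; apply/ffunP=> g; rewrite ffunE (bigD1 1%g) //= big1 => [|h /negPf nh].
  by rewrite ffunE eqxx mul1r invg1 mul1g addr0.
by rewrite ffunE nh mul0r.
Qed.

Lemma galg_mul1r : right_id (lam 1%g) galg_mul.
Proof.
move=> x; apply/ffunP=> g; rewrite ffunE (bigD1 g) //= big1 => [|h nh].
  by rewrite ffunE mulVg eqxx mulr1 addr0.
by rewrite ffunE -eq_mulVg1 (negPf nh) mulr0.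
Qed.

Lemma galg_mulDl : left_distributive galg_mul +%R.
Proof.
move=> x y z; apply/ffunP=> g; rewrite !ffunE -big_split.
by apply: eq_bigr => h _; rewrite ffunE mulrDl.
Qed.

Lemma galg_mulDr : right_distributive galg_mul +%R.
Proof.
move=> x y z; apply/ffunP=> g; rewrite !ffunE -big_split.
by apply: eq_bigr => h _; rewrite ffunE mulrDr.
Qed.

Lemma galg_1neq0 : lam 1%g != 0.
Proof. by apply/eqP => /ffunP/(_ 1%g)/eqP; rewrite !ffunE eqxx oner_eq0. Qed.

HB.instance Definition _ := GRing.Zmodule_isNzRing.Build A
  galg_mulA galg_mul1l galg_mul1r galg_mulDl galg_mulDr galg_1neq0.

Fact galg_scaleAl (a : C) (x y : A) : a *: (x * y) = (a *: x) * y.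
Proof.
apply/ffunP=> g; rewrite !ffunE scaler_sumr.
by apply: eq_bigr => h _; rewrite ffunE -scalerAl.
Qed.
HB.instance Definition _ := GRing.Lmodule_isLalgebra.Build C A galg_scaleAl.

Fact galg_scaleAr (a : C) (x y : A) : a *: (x * y) = x * (a *: y).
Proof.
apply/ffunP=> g; rewrite !ffunE scaler_sumr.
by apply: eq_bigr => h _; rewrite ffunE -scalerAr.
Qed.
HB.instance Definition _ := GRing.Lalgebra_isAlgebra.Build C A galg_scaleAr.
HB.instance Definition _ := Algebra_isFalgebra.Build C A.

Lemma lam_mul (g h : gT) : lam g * lam h = lam (g * h)%g.
Proof.
apply/ffunP=> x; rewrite ffunE (bigD1 g) //= big1 => [|k /negPf nk].
  by rewrite !ffunE eqxx mul1r addr0 -(inj_eq (mulgI g)) mulKVg.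
by rewrite ffunE nk mul0r.
Qed.

End GroupAlgebra.

(* C[G] (x) C[G] is identified with C[G x G]. *)
Definition tens (C : fieldType) (gT : finGroupType) (x y : galg C gT) :
  galg C (gT * gT)%type := [ffun g => x g.1 * y g.2].

Definition tensv (C : fieldType) (gT : finGroupType) (U V : {vspace galg C gT}) :
  {vspace galg C (gT * gT)%type} :=
  <<[seq tens u v | u <- vbasis U, v <- vbasis V]>>%VS.

Definition star (C : numClosedFieldType) (gT : finGroupType) (x : galg C gT) :
  galg C gT := [ffun g => (x g^-1%g)^*].

Definition counit (C : fieldType) (gT : finGroupType) (x : galg C gT) : C :=
  \sum_g x g.

(* [dih n] is D_2n, of order 4n (for n >= 1); the pair (s, k) stands for
   b^s a^k. *)
Definition dih (n : nat) : Type := (bool * 'Z_(n.*2))%type.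
HB.instance Definition _ n := Finite.copy (dih n) (bool * 'Z_(n.*2))%type.

Section Dihedral.
Variable n : nat.

Definition dih_mul (x y : dih n) : dih n :=
  (x.1 (+) y.1, (if y.1 then - x.2 else x.2) + y.2).
Definition dih_one : dih n := (false, 0).
Definition dih_inv (x : dih n) : dih n :=
  (x.1, if x.1 then x.2 else - x.2).

Fact dih_mulA : associative dih_mul.
Proof.
move=> [s k] [t l] [u m]; congr pair; rewrite /= ?addbA //.
by case: t u => [] []; rewrite /= ?opprD ?opprK ?addrA.
Qed.
Fact dih_mul1 : left_id dih_one dih_mul.
Proof. by move=> [[] k]; congr pair; rewrite /= ?oppr0 add0r. Qed.
Fact dih_mulV : left_inverse dih_one dih_inv dih_mul.
Proof. by move=> [[] k]; congr pair; rewrite /= addNr. Qed.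

HB.instance Definition _ :=
  Finite_isGroup.Build (dih n) dih_mulA dih_mul1 dih_mulV.

Definition dih_a : dih n := (false, 1).
Definition dih_b : dih n := (true, 0).

Fact card_dih : (0 < n)%N -> #|{: dih n}| = (4 * n)%N.
Proof.
move=> n_gt0; rewrite card_prod card_bool card_ord Zp_cast.
  by rewrite -mul2n mulnA.
by case: n n_gt0.
Qed.

Fact dih_pres : [/\ dih_a ^+ n.*2 = 1, dih_b ^+ 2 = 1 &
  dih_b * dih_a = dih_a^-1 * dih_b]%g.
Proof.
have eq_dih (u v : dih n) : u.1 = v.1 -> u.2 = v.2 -> u = v.
  by case: u v => [? ?] [? ?] /= -> ->.
have a2n : (n.*2)%:R = 0 :> 'Z_(n.*2).
  by case: n => [|m] //; rewrite pchar_Zp.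
have ha k : (dih_a ^+ k)%g = (false, k%:R) :> dih n.
  by elim: k => [|k IH] //; rewrite expgS IH; apply: eq_dih; rewrite //= -natr1 addrC.
split; first by rewrite ha a2n.
  by apply: eq_dih; rewrite /= ?oppr0 ?addr0.
apply: eq_dih => //.
exact: etrans (add0r _) (esym (etrans (addr0 _) (opprK _))).
Qed.

End Dihedral.

Section KacAlgebra.
Variables (R : realType) (n : nat).

Definition KD : falgType R[i] := galg R[i] (dih n).
Definition KD2 : falgType R[i] := galg R[i] (dih n * dih n)%type.

Definition expi (t : R) : R[i] := Complex (cos t) (sin t).

Local Notation a := (dih_a n).
Local Notation b := (dih_b n).

Definition kd_h (i : 'I_4) : dih n := nth 1%g [:: 1; a ^+ n; b; b * a ^+ n]%g i.

Definition kd_c : 'M[R[i]]_4 :=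
  let nu : R[i] := -1 + 2 * 'i in
  8^-1 *: \matrix_(i, j) nth 0 (nth [::]
    [:: [:: 5; 1;    1;    1];
        [:: 1; 1;    nu^*; nu];
        [:: 1; nu;   1;    nu^*];
        [:: 1; nu^*; nu;   1]] i) j.

Definition kd_Omega : KD2 :=
  \sum_i \sum_j kd_c i j *: tens (lam _ (kd_h i)) (lam _ (kd_h j)).

Definition Delta_s (x : KD) : KD2 := \sum_g x g *: tens (lam _ g) (lam _ g).

Definition Delta (x : KD) : KD2 := kd_Omega * Delta_s x * star kd_Omega.

Definition coideal_subalgebra (I : {vspace KD}) : Prop :=
  [/\ 1 \in I,
      forall x y, x \in I -> y \in I -> x * y \in I,
      forall x, x \in I -> star x \in I
    & forall x, x \in I -> Delta x \in tensv fullv I].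

(* Such a p is unique when it exists: p = counit p' *: p = p' * p, and the
   adjoint of the symmetric identity gives p' * p = p'. *)
Definition jones_projection (I : {vspace KD}) (p : KD) : Prop :=
  [/\ p \in I, p != 0, p * p = p, star p = p
    & forall y, y \in I -> y * p = counit y *: p].

Definition covers (I J : {vspace KD}) : Prop :=
  [/\ coideal_subalgebra I, coideal_subalgebra J, (I <= J)%VS, I != J
    & forall M, coideal_subalgebra M -> (I <= M)%VS -> (M <= J)%VS ->
        M = I \/ M = J].

Local Notation la k := (lam R[i] (a ^+ k)%g : KD).
Local Notation lba k := (lam R[i] (b * a ^+ k)%g : KD).

Definition e1 : KD := (4 * n)%:R^-1 *: \sum_(k < n.*2) (la k + lba k).
Definition e2 : KD := (4 * n)%:R^-1 *: \sum_(k < n.*2) (la k - lba k).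
Definition e3 : KD :=
  (4 * n)%:R^-1 *: \sum_(k < n.*2) (-1) ^+ k *: (la k - lba k).
Definition e4 : KD :=
  (4 * n)%:R^-1 *: \sum_(k < n.*2) (-1) ^+ k *: (la k + lba k).

Definition eps : R[i] := expi (pi / n%:R).

Definition e11 (j : nat) : KD :=
  (2 * n)%:R^-1 *: \sum_(k < n.*2) eps ^- (j * k) *: la k.
Definition e22 (j : nat) : KD :=
  (2 * n)%:R^-1 *: \sum_(k < n.*2) eps ^+ (j * k) *: la k.
Definition e12 (j : nat) : KD :=
  (2 * n)%:R^-1 *: \sum_(k < n.*2) eps ^+ (j * k) *: lba k.
Definition e21 (j : nat) : KD :=
  (2 * n)%:R^-1 *: \sum_(k < n.*2) eps ^- (j * k) *: lba k.

Definition r11 (j : nat) : KD :=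
  2^-1 *: (e11 j - 'i *: e12 j + 'i *: e21 j + e22 j).
Definition r22 (j : nat) : KD :=
  2^-1 *: (e11 j + 'i *: e12 j - 'i *: e21 j + e22 j).
Definition p11 (j : nat) : KD := 2^-1 *: (e11 j + e12 j + e21 j + e22 j).
Definition p22 (j : nat) : KD := 2^-1 *: (e11 j - e12 j - e21 j + e22 j).

(* q(0, beta, j) *)
Definition q0 (beta : R) (j : nat) : KD :=
  2^-1 *: (e11 j + expi (- beta) *: e12 j + expi beta *: e21 j + e22 j).

Definition p1 : KD := \sum_(1 <= j < n | odd j) p11 j.
Definition p2 : KD := \sum_(1 <= j < n | odd j) p22 j.
Definition q1 : KD := \sum_(1 <= j < n | ~~ odd j) p11 j.
Definition q2 : KD := \sum_(1 <= j < n | ~~ odd j) p22 j.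

End KacAlgebra.

Inductive node : Set :=
| CC
| I0 | I1 | I2 | I3 | I4
| L1 | L3 | L5
| J0 | J1 | J2 | J3 | J4 | J5 | J20
| K1 | K21 | K22 | K23 | K24 | K25 | K26 | K41 | K42
| K0 | K01 | K02
| K2 | K3 | K4
| KD6.

Fact node_eq_dec : comparable node.
Proof. by rewrite /comparable /decidable; decide equality. Qed.
HB.instance Definition _ := hasDecEq.Build node (compareP node_eq_dec).

Definition node_dim (x : node) : nat :=
  match x with
  | CC => 1
  | I0 | I1 | I2 | I3 | I4 => 2
  | L1 | L3 | L5 => 3
  | J0 | J1 | J2 | J3 | J4 | J5 | J20 => 4
  | K1 | K21 | K22 | K23 | K24 | K25 | K26 | K41 | K42 => 6
  | K0 | K01 | K02 => 8
  | K2 | K3 | K4 => 12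
  | KD6 => 24
  end.

(* Edges of the Hasse diagram, upwards. If I <= J then p_I * p_J = p_J for the
   Jones projections. The published diagram violates this: it joins I3 to K21,
   K22, K23 and I4 to K24, K25, K26, although r11 j and r22 j are orthogonal (so
   p_I3 * p_K21 = e1 + e2, for example), and it lacks the edges from L1 to K21,
   K26, from L3 to K22, K25 and from L5 to K23, K24. These edges are listed here
   as the projections below force them; all the others are the published ones. *)
Definition upper (x : node) : seq node :=
  match x with
  | CC => [:: I0; I1; I2; I3; I4; L1; L3; L5]
  | I0 => [:: J0; J1; J2; J3; J4; J5; J20; K1]
  | I1 => [:: J0; K41]
  | I2 => [:: J0; K42]
  | I3 => [:: J20; K22; K24; K26]
  | I4 => [:: J20; K21; K23; K25]
  | L1 => [:: K1; K21; K26]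
  | L3 => [:: K1; K41; K42; K22; K25]
  | L5 => [:: K1; K23; K24]
  | J0 => [:: K0; K4]
  | J1 => [:: K01; K3]
  | J2 => [:: K02; K4]
  | J3 => [:: K0; K3]
  | J4 => [:: K01; K4]
  | J5 => [:: K02; K3]
  | J20 => [:: K0; K01; K02; K2]
  | K1 => [:: K2; K3; K4]
  | K21 | K22 | K23 | K24 | K25 | K26 => [:: K2]
  | K41 | K42 => [:: K4]
  | K0 | K01 | K02 | K2 | K3 | K4 => [:: KD6]
  | KD6 => [::]
  end.

Section Nodes.
Variable R : realType.
Local Notation e1 := (e1 R 6).
Local Notation e2 := (e2 R 6).
Local Notation e3 := (e3 R 6).
Local Notation e4 := (e4 R 6).
Local Notation e11 := (e11 R 6).
Local Notation e22 := (e22 R 6).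
Local Notation r11 := (r11 R 6).
Local Notation r22 := (r22 R 6).
Local Notation p11 := (p11 R 6).
Local Notation p22 := (p22 R 6).
Local Notation p1 := (p1 R 6).
Local Notation p2 := (p2 R 6).
Local Notation q1 := (q1 R 6).
Local Notation q2 := (q2 R 6).
Local Notation q0 := (@q0 R 6).

Definition node_projection (x : node) : option (KD R 6) :=
  match x with
  | CC | KD6 => None
  | I0 => Some (e1 + e2 + e3 + e4 + q1 + q2)
  | I1 => Some (e1 + e4 + q1 + p2)
  | I2 => Some (e1 + e4 + q1 + p1)
  | I3 => Some (e1 + e2 + e11 4 + e22 4 + r22 1 + r11 3 + r22 5)
  | I4 => Some (e1 + e2 + e11 4 + e22 4 + r11 1 + r22 3 + r11 5)
  | L1 => Some (e1 + e2 + e3 + e4 + r11 1 + r22 5)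
  | L3 => Some (e1 + e2 + e3 + e4 + r11 3 + r22 3)
  | L5 => Some (e1 + e2 + e3 + e4 + r11 5 + r22 1)
  | J0 => Some (e1 + e4 + q1)
  | J1 => Some (e1 + e3 + q0 (pi / 3) 2 + q0 (2 * pi / 3) 4)
  | J2 => Some (e1 + e4 + q0 (2 * pi / 3) 2 + q0 (4 * pi / 3) 4)
  | J3 => Some (e1 + e3 + p22 2 + p11 4)
  | J4 => Some (e1 + e4 + q0 (4 * pi / 3) 2 + q0 (2 * pi / 3) 4)
  | J5 => Some (e1 + e3 + q0 (5 * pi / 3) 2 + q0 (4 * pi / 3) 4)
  | J20 => Some (e1 + e2 + e11 4 + e22 4)
  | K1 => Some (e1 + e2 + e3 + e4)
  | K21 => Some (e1 + e2 + r11 1)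
  | K22 => Some (e1 + e2 + r11 3)
  | K23 => Some (e1 + e2 + r11 5)
  | K24 => Some (e1 + e2 + r22 1)
  | K25 => Some (e1 + e2 + r22 3)
  | K26 => Some (e1 + e2 + r22 5)
  | K41 => Some (e1 + e4 + p22 3)
  | K42 => Some (e1 + e4 + p11 3)
  | K0 => Some (e1 + p11 4)
  | K01 => Some (e1 + q0 (2 * pi / 3) 4)
  | K02 => Some (e1 + q0 (4 * pi / 3) 4)
  | K2 => Some (e1 + e2)
  | K3 => Some (e1 + e3)
  | K4 => Some (e1 + e4)
  end.

Definition denotes (x : node) (I : {vspace KD R 6}) : Prop :=
  match node_projection x with
  | Some p => coideal_subalgebra I /\ jones_projection I p
  | None => I = if x is CC then 1%VS else fullv
  end.

End Nodes.

(* Main.v *)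
From Stdlib Require Import ZArith.
From HB Require Import structures.
Require Import Defs.
From mathcomp Require Import all_boot all_order all_algebra all_fingroup all_field.
From mathcomp Require Import reals trigo complex.
From mathcomp Require Import boolp ring lra ssrZ.

Set Implicit Arguments.
Unset Strict Implicit.
Unset Printing Implicit Defensive.

Import Order.TTheory GRing.Theory Num.Theory.
Local Open Scope ring_scope.

Local Notation Z12 := 'Z_(6.*2).

(** Let a and b generate the dihedral group of order 24, let P = (1 + a^6)/2 and
Q = (1 - a^6)/2, and for k in Z/12 put X_k = P a^k and Y_k = Q t_k, where
  t_k = (a^k + a^-k)/2 + (i/2) b (a^-k - a^k).
The addition formulas of cosine and sine give t_k t_l = t_{k+l}, and b t_k = t_{-k} b.
Hence X_k X_l = X_{k+l}, Y_k Y_l = Y_{k+l} and X_k Y_l = Y_l X_k = 0; also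
X_{k+6} = X_k and Y_{k+6} = - Y_k, and the 24 elements b^s X_k, b^s Y_k with
s = 0, 1 and 0 <= k < 6 form an orthogonal basis. What makes this basis useful is
that it simplifies the twisted coproduct ([KX_Delta], [KY_Delta]):
  Delta (b^s X_k) = b^s X_k (x) b^s X_k + b^s Y_k (x) b^s Y_{-k},
  Delta (b^s Y_k) = b^s X_k (x) b^s Y_k + b^s Y_k (x) b^s X_{-k}.

Pairing the first leg of Delta x with a basis vector therefore extracts the part of x
in one of the planes b^s (C X_k + C Y_k), or this part with its two coordinates
exchanged and k replaced by -k ([coideal_slice]). So a coideal subalgebra I is the
same as a family of subspaces U s k of C^2, namely the (v, w) such that
b^s (v X_k + w Y_k) is in I, which is closed under the componentwise product
U s k * U t l into U (s + t) (+-k + l), under the adjoint, under the exchange of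
coordinates from k to -k, and under the change of sign of w from k to k + 6. Only
k = 0, 1, 2, 3 matter. For k = 0 and k = 3 the exchange is an involution, or a square
root of -1, of U s k, so U s k is spanned by some of the vectors (1, 1), (1, -1),
respectively (1, i), (1, -i). For k = 1 and k = 2, U s k is zero, a line or C^2, and
products and adjoints leave only finitely many slopes. Discussing which of these
blocks vanish leaves 32 families ([classification]), one for each node.

Conversely each of these families spans a coideal subalgebra [node_space]. Its
generators are orthogonal, with coordinates in Z[zeta], zeta = exp (i pi / 6), so
that the closure under the operations, the values of the Jones projections and the
inclusions are decided by computations with integer coordinates. The Jones projection
of a coideal subalgebra is unique, and the 32 projections are distinct, so that they
identify the subspaces ([denotesP]). Finally the inclusions [L_le] and the
classification give the covering relation. *)

(** * A dihedral group algebra with a twisted second half *)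

(** In a group algebra, [d s k] is the element b^s a^k of a dihedral group whose
rotations form the abelian group [V], and [c] is a rotation of order two. The
algebra is the sum of its ideals cut out by the central idempotents [Pe] and [Qe]; the
group basis is kept on the first one and twisted on the second one. *)
Section TwistedBasis.
Variables (C : numClosedFieldType) (A : algType C) (V : zmodType).
Variables (c : V) (d : bool -> V -> A).
Hypothesis c2 : c + c = 0.
Hypothesis d1 : d false 0 = 1.
Hypothesis dM : forall s k t l,
  d s k * d t l = d (s (+) t) ((if t then - k else k) + l).

Definition Pe : A := 2^-1 *: (1 + d false c).
Definition Qe : A := 2^-1 *: (1 - d false c).
(** The twisted rotation: half the sum of [S k], which behaves like 2 cos, and of
[D k], which behaves like 2 i sin. *)
Definition tw (k : V) : A :=
  2^-1 *: (d false k + d false (- k)) + ('i / 2) *: (d true (- k) - d true k).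
Definition X s k := Pe * d s k.
Definition Y s k := Qe * d s 0 * tw k.

Let oppc : - c = c.
Proof. by apply/eqP; rewrite eq_sym -addr_eq0 c2. Qed.

Let half2 (W : lmodType C) (v : W) : 2^-1 *: (v + v) = v.
Proof.
by rewrite -mulr2n -(scaler_nat 2 v) scalerA mulVf ?scale1r // pnatr_eq0.
Qed.

Let S k := d false k + d false (- k).
Let D k := 'i *: (d true (- k) - d true k).

Let twE k : tw k = 2^-1 *: (S k + D k).
Proof. by rewrite /tw [RHS]scalerDr scalerA [_ * 'i]mulrC. Qed.

Let SN k : S (- k) = S k. Proof. by rewrite /S opprK addrC. Qed.
Let DN k : D (- k) = - D k. Proof. by rewrite /D opprK -scalerN opprB. Qed.

(* The next four identities are the addition formulas of cosine and sine. *)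
Let SS k l : S k * S l = S (k + l) + S (k - l).
Proof.
rewrite /S mulrDl !mulrDr !dM /= !opprB !opprD.
by rewrite [d _ (- k + l) + _]addrC addrACA [- k + l]addrC.
Qed.

Let SD k l : S k * D l = D (k + l) - D (k - l).
Proof.
rewrite /S /D -scalerAr -scalerBr mulrDl !mulrBr !dM /= !opprB !opprD !opprK.
congr (_ *: _); rewrite addrACA [RHS]addrACA [- k + l]addrC.
by rewrite [- d _ (l - k) - _]addrC.
Qed.

Let DS k l : D k * S l = D (k + l) + D (k - l).
Proof.
rewrite /S /D -scalerAl -scalerDr mulrBl !mulrDr !dM /= !opprB !opprD.
by congr (_ *: _); rewrite [d _ (- k + l) + _]addrC addrACA [- k + l]addrC.
Qed.

Let DD k l : D k * D l = S (k + l) - S (k - l).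
Proof.
rewrite /S /D -scalerAl -scalerAr scalerA -expr2 sqrCi scaleN1r.
rewrite mulrBl !mulrBr !dM /= !opprK !opprB !opprD.
rewrite [RHS]addrACA addrC.
by rewrite [- k + l]addrC.
Qed.

Lemma twM k l : tw k * tw l = tw (k + l).
Proof.
rewrite !twE -scalerAl -scalerAr; congr (_ *: _).
have expand (s s' e e' : A) : (s + e) * (s' + e') = s * s' + s * e' + (e * s' + e * e').
  by rewrite mulrDl !mulrDr.
rewrite expand SS SD DS DD.
rewrite -[RHS]half2; congr (_ *: _).
move: (S _) (S (k - l)) (D _) (D (k - l)) => u v w z.
rewrite [w + z + _]addrC addrACA [u + v + _]addrACA subrr addr0.
by rewrite [w - z + _]addrACA addNr addr0 addrACA.
Qed.

Let b := d true 0.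

(* Conjugation by b exchanges k and -k, since [D] is odd and is formed of flips. *)
Let Dtw k : b * tw k = tw (- k) * b.
Proof.
rewrite !twE SN DN -scalerAl -scalerAr /S /D; congr (_ *: _).
rewrite mulrDl mulrDr mulNr -scalerAl -scalerAr -scalerN mulrDl mulrDr.
rewrite mulrBl mulrBr /b !dM /= !oppr0 !add0r !addr0 opprK opprB.
by rewrite [d true (- k) + _]addrC.
Qed.

Let dP s k : d s k * Pe = Pe * d s k.
Proof.
rewrite /Pe -scalerAl -scalerAr mulrDl mulrDr mul1r mulr1 !dM addbF /=.
by case: s; rewrite ?oppc [c + k]addrC.
Qed.
Let dQ s k : d s k * Qe = Qe * d s k.
Proof.
rewrite /Qe -scalerAl -scalerAr mulrBl mulrBr mul1r mulr1 !dM addbF /=.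
by case: s; rewrite ?oppc [c + k]addrC.
Qed.

Let cP : d false c * Pe = Pe.
Proof. by rewrite /Pe -scalerAr mulrDr mulr1 dM c2 d1 addrC. Qed.
Let cQ : d false c * Qe = - Qe.
Proof. by rewrite /Qe -scalerAr mulrBr mulr1 dM c2 d1 -scalerN opprB. Qed.
Let PP : Pe * Pe = Pe.
Proof. by rewrite {1}/Pe -scalerAl mulrDl mul1r cP half2. Qed.
Let QQ : Qe * Qe = Qe.
Proof. by rewrite {1}/Qe -scalerAl mulrBl mul1r cQ opprK half2. Qed.
Let QP : Qe * Pe = 0.
Proof. by rewrite {1}/Qe -scalerAl mulrBl mul1r cP subrr scaler0. Qed.
Let PQ : Pe * Qe = 0.
Proof. by rewrite {1}/Pe -scalerAl mulrDl mul1r cQ subrr scaler0. Qed.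
Let PQ1 : Pe + Qe = 1.
Proof.
by rewrite /Pe /Qe -scalerDr addrACA subrr addr0 half2.
Qed.
Let tw_comm q k : (forall s m, d s m * q = q * d s m) -> tw k * q = q * tw k.
Proof.
move=> qd; rewrite /tw mulrDl mulrDr -!scalerAl -!scalerAr.
by rewrite mulrDl mulrDr mulrBl mulrBr !qd.
Qed.
Let twQ k : tw k * Qe = Qe * tw k. Proof. by apply: tw_comm => s m; apply: dQ. Qed.
Let twP k : tw k * Pe = Pe * tw k. Proof. by apply: tw_comm => s m; apply: dP. Qed.

Lemma XM s k t l : X s k * X t l = X (s (+) t) ((if t then - k else k) + l).
Proof. by rewrite /X mulrA -(mulrA Pe) dP mulrA PP -mulrA dM. Qed.

Lemma YM s k t l : Y s k * Y t l = Y (s (+) t) ((if t then - k else k) + l).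
Proof.
rewrite /Y -!mulrA (mulrA (tw k)) twQ -!mulrA (mulrA (d s 0)) dQ -!mulrA.
rewrite (mulrA Qe) QQ; congr (_ * _).
have -> : tw k * (d t 0 * tw l) = d t 0 * tw ((if t then - k else k) + l).
  case: t; last by rewrite d1 !mul1r twM.
  by rewrite mulrA -(opprK k) -Dtw -mulrA opprK twM.
by rewrite mulrA dM addr0; case: t; rewrite ?oppr0.
Qed.

Lemma XY0 s k t l : X s k * Y t l = 0.
Proof. by rewrite /X /Y !mulrA -(mulrA Pe) dQ !mulrA PQ !mul0r. Qed.

Lemma YX0 s k t l : Y s k * X t l = 0.
Proof.
by rewrite /X /Y !mulrA -(mulrA _ (tw k)) twP !mulrA -(mulrA Qe) dP !mulrA QP !mul0r.
Qed.

Lemma Xshift s k : X s (k + c) = X s k.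
Proof.
have e : d s (k + c) = d s k * d false c by rewrite dM addbF.
by rewrite /X e mulrA -dP -mulrA -dP cP.
Qed.

(** The twisted rotation by [c] is [d false c] itself, which acts as -1 on [Qe]. *)
Lemma Yshift s k : Y s (k + c) = - Y s k.
Proof.
have twc : tw c = d false c by rewrite /tw oppc subrr scaler0 addr0 half2.
rewrite /Y [k + c]addrC -twM twc mulrA -(dQ s) -(mulrA _ Qe) -(dQ false) cQ.
by rewrite mulrN mulNr.
Qed.

(** Shows that the [X] and [Y] span the group elements: [tw k + tw (- k)] and
[tw k - tw (- k)] give back the symmetric and antisymmetric sums. *)
Lemma dXY s k : d s k = X s k + 2^-1 *: (Y s k + Y s (- k))
   + ('i / 2) *: (Y (~~ s) k - Y (~~ s) (- k)).
Proof.
have twD : tw k + tw (- k) = S k.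
  by rewrite !twE SN DN -scalerDr addrACA subrr addr0 half2.
have twB : tw k - tw (- k) = D k.
  by rewrite !twE SN DN -scalerBr opprD opprK addrACA subrr add0r half2.
rewrite -[LHS]mul1r -PQ1 mulrDl -addrA /X; congr (_ + _).
rewrite /Y -mulrDr -mulrBr twD twB /S /D -scalerAr scalerA mulrAC -expr2 sqrCi.
rewrite mulN1r scaleNr -scalerBr -!mulrA -mulrBr scalerAr; congr (_ * _).
rewrite mulrDr mulrBr !dM addbF addbT negbK !oppr0 !add0r opprB.
by rewrite addrACA subrr addr0 half2.
Qed.

Section Star.
Variable star : A -> A.
Hypothesis starD : forall x y, star (x + y) = star x + star y.
Hypothesis starZ : forall a x, star (a *: x) = a^* *: star x.
Hypothesis starM : forall x y, star (x * y) = star y * star x.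
Hypothesis starE : forall s k, star (d s k) = d s (if s then k else - k).

Let starB x y : star (x - y) = star x - star y.
Proof. by rewrite starD -!scaleN1r starZ rmorphN1. Qed.

Let star1 : star 1 = 1. Proof. by rewrite -d1 starE oppr0. Qed.

Let conj2 : (2^-1 : C)^* = 2^-1. Proof. by rewrite fmorphV rmorph_nat. Qed.

Lemma XJ s k : star (X s k) = X s (if s then k else - k).
Proof.
have PJ : star Pe = Pe by rewrite /Pe starZ starD star1 starE oppc conj2.
by rewrite /X starM PJ starE dP.
Qed.

Lemma YJ s k : star (Y s k) = Y s (if s then k else - k).
Proof.
have QJ : star Qe = Qe by rewrite /Qe starZ starB star1 starE oppc conj2.
have twJ : star (tw k) = tw (- k).
  rewrite /tw starD !starZ starD starB !starE opprK rmorphM /= conj2 conjCi.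
  by rewrite [d false (- k) + _]addrC mulNr scaleNr -scalerN opprB.
rewrite /Y !starM QJ twJ starE oppr0 if_same dQ mulrA twQ -!mulrA.
by case: s; rewrite ?d1 ?mulr1 ?mul1r // -Dtw.
Qed.
End Star.

End TwistedBasis.

(** * Exact computations over the integers of the twelfth cyclotomic field *)

(** The integer a + b zeta + c zeta^2 + d zeta^3 of the twelfth cyclotomic field, where
zeta^4 = zeta^2 - 1. *)
Inductive cyc := Cyc (a b c d : Z).

Definition cyc_tuple (x : cyc) := let: Cyc a b c d := x in (a, b, c, d).
Definition tuple_cyc (t : Z * Z * Z * Z) := let: (a, b, c, d) := t in Cyc a b c d.
Lemma cyc_tupleK : cancel cyc_tuple tuple_cyc. Proof. by case. Qed.
HB.instance Definition _ := Equality.copy cyc (can_type cyc_tupleK).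

Definition cyc_add (x y : cyc) :=
  let: Cyc a b c d := x in let: Cyc a' b' c' d' := y in
  Cyc (a + a')%Z (b + b')%Z (c + c')%Z (d + d')%Z.
Definition cyc_mul (x y : cyc) :=
  let: Cyc a b c d := x in let: Cyc a' b' c' d' := y in
  let r4 := (b * d' + c * c' + d * b')%Z in
  let r5 := (c * d' + d * c')%Z in
  Cyc (a * a' - r4 - d * d')%Z (a * b' + b * a' - r5)%Z
      (a * c' + b * b' + c * a' + r4)%Z (a * d' + b * c' + c * b' + d * a' + r5)%Z.
Definition cyc_conj (x : cyc) :=
  let: Cyc a b c d := x in Cyc (a + c)%Z b (- c)%Z (- b - d)%Z.
Definition cyc_int (z : Z) := Cyc z 0 0 0.
Definition cyc_eq0 (x : cyc) :=
  let: Cyc a b c d := x in [&& Z.eqb a 0, Z.eqb b 0, Z.eqb c 0 & Z.eqb d 0].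
Definition cyc_pow (n : nat) := nth (cyc_int 0)
  [:: Cyc 1 0 0 0; Cyc 0 1 0 0; Cyc 0 0 1 0; Cyc 0 0 0 1; Cyc (-1) 0 1 0; Cyc 0 (-1) 0 1;
      Cyc (-1) 0 0 0; Cyc 0 (-1) 0 0; Cyc 0 0 (-1) 0; Cyc 0 0 0 (-1); Cyc 1 0 (-1) 0; Cyc 0 1 0 (-1)] (n %% 12).
(** The image of [x] under zeta |-> zeta^k, an automorphism when k is prime to 12. *)
Definition cyc_gal (k : nat) (x : cyc) :=
  let: Cyc a b c d := x in
  cyc_add (cyc_add (cyc_int a) (cyc_mul (cyc_int b) (cyc_pow k)))
   (cyc_add (cyc_mul (cyc_int c) (cyc_pow (2 * k))) (cyc_mul (cyc_int d) (cyc_pow (3 * k)))).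
(** Checks that the norm, the product of the four conjugates, is a nonzero integer. *)
Definition cyc_neq0 (x : cyc) :=
  let y := cyc_mul (cyc_gal 5 x) (cyc_mul (cyc_gal 7 x) (cyc_gal 11 x)) in
  let: Cyc n b c d := cyc_mul x y in
  [&& ~~ Z.eqb n 0, Z.eqb b 0, Z.eqb c 0 & Z.eqb d 0].

Section Value.
Variables (C : numClosedFieldType) (zeta : C).
Hypothesis zeta4 : zeta ^+ 4 = zeta ^+ 2 - 1.
Hypothesis zetaJ : zeta^* = zeta ^+ 11.

Let zr (z : Z) : C := (int_of_Z z)%:~R.
Definition cyc_val (x : cyc) : C :=
  let: Cyc a b c d := x in zr a + zr b * zeta + zr c * zeta ^+ 2 + zr d * zeta ^+ 3.

Local Notation cval := cyc_val.

Let zrD a b : zr (a + b)%Z = zr a + zr b. Proof. by rewrite /zr -rmorphD -rmorphD. Qed.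
Let zrN a : zr (- a)%Z = - zr a. Proof. by rewrite /zr -rmorphN -rmorphN. Qed.
Let zrB a b : zr (a - b)%Z = zr a - zr b. Proof. by rewrite zrD zrN. Qed.
Let zrM a b : zr (a * b)%Z = zr a * zr b. Proof. by rewrite /zr -rmorphM -rmorphM. Qed.

Let zeta5 : zeta ^+ 5 = zeta ^+ 3 - zeta.
Proof. by rewrite exprS zeta4 mulrBr mulr1 -exprS. Qed.
Let zeta6 : zeta ^+ 6 = -1.
Proof. by rewrite exprS zeta5 mulrBr -exprS zeta4 -expr2 addrAC subrr add0r. Qed.

Lemma cval_int z : cval (cyc_int z) = zr z.
Proof. by rewrite /= /zr !mul0r !addr0. Qed.
Lemma cval1 : cval (cyc_int 1) = 1. Proof. by rewrite cval_int. Qed.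

Lemma cvalD x y : cval (cyc_add x y) = cval x + cval y.
Proof. by case: x y => a b c d [a' b' c' d'] /=; rewrite !zrD; ring. Qed.

Lemma cvalM x y : cval (cyc_mul x y) = cval x * cval y.
Proof.
case: x y => a b c d [a' b' c' d'] /=; rewrite !(zrD, zrB, zrM).
set A := zr a; set B := zr b; set D := zr c; set E := zr d.
set A' := zr a'; set B' := zr b'; set D' := zr c'; set E' := zr d'.
transitivity (A * A' + (A * B' + B * A') * zeta + (A * D' + B * B' + D * A') * zeta ^+ 2
  + (A * E' + B * D' + D * B' + E * A') * zeta ^+ 3
  + (B * E' + D * D' + E * B') * zeta ^+ 4 + (D * E' + E * D') * zeta ^+ 5
  + E * E' * zeta ^+ 6); last ring.
by rewrite zeta6 zeta5 zeta4; ring.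
Qed.

Lemma cvalJ x : cval (cyc_conj x) = (cval x)^*.
Proof.
case: x => a b c d /=.
have zrJ z : (zr z)^* = zr z by rewrite rmorph_int.
have termJ z m : (zr z * zeta ^+ m)^* = zr z * (zeta ^+ 11) ^+ m.
  by rewrite rmorphM rmorphXn /= zrJ zetaJ.
rewrite !rmorphD /= zrJ !termJ -[zr b * zeta]/(zr b * zeta ^+ 1) termJ expr1.
rewrite !(zrB, zrD, zrN).
have -> : zeta ^+ 11 = zeta - zeta ^+ 3.
  by rewrite (exprD zeta 6 5) zeta6 zeta5 mulN1r opprB.
have -> : (zeta - zeta ^+ 3) ^+ 2 = zeta ^+ 2 - 2 * zeta ^+ 4 + zeta ^+ 6 by ring.
have -> : (zeta - zeta ^+ 3) ^+ 3
  = zeta ^+ 3 - 3 * zeta ^+ 5 + 3 * zeta * zeta ^+ 6 - zeta ^+ 3 * zeta ^+ 6 by ring.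
by rewrite zeta6 zeta5 zeta4; ring.
Qed.

Lemma cval_pow n : cval (cyc_pow n) = zeta ^+ n.
Proof.
have zeta12 : zeta ^+ 12 = 1 by rewrite (exprM zeta 6 2) zeta6 sqrrN expr1n.
have p6 k : zeta ^+ (6 + k) = - zeta ^+ k by rewrite exprD zeta6 mulN1r.
rewrite {2}(divn_eq n 12) exprD mulnC exprM zeta12 expr1n mul1r /cyc_pow.
have: (n %% 12 < 12)%N by rewrite ltn_mod.
have zr0 : zr 0 = 0 by [].
have zr1 : zr 1 = 1 by [].
have zrN1 : zr (-1) = -1 by [].
case: (n %% 12)%N => [|[|[|[|[|[|[|[|[|[|[|[|//]]]]]]]]]]]] _ /=; rewrite ?zr0 ?zr1 ?zrN1.
- by rewrite expr0; ring.
- by rewrite expr1; ring.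
- by ring.
- by ring.
- by rewrite zeta4; ring.
- by rewrite zeta5; ring.
- by rewrite zeta6; ring.
- by rewrite (p6 1%N); ring.
- by rewrite (p6 2%N); ring.
- by rewrite (p6 3%N); ring.
- by rewrite (p6 4%N) zeta4; ring.
- by rewrite (p6 5%N) zeta5; ring.
Qed.

Lemma cyc_eq0P x : cyc_eq0 x -> cval x = 0.
Proof.
case: x => a b c d /and4P[/Z.eqb_spec-> /Z.eqb_spec-> /Z.eqb_spec-> /Z.eqb_spec->].
by rewrite /= /zr !mul0r !addr0.
Qed.

(** A vanishing factor would make the norm vanish, and an integer is zero in [C] only if
it is zero. *)
Lemma cyc_neq0P x : cyc_neq0 x -> cval x != 0.
Proof.
rewrite /cyc_neq0; set y := cyc_mul (cyc_gal 5 x) _.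
have := cvalM x y; case: (cyc_mul x y) => n b c d xy.
case/and4P=> n0 /Z.eqb_spec b0 /Z.eqb_spec c0 /Z.eqb_spec d0.
apply: contraNneq n0 => x0; move: xy.
rewrite b0 c0 d0 x0 mul0r /= /zr !mul0r !addr0 => /eqP.
rewrite intr_eq0 => /eqP n0; apply/Z.eqb_spec.
by rewrite -(int_of_ZK n) n0.
Qed.

End Value.

Section Formal.
Variable T : eqType.

(** Formal combinations of elements of [T] with cyclotomic coefficients; an element of
[T] may occur several times. *)
Definition form := seq (cyc * T).
Definition scalef (c : cyc) (l : form) : form := [seq (cyc_mul c p.1, p.2) | p <- l].
Definition oppf := scalef (cyc_int (-1)).

Fixpoint insertf (p : cyc * T) (l : form) : form :=
  if l is q :: l' then
    if p.2 == q.2 then (cyc_add p.1 q.1, q.2) :: l' else q :: insertf p l'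
  else [:: p].
Definition collect (l : form) : form := foldr insertf [::] l.
Definition eqf (l m : form) := all (fun p => cyc_eq0 p.1) (collect (l ++ oppf m)).

Variable mu : T -> T -> form.
Definition mulf (l m : form) : form :=
  flatten [seq flatten [seq scalef (cyc_mul p.1 q.1) (mu p.2 q.2) | q <- m] | p <- l].
Variable st : T -> form.
Definition starf (l : form) : form :=
  flatten [seq scalef (cyc_conj p.1) (st p.2) | p <- l].

Variables (C : numClosedFieldType) (zeta : C).
Hypothesis zeta4 : zeta ^+ 4 = zeta ^+ 2 - 1.
Hypothesis zetaJ : zeta^* = zeta ^+ 11.
Notation cval := (cyc_val zeta).

Section Additive.
Variables (V : lmodType C) (beta : T -> V).

Definition evf (l : form) : V := \sum_(p <- l) cval p.1 *: beta p.2.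

Lemma evf_nil : evf [::] = 0. Proof. by rewrite /evf big_nil. Qed.
Lemma evf_cons p l : evf (p :: l) = cval p.1 *: beta p.2 + evf l.
Proof. by rewrite /evf big_cons. Qed.
Lemma evf1 p : evf [:: p] = cval p.1 *: beta p.2.
Proof. by rewrite evf_cons evf_nil addr0. Qed.
Lemma evf2 p q : evf [:: p; q] = cval p.1 *: beta p.2 + cval q.1 *: beta q.2.
Proof. by rewrite evf_cons evf1. Qed.
Lemma evf_cat l m : evf (l ++ m) = evf l + evf m.
Proof. by rewrite /evf big_cat. Qed.
Lemma evfZ c l : evf (scalef c l) = cval c *: evf l.
Proof.
rewrite /evf big_map scaler_sumr; apply: eq_bigr => p _.
by rewrite /= cvalM // scalerA.
Qed.
Lemma evfN l : evf (oppf l) = - evf l.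
Proof. by rewrite evfZ cval_int scaleN1r. Qed.
Lemma evf_flatten (ls : seq form) : evf (flatten ls) = \sum_(l <- ls) evf l.
Proof.
elim: ls => [|l ls IH]; first by rewrite evf_nil big_nil.
by rewrite /= evf_cat IH big_cons.
Qed.
Lemma evf_insert p l : evf (insertf p l) = cval p.1 *: beta p.2 + evf l.
Proof.
elim: l => [|q l IH] /=; first by rewrite evf1 evf_nil addr0.
case: eqP => [e|_]; last by rewrite !evf_cons IH addrCA.
by rewrite !evf_cons /= cvalD scalerDl e addrA.
Qed.
Lemma evf_collect l : evf (collect l) = evf l.
Proof. by elim: l => //= p l IH; rewrite evf_insert evf_cons IH. Qed.
Lemma eqfP l m : eqf l m -> evf l = evf m.
Proof.
move=> z; apply/eqP; rewrite -subr_eq0 -evfN -evf_cat -evf_collect; apply/eqP.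
move: z; rewrite /eqf; elim: (collect _) => [|p k IH] /=; first by rewrite evf_nil.
by case/andP=> /(cyc_eq0P zeta) z /IH e; rewrite evf_cons e z scale0r addr0.
Qed.
End Additive.

Section Multiplicative.
Variables (A : algType C) (beta : T -> A).
Hypothesis muP : forall s t, beta s * beta t = evf beta (mu s t).

Lemma evfM l m : evf beta (mulf l m) = evf beta l * evf beta m.
Proof.
rewrite evf_flatten big_map mulr_suml; apply: eq_bigr => p _.
rewrite evf_flatten big_map mulr_sumr; apply: eq_bigr => q _.
by rewrite evfZ cvalM // -muP -scalerAl -scalerAr scalerA.
Qed.

Variable star : A -> A.
Hypothesis starD : forall x y, star (x + y) = star x + star y.
Hypothesis starZ : forall a x, star (a *: x) = a^* *: star x.
Hypothesis stP : forall t, star (beta t) = evf beta (st t).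

Lemma evf_star l : evf beta (starf l) = star (evf beta l).
Proof.
have star0 : star 0 = 0 by rewrite -[in LHS](scale0r (0 : A)) starZ conjC0 scale0r.
rewrite evf_flatten big_map.
elim: l => [|p l IH]; first by rewrite big_nil evf_nil star0.
by rewrite big_cons evf_cons starD starZ IH evfZ cvalJ // stP.
Qed.
End Multiplicative.

End Formal.

Section Morphisms.
Variables (C : numClosedFieldType) (zeta : C).
Hypothesis zeta4 : zeta ^+ 4 = zeta ^+ 2 - 1.

Lemma evf_linear (T : eqType) (V W : lmodType C) (f : V -> W) (beta : T -> V) l :
    (forall x y, f (x + y) = f x + f y) -> (forall a x, f (a *: x) = a *: f x) ->
  f (evf zeta beta l) = evf zeta (f \o beta) l.
Proof.
move=> fD fZ; have f0 : f 0 = 0 by rewrite -[in LHS](scale0r (0 : V)) fZ scale0r.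
elim: l => [|p l IH]; first by rewrite !evf_nil.
by rewrite !evf_cons fD fZ IH.
Qed.

Definition tensf (T U : eqType) (l : form T) (m : form U) : form (T * U)%type :=
  flatten [seq [seq (cyc_mul p.1 q.1, (p.2, q.2)) | q <- m] | p <- l].

Lemma evf_bilinear (T U : eqType) (V V' W : lmodType C) (f : V -> V' -> W)
    (beta : T -> V) (beta' : U -> V') l m :
    (forall x y z, f (x + y) z = f x z + f y z) ->
    (forall a x z, f (a *: x) z = a *: f x z) ->
    (forall z x y, f z (x + y) = f z x + f z y) ->
    (forall a x z, f z (a *: x) = a *: f z x) ->
  f (evf zeta beta l) (evf zeta beta' m)
    = evf zeta (fun p => f (beta p.1) (beta' p.2)) (tensf l m).
Proof.
move=> fDl fZl fDr fZr.
rewrite (evf_linear (f := fun x => f x _)) // /tensf evf_flatten big_map.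
rewrite {1}/evf; apply: eq_bigr => p _; rewrite /= (evf_linear (f := f _)) //.
rewrite /evf big_map scaler_sumr; apply: eq_bigr => q _ /=.
by rewrite cvalM // scalerA.
Qed.
End Morphisms.

(** * Group algebras: adjoint, counit, inner product and slices *)

Lemma span_sum (F : fieldType) (V : vectType F) (s : seq V) v : v \in <<s>>%VS ->
  v = \sum_(i < size s) coord (in_tuple s) i v *: s`_i.
Proof. exact: (@coord_span _ _ _ (in_tuple s)). Qed.

Section GroupAlgebra.
Variables (C : numClosedFieldType) (gT : finGroupType).
Local Notation A := (galg C gT).
Local Notation A2 := (galg C (gT * gT)%type).
Implicit Types (x y z : A) (I : {vspace A}).

Lemma starD x y : star (x + y) = star x + star y.
Proof. by apply/ffunP => g; rewrite !ffunE rmorphD. Qed.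

Lemma starZ a x : star (a *: x) = a^* *: star x.
Proof. by apply/ffunP => g; rewrite !ffunE rmorphM. Qed.

Lemma star_lam (g : gT) : star (lam C g) = lam C g^-1%g.
Proof. by apply/ffunP => h; rewrite !ffunE rmorph_nat -(inj_eq invg_inj) invgK. Qed.

Lemma starM x y : star (x * y) = star y * star x.
Proof.
apply/ffunP => g; rewrite !ffunE rmorph_sum /=.
rewrite (reindex_inj (mulgI g^-1%g)) /=; apply: eq_bigr => h _.
by rewrite !ffunE rmorphM /= mulrC !invMg !invgK mulgK.
Qed.

Lemma galg_lam x : x = \sum_g x g *: lam C g.
Proof.
apply/ffunP => g; rewrite sum_ffunE (bigD1 g) //= big1 => [|h /negPf nh].
  by rewrite addr0 !ffunE eqxx [_ *: _]mulr1.
by rewrite !ffunE eq_sym nh [_ *: _]mulr0.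
Qed.

Lemma counitD x y : counit (x + y) = counit x + counit y.
Proof. by rewrite /counit -big_split; apply: eq_bigr => g _; rewrite ffunE. Qed.

Lemma counitZ a x : counit (a *: x) = a * counit x.
Proof. by rewrite /counit mulr_sumr; apply: eq_bigr => g _; rewrite ffunE. Qed.

Lemma counit_lam (g : gT) : counit (lam C g) = 1.
Proof.
rewrite /counit (bigD1 g) //= big1 => [|h /negPf nh]; rewrite !ffunE ?eqxx ?addr0 //.
by rewrite nh.
Qed.

(** The inner product for which the group elements are orthonormal. *)
Definition ip x y : C := (star x * y) 1%g.

Lemma ipE x y : ip x y = \sum_g (x g)^* * y g.
Proof.
rewrite /ip ffunE (reindex_inj invg_inj) /=; apply: eq_bigr => g _.
by rewrite !ffunE invgK mulg1.
Qed.

Lemma ipD x y z : ip x (y + z) = ip x y + ip x z.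
Proof.
by rewrite !ipE -big_split; apply: eq_bigr => g _; rewrite ffunE mulrDr.
Qed.
Lemma ipZ x a y : ip x (a *: y) = a * ip x y.
Proof.
rewrite !ipE mulr_sumr; apply: eq_bigr => g _.
by rewrite !ffunE mulrCA.
Qed.

Lemma ip0 x : ip x 0 = 0.
Proof. by rewrite ipE big1 // => g _; rewrite ffunE mulr0. Qed.

Lemma tensDl x x' y : tens (x + x') y = tens x y + tens x' y.
Proof. by apply/ffunP => g; rewrite !ffunE mulrDl. Qed.
Lemma tensDr x y y' : tens x (y + y') = tens x y + tens x y'.
Proof. by apply/ffunP => g; rewrite !ffunE mulrDr. Qed.
Lemma tensZl a x y : tens (a *: x) y = a *: tens x y.
Proof. apply/ffunP => g; rewrite !ffunE; exact: esym (mulrA a _ _). Qed.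
Lemma tensZr a x y : tens x (a *: y) = a *: tens x y.
Proof. apply/ffunP => g; rewrite !ffunE; exact: mulrCA. Qed.
Lemma tens_lam (g h : gT) : tens (lam C g) (lam C h) = lam C (g, h).
Proof.
apply/ffunP => -[u v]; rewrite !ffunE /= xpair_eqE.
by case: eqP; case: eqP => //= _ _; rewrite ?mulr1 ?mulr0.
Qed.

Lemma tens_mem (U V : {vspace A}) x y : x \in U -> y \in V -> tens x y \in tensv U V.
Proof.
move=> /coord_vbasis -> /coord_vbasis ->.
have ts0l v : tens 0 v = 0 :> A2 by apply/ffunP => g; rewrite !ffunE mul0r.
have ts0r u : tens u 0 = 0 :> A2 by apply/ffunP => g; rewrite !ffunE mulr0.
rewrite (big_morph (fun u => tens u _) (fun u v => tensDl u v _) (ts0l _)).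
apply: memv_suml => i _; rewrite (big_morph (tens _) (tensDr _) (ts0r _)).
apply: memv_suml => j _; rewrite tensZl tensZr !memvZ //.
by apply/memv_span/allpairs_f; rewrite mem_nth // size_tuple.
Qed.

(** The functional [ip x] applied to the first leg. It maps C[G] (x) I into I, which is
the form in which the coideal condition is used. *)
Definition slice x (z : A2) : A := [ffun g => \sum_h (x h)^* * z (h, g)].

Lemma slice_tens x u v : slice x (tens u v) = ip x u *: v.
Proof.
apply/ffunP => g; rewrite !ffunE ipE [RHS]mulr_suml; apply: eq_bigr => h _.
by rewrite ffunE mulrA.
Qed.

Lemma sliceD x : {morph slice x : u v / u + v}.
Proof.
move=> u v; apply/ffunP => g; rewrite !ffunE -big_split; apply: eq_bigr => h _.
by rewrite !ffunE mulrDr.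
Qed.

Lemma sliceZ x a u : slice x (a *: u) = a *: slice x u.
Proof.
apply/ffunP => g; rewrite !ffunE [RHS]mulr_sumr; apply: eq_bigr => h _.
by rewrite !ffunE mulrCA.
Qed.

Lemma slice_mem x I (z : A2) : z \in tensv fullv I -> slice x z \in I.
Proof.
have s0 : slice x 0 = 0.
  by apply/ffunP => g; rewrite !ffunE big1 // => h _; rewrite ffunE mulr0.
move=> zI; rewrite (span_sum zI) (big_morph _ (sliceD x) s0).
apply: memv_suml => i _; rewrite sliceZ memvZ //.
have /allpairsP[[u v] [_ /= vI ->]] := mem_nth 0 (ltn_ord i).
by rewrite slice_tens memvZ // vbasis_mem.
Qed.

Section Orthogonal.
Variable s : seq A.
Definition orthogonal_family :=
  (forall i, (i < size s)%N -> ip s`_i s`_i != 0) /\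
  (forall i j, (i < size s)%N -> (j < size s)%N -> i != j -> ip s`_i s`_j = 0).

Lemma ip_span x : (forall y, y \in s -> ip x y = 0) -> forall y, y \in <<s>>%VS -> ip x y = 0.
Proof.
move=> h y ys; rewrite (span_sum ys).
rewrite (big_morph (ip x) (ipD x) (ip0 x)) big1 // => i _.
by rewrite ipZ h ?mulr0 // mem_nth.
Qed.

Lemma orthogonal_free : orthogonal_family -> free s.
Proof.
case=> nz orth; apply/(@freeP _ _ _ (in_tuple s)) => k sk0 i.
have := congr1 (ip s`_i) sk0.
rewrite (big_morph (ip _) (ipD _) (ip0 _)) (bigD1 i) //= big1 => [|j ji].
  by rewrite addr0 ipZ ip0 => /eqP; rewrite mulf_eq0 (negPf (nz _ _)) // orbF => /eqP.
by rewrite ipZ orth ?mulr0 // eq_sym.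
Qed.
End Orthogonal.

End GroupAlgebra.

(** * The twist of KD(6) in coordinates *)

Section RootOfUnity.
Variable R : realType.
Local Notation zeta := (eps R 6).

Lemma expiD (s t : R) : expi (s + t) = expi s * expi t.
Proof. by apply/eqP; rewrite eq_complex /= cosD sinD addrC [X in _ && (_ == X)]addrC !eqxx. Qed.

Lemma expi0 : expi (0 : R) = 1.
Proof. by rewrite /expi cos0 sin0. Qed.

Lemma expiMn (t : R) n : expi (t *+ n) = expi t ^+ n.
Proof. by elim: n => [|n IH]; rewrite ?expi0 // mulrS expiD IH exprS. Qed.

Lemma expiN (t : R) : expi (- t) = (expi t)^*.
Proof. by rewrite /expi cosN sinN. Qed.

Lemma zetaX n : zeta ^+ n = expi (pi / 6%:R *+ n).
Proof. by rewrite expiMn. Qed.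

Lemma zeta3 : zeta ^+ 3 = 'i.
Proof.
rewrite zetaX -complexiE /expi.
have -> : pi / 6%:R *+ 3 = pi / 2 :> R by field.
by rewrite cos_pihalf sin_pihalf.
Qed.

(** zeta^6 + 1 is the product of zeta^2 + 1 and of zeta^4 - zeta^2 + 1, and zeta^2 is not
-1 because its imaginary part sin (pi / 3) is positive. *)
Lemma zeta4 : zeta ^+ 4 = zeta ^+ 2 - 1.
Proof.
have nz : zeta ^+ 2 + 1 != 0.
  rewrite addr_eq0 zetaX; apply/eqP => /(congr1 (@complex.Im R)) /= /eqP; rewrite oppr0.
  rewrite gt_eqF //; apply: sin_gt0_pi.
  have := pi_gt0 R; lra.
apply/eqP; rewrite -subr_eq0 -(mulrI_eq0 _ (mulfI nz)).
have z6 : zeta ^+ 6 = -1 by rewrite (exprM zeta 3 2) zeta3 sqrCi.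
rewrite [X in X == 0](_ : _ = zeta ^+ 6 + 1); last ring.
by rewrite z6 addNr.
Qed.

Lemma zetaJ : zeta^* = zeta ^+ 11.
Proof.
rewrite -expiN zetaX -[LHS]mul1r.
have -> : 1 = expi (pi *+ 2) :> R[i] by rewrite /expi cos2pi sin2pi.
by rewrite -expiD; congr expi; field.
Qed.
End RootOfUnity.

Section KD6.
Variable R : realType.
Local Notation C := R[i].
Local Notation K := (KD R 6).
Local Notation K2 := (KD2 R 6).
Local Notation zeta := (eps R 6).
Local Notation cval := (cyc_val zeta).

Definition lr (s : bool) (k : Z12) : K := lam C ((s, k) : dih 6).

Lemma lrM s k t l :
  lr s k * lr t l = lr (s (+) t) ((if t then - k else k) + l).
Proof. by rewrite /lr lam_mul. Qed.

Lemma lr1 : lr false 0 = 1. Proof. by []. Qed.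
Lemma six2 : 6%:R + 6%:R = 0 :> Z12. Proof. by apply: val_inj. Qed.

Lemma lrJ s k : star (lr s k) = lr s (if s then k else - k).
Proof. exact: star_lam. Qed.

Definition KD_X (s : bool) (k : Z12) : K := X 6%:R lr s k.
Definition KD_Y (s : bool) (k : Z12) : K := Y 6%:R lr s k.

Lemma Delta_sD (x y : K) : Delta_s (x + y) = Delta_s x + Delta_s y.
Proof.
by rewrite /Delta_s -big_split; apply: eq_bigr => g _; rewrite ffunE scalerDl.
Qed.

Lemma Delta_sZ a (x : K) : Delta_s (a *: x) = a *: Delta_s x.
Proof.
rewrite /Delta_s scaler_sumr; apply: eq_bigr => g _.
by rewrite ffunE scalerA.
Qed.

Lemma Delta_s_lam (g : dih 6) : Delta_s (lam C g : K) = lam C (g, g).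
Proof.
rewrite /Delta_s (bigD1 g) //= big1 => [|h /negPf nh]; rewrite !ffunE ?eqxx.
  by rewrite addr0 scale1r tens_lam.
by rewrite nh scale0r.
Qed.

(** The pair (s, k) codes the group element b^s a^k; k is kept a natural number, so that
group elements can be compared by evaluation, and -k becomes 11 k. *)
Definition gcode : Type := (bool * nat)%type.
Definition gm (p q : gcode) : gcode :=
  (p.1 (+) q.1, ((if q.1 then 11 * p.2 else p.2) + q.2) %% 12)%N.
Definition gv (p : gcode) : dih 6 := (p.1, p.2%:R).

Lemma natZ12 m : (m %% 12)%:R = m%:R :> Z12.
Proof. by apply: val_inj; rewrite /= !Zp_nat /= modn_mod. Qed.

Lemma gvM p q : gv (gm p q) = (gv p * gv q)%g.
Proof.
case: p q => s k [t l]; rewrite /gv /gm /= natZ12 natrD; congr (_, _).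
case: t => //; congr (_ + _); rewrite natrM.
have -> : 11%:R = -1 :> Z12 by apply: val_inj.
by rewrite mulN1r.
Qed.

Definition mu2 (p q : gcode * gcode) : form (gcode * gcode)%type :=
  [:: (cyc_int 1, (gm p.1 q.1, gm p.2 q.2))].
Definition beta2 (p : gcode * gcode) : K2 := lam C (gv p.1, gv p.2).

Lemma mu2P p q : beta2 p * beta2 q = evf zeta beta2 (mu2 p q).
Proof.
by rewrite evf1 cval_int scale1r /beta2 /= lam_mul !gvM.
Qed.

Definition beta1 (p : gcode) : K := lam C (gv p).
Notation ev1 := (evf zeta beta1).
Notation ev2 := (evf zeta beta2).

Lemma ev_tens l m : tens (ev1 l) (ev1 m) = ev2 (tensf l m).
Proof.
rewrite (evf_bilinear (zeta4 R) (f := @tens C (dih 6))).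
- by apply: eq_bigr => p _; congr (_ *: _); apply: tens_lam.
- exact: tensDl.
- exact: tensZl.
- exact: tensDr.
- by move=> a x z; apply: tensZr.
Qed.

Definition Delta_sf (l : form gcode) : form (gcode * gcode)%type :=
  [seq (p.1, (p.2, p.2)) | p <- l].

Lemma ev_Delta_s l : Delta_s (ev1 l) = ev2 (Delta_sf l).
Proof.
rewrite (evf_linear zeta _ _ Delta_sD Delta_sZ) /evf big_map.
by apply: eq_bigr => p _; congr (_ *: _); apply: Delta_s_lam.
Qed.

Definition hcode : seq gcode := [:: (false, 0); (false, 6); (true, 0); (true, 6)]%N.
Definition nuc := Cyc (-1) 0 0 2.
Definition ccode : seq (seq cyc) :=
  let nu := nuc in let nu' := cyc_conj nuc in let o := cyc_int 1 in let f := cyc_int 5 in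
  [:: [:: f; o; o; o]; [:: o; o; nu'; nu]; [:: o; nu; o; nu']; [:: o; nu'; nu; o]].
(** Eight times the twist, to have integral coefficients. *)
Definition Omegaf : form (gcode * gcode)%type :=
  flatten [seq [seq (nth (cyc_int 0) (nth [::] ccode i) j,
                      (nth (false, 0%N) hcode i, nth (false, 0%N) hcode j))
    | j <- iota 0 4] | i <- iota 0 4].

Definition ginv (p : gcode) : gcode := (p.1, if p.1 then p.2 else (11 * p.2) %% 12)%N.
Definition st2 (p : gcode * gcode) : form (gcode * gcode)%type :=
  [:: (cyc_int 1, (ginv p.1, ginv p.2))].
Definition Omegaf' := starf st2 Omegaf.

Lemma gv_rot k : (dih_a 6 ^+ k)%g = gv (false, k).
Proof.
elim: k => [|k IH] //; rewrite expgS IH /gv /= -natr1 addrC.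
by [].
Qed.

Lemma gv_flip k : (dih_b 6 * dih_a 6 ^+ k)%g = gv (true, k).
Proof. by rewrite gv_rot /gv; congr (_, _); apply: add0r. Qed.

Lemma kd_hE (i : 'I_4) : kd_h 6 i = gv (nth (false, 0%N) hcode i).
Proof.
by case: i => [[|[|[|[|//]]]] ilt]; rewrite /kd_h /= ?gv_flip // gv_rot.
Qed.

Lemma OmegaE : kd_Omega R 6 = 8^-1 *: ev2 Omegaf.
Proof.
rewrite /kd_Omega evf_flatten big_map -[iota 0 4]/(index_iota 0 4) big_mkord scaler_sumr.
apply: eq_bigr => i _; rewrite /evf big_map big_mkord scaler_sumr.
apply: eq_bigr => j _ /=; rewrite !kd_hE scalerA; congr (_ *: _); last exact: tens_lam.
rewrite !mxE; congr (_ * _).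
have nuE : cval nuc = -1 + 2 * 'i by rewrite -zeta3 /= !mul0r !addr0.
have nuJ := cvalJ (zeta4 R) (zetaJ R) nuc; rewrite nuE in nuJ.
have intE n : cval (cyc_int (Z.of_nat n)) = n%:R.
  by case: n => [|n]; rewrite cval_int /= ?SuccNat2Pos.id_succ.
have [e1 e5] := (intE 1%N, intE 5%N).
by case: i j => [[|[|[|[|//]]]]] /= _ [[|[|[|[|//]]]]].
Qed.

Lemma gvV p : gv (ginv p) = (gv p)^-1%g.
Proof.
case: p => [[] k]; rewrite /gv /ginv //= natZ12 natrM.
have -> : 11%:R = -1 :> Z12 by apply: val_inj.
by rewrite mulN1r.
Qed.

Lemma Omega_starE : star (kd_Omega R 6) = 8^-1 *: ev2 Omegaf'.
Proof.
rewrite OmegaE starZ (evf_star (zeta4 R) (zetaJ R) (A := K2) (star := @star _ _)).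
- by rewrite fmorphV rmorph_nat.
- exact: starD.
- exact: starZ.
- by move=> p; rewrite star_lam evf1 cval_int scale1r /beta2 !gvV.
Qed.

Definition mulf2 := mulf mu2.
Lemma ev_mul2 l m : ev2 (mulf2 l m) = ev2 l * ev2 m.
Proof. by apply: (evfM (zeta4 R) (A := K2)); apply: mu2P. Qed.

(** The two denominators 8 of the twist and of its adjoint give 64. *)
Lemma ev_Delta l :
  Delta (ev1 l) = 64^-1 *: ev2 (mulf2 (collect (mulf2 Omegaf (Delta_sf l))) Omegaf').
Proof.
rewrite /Delta Omega_starE OmegaE ev_Delta_s ev_mul2 evf_collect ev_mul2.
by rewrite -!scalerAl -scalerAr scalerA -invfM -natrM.
Qed.

Definition mu1 (p q : gcode) : form gcode := [:: (cyc_int 1, gm p q)].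
Lemma mu1P p q : beta1 p * beta1 q = evf zeta beta1 (mu1 p q).
Proof. by rewrite evf1 cval_int scale1r /beta1 /= lam_mul !gvM. Qed.
Definition mulf1 := mulf mu1.
Lemma ev_mul1 l m : ev1 (mulf1 l m) = ev1 l * ev1 m.
Proof. by apply: (evfM (zeta4 R) (A := K)); apply: mu1P. Qed.

End KD6.

(** * The coproduct of the twisted basis *)

Definition rotn (k : nat) : nat := ((11 * k) %% 12)%N.
(** The elements 4 b^s X_k and 4 b^s Y_k in the group basis; the factor clears the
denominators. *)
Definition Xf (s : bool) (k : nat) : form gcode :=
  scalef (cyc_int 2) (mulf1 [:: (cyc_int 1, (false, 0%N)); (cyc_int 1, (false, 6%N))]
     [:: (cyc_int 1, (s, k))]).
Definition Yf (s : bool) (k : nat) : form gcode :=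
  mulf1 (mulf1 [:: (cyc_int 1, (false, 0%N)); (cyc_int (-1), (false, 6%N))]
     [:: (cyc_int 1, (s, 0%N))])
   [:: (cyc_int 1, (false, k)); (cyc_int 1, (false, rotn k));
       (cyc_pow 3, (true, rotn k)); (cyc_pow 9, (true, k))].

(** Both legs of a tensor of two scaled elements carry a factor 4, and [Delta] of one
scaled element is computed up to 64: the two sides differ by 64 * 4 / (4 * 4) = 16. *)
Definition DeltaX_check s k :=
  eqf (mulf2 (collect (mulf2 Omegaf (Delta_sf (Xf s k)))) Omegaf')
      (scalef (cyc_int 16) (tensf (Xf s k) (Xf s k) ++ tensf (Yf s k) (Yf s (rotn k)))).
Definition DeltaY_check s k :=
  eqf (mulf2 (collect (mulf2 Omegaf (Delta_sf (Yf s k)))) Omegaf')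
      (scalef (cyc_int 16) (tensf (Xf s k) (Yf s k) ++ tensf (Yf s k) (Xf s (rotn k)))).

Lemma Delta_check : all (fun s => all (fun k => DeltaX_check s k && DeltaY_check s k) (iota 0 6)) [:: false; true].
Proof. by vm_compute. Qed.

Section KD6.
Variable R : realType.
Local Notation C := R[i].
Local Notation K := (KD R 6).
Local Notation zeta := (eps R 6).
Local Notation cval := (cyc_val zeta).
Local Notation KX := (KD_X R).
Local Notation KY := (KD_Y R).
Notation ev1 := (evf zeta (beta1 R)).
Notation ev2 := (evf zeta (beta2 R)).

Lemma rotnE k : (rotn k)%:R = - k%:R :> Z12.
Proof.
rewrite /rotn natZ12 natrM.
have -> : 11%:R = -1 :> Z12 by apply: val_inj.
by rewrite mulN1r.
Qed.

Lemma pow9 : cval (cyc_pow 9) = - 'i.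
Proof. by rewrite (cval_pow (zeta4 R)) (exprD _ 3 6) (exprM _ 3 2) zeta3 sqrCi mulrN1. Qed.

Lemma ev_one (p : gcode) : ev1 [:: (cyc_int 1, p)] = beta1 R p.
Proof. by rewrite evf1 cval_int scale1r. Qed.

Lemma P2fE : ev1 [:: (cyc_int 1, (false, 0%N)); (cyc_int 1, (false, 6%N))] = 2 *: Pe 6%:R (lr R).
Proof.
rewrite evf2 !cval_int !scale1r /Pe scalerA mulfV ?pnatr_eq0 // scale1r.
by [].
Qed.
Lemma Q2fE : ev1 [:: (cyc_int 1, (false, 0%N)); (cyc_int (-1), (false, 6%N))] = 2 *: Qe 6%:R (lr R).
Proof.
by rewrite evf2 !cval_int scale1r scaleN1r /Qe scalerA mulfV ?pnatr_eq0 // scale1r.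
Qed.

Lemma twfE k : ev1 [:: (cyc_int 1, (false, k)); (cyc_int 1, (false, rotn k));
       (cyc_pow 3, (true, rotn k)); (cyc_pow 9, (true, k))] = 2 *: tw (lr R) k%:R.
Proof.
rewrite -[[:: _; _; _; _]]/([:: _; _] ++ [:: _; _]) evf_cat !evf2.
rewrite !cval_int pow9 (cval_pow (zeta4 R)) zeta3 !scale1r.
rewrite /tw [RHS]scalerDr !scalerA mulfV ?pnatr_eq0 // scale1r.
rewrite [2 * _]mulrC divfK ?pnatr_eq0 // scaleNr -scalerBr.
by rewrite /beta1 /gv rotnE.
Qed.

Lemma XfE s k : ev1 (Xf s k) = 4 *: KX s k%:R.
Proof.
rewrite (evfZ (zeta4 R)).
have -> : cval (cyc_int 2) = 2 by rewrite cval_int.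
rewrite ev_mul1 P2fE ev_one -scalerAl scalerA -natrM.
by [].
Qed.

Lemma YfE s k : ev1 (Yf s k) = 4 *: KY s k%:R.
Proof.
rewrite !ev_mul1 Q2fE ev_one twfE -scalerAl -scalerAr -scalerAl scalerA -natrM.
by [].
Qed.

Lemma DeltaZ a (x : K) : Delta (a *: x) = a *: Delta x.
Proof. by rewrite /Delta Delta_sZ -scalerAr -scalerAl. Qed.
Lemma DeltaD (x y : K) : Delta (x + y) = Delta x + Delta y.
Proof. by rewrite /Delta Delta_sD mulrDr mulrDl. Qed.

Let scaleI4 (V : lmodType C) (x y : V) : 4 *: x = 4 *: y -> x = y.
Proof. by apply: scalerI; rewrite pnatr_eq0. Qed.

Let tens44 (x y : K) : tens (4 *: x) (4 *: y) = 16 *: tens x y :> KD2 R 6.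
Proof.
apply/ffunP => g; rewrite !ffunE.
suff mul44 (u v : C) : (4 * u) * (4 * v) = 16 * (u * v) by apply: mul44.
ring.
Qed.

Let descale (V : lmodType C) (x y : V) :
  64^-1 *: (cval (cyc_int 16) *: (16 *: x + 16 *: y)) = 4 *: (x + y).
Proof.
rewrite -scalerDr !scalerA cval_int; congr (_ *: _).
by have -> : (int_of_Z 16)%:~R = 16%:R :> C by []; field.
Qed.

(** The twist turns the diagonal coproduct of the group into one that is still diagonal
on the planes spanned by b^s X_k and b^s Y_k, up to the reversal of k in the Y part. All
that follows depends on the twist only through this and the next lemma. *)
Lemma KX_Delta s k : (k < 6)%N -> Delta (KX s k%:R) =
  tens (KX s k%:R) (KX s k%:R) + tens (KY s k%:R) (KY s (- k%:R)).
Proof.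
move=> k6; apply: scaleI4; rewrite -DeltaZ -XfE ev_Delta.
have /allP/(_ s) := Delta_check; rewrite !inE => /(_ _)/allP/(_ k).
rewrite mem_iota k6; case/(_ _ isT)/andP=> [|/(eqfP (zeta4 R) (beta2 R)) -> _].
  by case: s.
rewrite (evfZ (zeta4 R)) evf_cat -(ev_tens R (Xf s k)) -(ev_tens R (Yf s k)).
rewrite (XfE s k) (YfE s k) (YfE s (rotn k)) rotnE.
move: (KX s k%:R) (KY s k%:R) (KY s (- k%:R)) => x y z.
by rewrite !tens44; apply: descale.
Qed.

Lemma KY_Delta s k : (k < 6)%N -> Delta (KY s k%:R) =
  tens (KX s k%:R) (KY s k%:R) + tens (KY s k%:R) (KX s (- k%:R)).
Proof.
move=> k6; apply: scaleI4; rewrite -DeltaZ -YfE ev_Delta.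
have /allP/(_ s) := Delta_check; rewrite !inE => /(_ _)/allP/(_ k).
rewrite mem_iota k6; case/(_ _ isT)/andP=> [|_ /(eqfP (zeta4 R) (beta2 R)) ->].
  by case: s.
rewrite (evfZ (zeta4 R)) evf_cat -(ev_tens R (Xf s k)) -(ev_tens R (Yf s k)).
rewrite (XfE s k) (YfE s k) (XfE s (rotn k)) rotnE.
move: (KX s k%:R) (KY s k%:R) (KX s (- k%:R)) => x y z.
by rewrite !tens44; apply: descale.
Qed.
End KD6.

(** * Products, adjoints and orthogonality of the twisted basis *)

(** The code (y, (s, k)) stands for b^s X_k if y is false, for b^s Y_k if y is true. *)
Definition code : Type := (bool * (bool * nat))%type.

(** Brings back a rotation number below 12 to one below 6, by X_{k+6} = X_k and
Y_{k+6} = - Y_k. *)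
Definition reduce (y s : bool) (m : nat) : form code :=
  if (m < 6)%N then [:: (cyc_int 1, (y, (s, m)))]
  else [:: ((if y then cyc_int (-1) else cyc_int 1), (y, (s, m - 6)%N))].

Definition mu (p q : code) : form code :=
  if p.1 == q.1 then reduce p.1 (gm p.2 q.2).1 (gm p.2 q.2).2 else [::].
Definition st (p : code) : form code :=
  reduce p.1 p.2.1 ((if p.2.1 then p.2.2 else 11 * p.2.2) %% 12)%N.
Definition mulx := mulf mu.
Definition starx := starf st.
(** Twice the coefficient of the identity of the group. *)
Definition haarf (l : form code) : cyc :=
  foldr (fun p c => if p.2.2 == (false, 0%N) then cyc_add p.1 c else c) (cyc_int 0) l.
Definition counitf (l : form code) : cyc :=
  foldr (fun p c => if p.2.1 then c else cyc_add p.1 c) (cyc_int 0) l.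
Definition ipf (l m : form code) : cyc := haarf (mulx (starx l) m).

Definition places : seq (bool * nat) :=
  [seq (s, k) | s <- [:: false; true], k <- iota 0 6].
Definition codes : seq code :=
  [seq (false, q) | q <- places] ++ [seq (true, q) | q <- places].

Definition ghaarf (l : form gcode) : cyc :=
  foldr (fun p c => if ~~ p.2.1 && (p.2.2 %% 12 == 0)%N then cyc_add p.1 c else c) (cyc_int 0) l.
Definition gcounitf (l : form gcode) : cyc := foldr (fun p c => cyc_add p.1 c) (cyc_int 0) l.

Definition cyc_eq (x y : cyc) := cyc_eq0 (cyc_add x (cyc_mul (cyc_int (-1)) y)).

(** In order: the coefficient of the identity and the counit, read off the group basis
for four times the basis element; the orthogonality to the other basis elements. *)
Definition basis_check (p : code) : bool :=
  let l := if p.1 then Yf p.2.1 p.2.2 else Xf p.2.1 p.2.2 in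
  cyc_eq (ghaarf l) (if p.2 == (false, 0%N) then cyc_int 2 else cyc_int 0)
  && cyc_eq (gcounitf l) (if p.1 then cyc_int 0 else cyc_int 4)
  && all (fun q => cyc_eq (ipf [:: (cyc_int 1, p)] [:: (cyc_int 1, q)])
         (cyc_int (if p == q then 1 else 0))) codes.

Lemma basis_checks : all basis_check codes.
Proof. by vm_compute. Qed.

Section KD6.
Variable R : realType.
Local Notation C := R[i].
Local Notation K := (KD R 6).
Local Notation zeta := (eps R 6).
Local Notation cval := (cyc_val zeta).
Local Notation KX := (KD_X R).
Local Notation KY := (KD_Y R).

Definition basis_elt (p : code) : K := if p.1 then KY p.2.1 p.2.2%:R else KX p.2.1 p.2.2%:R.
Local Notation beta := basis_elt.
Notation ev := (evf zeta beta).

Lemma cyc_eqP x y : cyc_eq x y -> cval x = cval y.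
Proof.
move=> /(cyc_eq0P zeta)/eqP; rewrite cvalD (cvalM (zeta4 R)) cval_int mulN1r.
by rewrite subr_eq0 => /eqP.
Qed.

Lemma KX_shift s k : KX s (k + 6%:R) = KX s k.
Proof. by apply: Xshift; first [exact: six2|exact: lr1|exact: lrM]. Qed.
Lemma KY_shift s k : KY s (k + 6%:R) = - KY s k.
Proof. by apply: Yshift; first [exact: six2|exact: lr1|exact: lrM]. Qed.

Lemma KXM s k t l : KX s k * KX t l = KX (s (+) t) ((if t then - k else k) + l).
Proof. by apply: XM; first [exact: six2|exact: lr1|exact: lrM]. Qed.
Lemma KYM s k t l : KY s k * KY t l = KY (s (+) t) ((if t then - k else k) + l).
Proof. by apply: YM; first [exact: six2|exact: lr1|exact: lrM]. Qed.
Lemma KXY0 s k t l : KX s k * KY t l = 0.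
Proof. by apply: XY0; first [exact: six2|exact: lr1|exact: lrM]. Qed.
Lemma KYX0 s k t l : KY s k * KX t l = 0.
Proof. by apply: YX0; first [exact: six2|exact: lr1|exact: lrM]. Qed.

Lemma KXJ s k : star (KX s k) = KX s (if s then k else - k).
Proof.
by apply: (@XJ _ K); first [exact: six2|exact: lr1|exact: lrM|exact: starD|exact: starZ|exact: starM|exact: lrJ].
Qed.
Lemma KYJ s k : star (KY s k) = KY s (if s then k else - k).
Proof.
by apply: (@YJ _ K); first [exact: six2|exact: lr1|exact: lrM|exact: starD|exact: starZ|exact: starM|exact: lrJ].
Qed.

Lemma lr_KXY s k : lr R s k = KX s k + 2^-1 *: (KY s k + KY s (- k))
   + ('i / 2) *: (KY (~~ s) k - KY (~~ s) (- k)).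
Proof. by apply: (@dXY _ K); first [exact: six2|exact: lr1|exact: lrM]. Qed.

Lemma ev_reduce y s m : (m < 12)%N -> ev (reduce y s m) = if y then KY s m%:R else KX s m%:R.
Proof.
move=> m12; rewrite /reduce; case: ltnP => m6; first by rewrite evf1 cval_int scale1r.
have e : m%:R = (m - 6)%:R + 6%:R :> Z12 by rewrite -natrD subnK.
rewrite evf1 e KX_shift KY_shift; case: y; rewrite cval_int ?scale1r //.
by rewrite scaleN1r.
Qed.

Lemma muP p q : beta p * beta q = ev (mu p q).
Proof.
case: p q => [y [s k]] [z [t l]]; rewrite /mu /=; case: eqP => [<-|nyz].
  rewrite ev_reduce ?ltn_mod //.
  have e : (((if t then 11 * k else k) + l) %% 12)%:R = (if t then - k%:R else k%:R) + l%:R :> Z12.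
    by rewrite natZ12 natrD; case: t => //; rewrite -rotnE /rotn natZ12.
  by rewrite e /basis_elt /=; case: y; rewrite ?KXM ?KYM.
by rewrite evf_nil /basis_elt /=; case: y z nyz => [] [] //= _; rewrite ?KXY0 ?KYX0.
Qed.

Lemma stP p : star (beta p) = ev (st p).
Proof.
case: p => y [s k]; rewrite /st /= ev_reduce ?ltn_mod // /basis_elt /=.
have e : ((if s then k else 11 * k) %% 12)%:R = (if s then k%:R else - k%:R) :> Z12.
  by case: s; rewrite -?rotnE ?natZ12.
by rewrite e; case: y; rewrite ?KXJ ?KYJ.
Qed.

Lemma ev_mulx l m : ev (mulx l m) = ev l * ev m.
Proof. by apply: (evfM (zeta4 R) (A := K)); apply: muP. Qed.
Lemma ev_starx l : ev (starx l) = star (ev l).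
Proof.
by apply: (evf_star (zeta4 R) (zetaJ R) (A := K)); [exact: starD|exact: starZ|exact: stP].
Qed.

End KD6.

Definition wfc (p : code) := (p.2.2 < 6)%N.

Lemma mem_places s k : ((s, k) \in places) = (k < 6)%N.
Proof.
apply/allpairsP/idP => [[[t l] [_ l6 [_ ->]]]|k6]; first by rewrite mem_iota in l6.
by exists (s, k); split; rewrite ?mem_iota //; case: s.
Qed.

Lemma wf_reduce y s m : (m < 12)%N -> all (fun p => wfc p.2) (reduce y s m).
Proof.
move=> m12; rewrite /reduce; case: ltnP => m6 /=; rewrite /wfc ?m6 //=.
by rewrite andbT ltn_subLR.
Qed.

Lemma wf_mulx l m : all (fun p => wfc p.2) (mulx l m).
Proof.
rewrite /mulx /mulf; elim: l => //= p l IH; rewrite all_cat IH andbT.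
elim: m {l IH} => //= q m IH; rewrite all_cat IH andbT /scalef all_map /preim /=.
by rewrite /mu; case: eqP => // _; apply: wf_reduce; rewrite ltn_mod.
Qed.

Section KD6.
Variable R : realType.
Local Notation C := R[i].
Local Notation K := (KD R 6).
Local Notation zeta := (eps R 6).
Local Notation cval := (cyc_val zeta).
Local Notation KX := (KD_X R).
Local Notation KY := (KD_Y R).
Local Notation beta := (basis_elt R).
Local Notation ev := (evf zeta beta).
Local Notation ev1 := (evf zeta (beta1 R)).

Lemma ev1_haar l : (ev1 l) 1%g = cval (ghaarf l).
Proof.
elim: l => [|p l IH]; first by rewrite evf_nil cval_int ffunE.
rewrite evf_cons !ffunE IH /=.
have -> : (1%g == gv p.2) = ~~ p.2.1 && (p.2.2 %% 12 == 0)%N.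
  case: p.2 => s k; rewrite eq_sym /gv xpair_eqE eqbF_neg; congr (_ && _).
  by rewrite -val_eqE /= Zp_nat.
case: ifP => _; last by rewrite scaler0 add0r.
by rewrite cvalD [_ *: _]mulr1.
Qed.

Lemma ev1_counit l : counit (ev1 l) = cval (gcounitf l).
Proof.
elim: l => [|p l IH].
  by rewrite evf_nil cval_int /counit big1 // => g _; rewrite ffunE.
by rewrite evf_cons counitD counitZ IH counit_lam mulr1 /= cvalD.
Qed.

Let beta4 p : 4 *: beta p = ev1 (if p.1 then Yf p.2.1 p.2.2 else Xf p.2.1 p.2.2).
Proof. by rewrite /basis_elt; case: p.1; rewrite ?XfE ?YfE. Qed.

Let C4 : 4 != 0 :> C. Proof. by rewrite pnatr_eq0. Qed.

Lemma beta_haar p : p \in codes -> beta p 1%g = if p.2 == (false, 0%N) then 2^-1 else 0.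
Proof.
move=> pc; have /allP/(_ p pc)/andP[/andP[/(cyc_eqP R) h _] _] := basis_checks.
apply: (mulfI C4); have := congr1 (fun x : K => x 1%g) (beta4 p).
rewrite /= ev1_haar h ffunE => e; apply: (etrans e).
case: ifP; rewrite cval_int ?mulr0 //= => _.
by have -> : (int_of_Z 2)%:~R = 2 :> C by []; field.
Qed.

Lemma beta_counit p : p \in codes -> counit (beta p) = if p.1 then 0 else 1.
Proof.
move=> pc; have /allP/(_ p pc)/andP[/andP[_ /(cyc_eqP R) h] _] := basis_checks.
apply: (mulfI C4); rewrite -counitZ beta4 ev1_counit h.
by case: ifP; rewrite cval_int ?mulr0 ?mulr1.
Qed.

Lemma wfc_codes p : wfc p -> p \in codes.
Proof.
case: p => y [s k] /= k6; rewrite mem_cat; apply/orP.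
by case: y k6 => k6; [right|left]; apply: map_f; rewrite mem_places.
Qed.

Lemma ev_haar l : all (fun p => wfc p.2) l -> (ev l) 1%g = 2^-1 * cval (haarf l).
Proof.
elim: l => [_|p l IH]; first by rewrite evf_nil [haarf _]/(cyc_int 0) cval_int ffunE mulr0.
case/andP=> /wfc_codes pc /IH{}IH; rewrite /= evf_cons !ffunE IH beta_haar //.
case: ifP => _; last by rewrite scaler0 add0r.
by rewrite cvalD mulrDr [_ *: _]mulrC.
Qed.

Lemma ev_ip l m : ip (ev l) (ev m) = 2^-1 * cval (ipf l m).
Proof. by rewrite /ip -ev_starx -ev_mulx ev_haar // wf_mulx. Qed.

Lemma ev_counit l : all (fun p => wfc p.2) l -> counit (ev l) = cval (counitf l).
Proof.
elim: l => [_|p l IH].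
  by rewrite evf_nil [counitf _]/(cyc_int 0) cval_int /counit big1 // => g _; rewrite ffunE.
case/andP=> /wfc_codes pc /IH{}IH; rewrite /= evf_cons counitD counitZ IH beta_counit //.
by case: ifP => _; rewrite ?mulr0 ?add0r // cvalD mulr1.
Qed.

Lemma ev_code p : ev [:: (cyc_int 1, p)] = beta p.
Proof. by rewrite evf1 cval_int scale1r. Qed.

Lemma beta_ip p q : p \in codes -> q \in codes -> ip (beta p) (beta q) = (p == q)%:R / 2.
Proof.
move=> pc qc; have /allP/(_ p pc)/andP[_ /allP/(_ q qc)/(cyc_eqP R) h] := basis_checks.
by rewrite -!ev_code ev_ip h cval_int mulrC; case: eqP.
Qed.

End KD6.

(** * Homogeneous parts of elements and of coideals *)

Lemma pairD_abs (F : fieldType) (V : lmodType F) (b b' : V) v v' w w' :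
  (v + v') *: b + (w + w') *: b' = (v *: b + w *: b') + (v' *: b + w' *: b').
Proof. by rewrite !scalerDl addrACA. Qed.
Lemma pairZ_abs (F : fieldType) (V : lmodType F) (b b' : V) a v w :
  (a * v) *: b + (a * w) *: b' = a *: (v *: b + w *: b').
Proof. by rewrite scalerDr !scalerA. Qed.

Section KD6.
Variable R : realType.
Local Notation C := R[i].
Local Notation K := (KD R 6).
Local Notation KX := (KD_X R).
Local Notation KY := (KD_Y R).
Local Notation beta := (basis_elt R).

(** The factor 2 compensates for the squared norm 1/2 of the basis elements. *)
Definition coef (p : code) (x : K) : C := 2 * ip (beta p) x.

Lemma coefD p x y : coef p (x + y) = coef p x + coef p y.
Proof. by rewrite /coef ipD mulrDr. Qed.
Lemma coefZ p a x : coef p (a *: x) = a * coef p x.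
Proof. by rewrite /coef ipZ mulrCA. Qed.

Lemma places_codes y q : q \in places -> (y, q) \in codes.
Proof. by case: q => s k; rewrite mem_places => k6; apply: wfc_codes. Qed.

Lemma uniq_places : uniq places. Proof. by []. Qed.

Lemma coef_beta p q : p \in codes -> q \in codes -> coef p (beta q) = (p == q)%:R.
Proof. by move=> pc qc; rewrite /coef beta_ip // mulrC divfK // pnatr_eq0. Qed.

Definition homog (q : bool * nat) (v w : C) : K := v *: beta (false, q) + w *: beta (true, q).

Let sel_fst (V : lmodType C) (v w : V) : 1 *: v + 0 *: w + 0 = v.
Proof. by rewrite scale1r scale0r !addr0. Qed.
Let sel_snd (V : lmodType C) (v w : V) : 0 *: v + 1 *: w + 0 = w.
Proof. by rewrite scale1r scale0r add0r addr0. Qed.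
Let sel_none (V : lmodType C) (v w : V) : 0 *: v + 0 *: w = 0.
Proof. by rewrite !scale0r addr0. Qed.

Lemma homogD q v v' w w' : homog q (v + v') (w + w') = homog q v w + homog q v' w'.
Proof. exact: (@pairD_abs _ K). Qed.
Lemma homogZ q a v w : homog q (a * v) (a * w) = a *: homog q v w.
Proof. exact: (@pairZ_abs _ K). Qed.

(** Orthogonality makes this true for combinations of basis elements, and [lr_KXY] says
that the group elements are such combinations. *)
Lemma decomp (x : K) :
  x = \sum_(q <- places) homog q (coef (false, q) x) (coef (true, q) x).
Proof.
pose P x := x = \sum_(q <- places) homog q (coef (false, q) x) (coef (true, q) x).
have PD (y z : K) : P y -> P z -> P (y + z).
  move=> Py Pz; rewrite /P {1}Py {1}Pz -big_split; apply: eq_bigr => q _ /=.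
  by rewrite !coefD homogD.
have PZ a (y : K) : P y -> P (a *: y).
  move=> Py; rewrite /P {1}Py scaler_sumr; apply: eq_bigr => q _ /=.
  by rewrite !coefZ -homogZ.
have Pbeta y q : q \in places -> P (beta (y, q)).
  move=> qp; rewrite /P (bigD1_seq q qp uniq_places) /= big_seq_cond big1 => [|r].
    rewrite /homog !coef_beta ?places_codes // !xpair_eqE !eqxx.
    by case: y => /=; rewrite ?sel_snd ?sel_fst.
  case/andP=> rp rq; rewrite /homog !coef_beta ?places_codes // !xpair_eqE.
  by rewrite (negPf rq) !andbF sel_none.
have PN (y : K) : P y -> P (- y) by rewrite -scaleN1r; apply: PZ.
have PX y s m : P (beta (y, (s, (m : Z12) : nat))).
  have [m6|m6] := ltnP m 6; first by apply: Pbeta; rewrite mem_places.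
  have P' : P (beta (y, (s, (m - 6)%N))).
    by apply: Pbeta; rewrite mem_places ltn_subLR // (ltn_ord m).
  have e : m%:R = (m - 6)%:R + 6%:R :> Z12 by rewrite -natrD subnK.
  by rewrite /basis_elt /= e KX_shift KY_shift; case: y P' => [/PN|].
have PlrX s (m : Z12) : P (KX s m) by have := PX false s m; rewrite /basis_elt /= natr_Zp.
have PlrY s (m : Z12) : P (KY s m) by have := PX true s m; rewrite /basis_elt /= natr_Zp.
have Plr (g : dih 6) : P (lam C g : K).
  case: g => s m; rewrite -[lam C _]/(lr R s m) lr_KXY.
  have PDh y z a : P y -> P z -> P (a *: (y + z)) by move=> Py Pz; apply/PZ/PD.
  have PY := PDh _ _ 2^-1 (PlrY s m) (PlrY s (- m)).
  have PY' := PDh _ _ ('i / 2) (PlrY (~~ s) m) (PN _ (PlrY (~~ s) (- m))).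
  exact: PD (PD _ _ (PlrX s m) PY) PY'.
rewrite -/(P x) (galg_lam x); elim/big_ind: _ => [||g _] //; last by apply: PZ.
by have := PZ 0 _ (Plr 1%g); rewrite scale0r.
Qed.
End KD6.

(* From here on only the relations proved above are used, never the expression of these
   elements in the group basis. *)
Opaque KD_X KD_Y.

Section KD6.
Variable R : realType.
Local Notation C := R[i].
Local Notation K := (KD R 6).
Local Notation K2 := (KD2 R 6).
Local Notation KX := (KD_X R).
Local Notation KY := (KD_Y R).
Local Notation beta := (basis_elt R).

Definition homog_elt (s : bool) (k : Z12) (v w : C) : K := v *: KX s k + w *: KY s k.

Local Notation elt := homog_elt.

Lemma homogE s k (v w : C) : homog (s, k) v w = elt s k%:R v w.
Proof. by []. Qed.

Let bilinear_elt (V W : lmodType C) (f : V -> V -> W) (x y x' y' : V) v w :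
    (forall x v w y z, f x (v *: y + w *: z) = v *: f x y + w *: f x z) ->
  v *: (f x x + f y y') + w *: (f x y + f y x')
    = f x (v *: x + w *: y) + f y (w *: x' + v *: y').
Proof. by move=> fE; rewrite !fE !scalerDr addrACA [w *: f y x' + _]addrC. Qed.

Lemma elt_Delta s k v w : (k < 6)%N ->
  Delta (elt s k%:R v w) = tens (KX s k%:R) (elt s k%:R v w) + tens (KY s k%:R) (elt s (- k%:R) w v).
Proof.
move=> k6; rewrite DeltaD !DeltaZ KX_Delta // KY_Delta //.
apply: (@bilinear_elt K K2 (@tens C (dih 6))) => x v' w' y z.
by rewrite tensDr !tensZr.
Qed.

Let slice_pair (x u v u' v' : K) :
  slice x (tens u v + tens u' v' : K2) = ip x u *: v + ip x u' *: v'.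
Proof. by apply: etrans (sliceD _ _ _) _; congr (_ + _); apply: slice_tens. Qed.

Let select1 (V : lmodType C) (v w : V) : (true%:R / 2) *: v + (false%:R / 2) *: w = 2^-1 *: v.
Proof. by rewrite mul1r mul0r scale0r addr0. Qed.
Let select2 (V : lmodType C) (v w : V) : (false%:R / 2) *: v + (true%:R / 2) *: w = 2^-1 *: w.
Proof. by rewrite mul1r mul0r scale0r add0r. Qed.
Let select0 (V : lmodType C) (v w : V) : (false%:R / 2) *: v + (false%:R / 2) *: w = 0.
Proof. by rewrite mul0r !scale0r addr0. Qed.

Let two_half (V : lmodType C) (v : V) : 2 *: (2^-1 *: v) = v.
Proof. by rewrite scalerA mulfV ?pnatr_eq0 // scale1r. Qed.

Lemma slice_elt s k t l y v w : (k < 6)%N -> (l < 6)%N ->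
  slice (beta (y, (t, l))) (Delta (elt s k%:R v w)) =
  if (t, l) == (s, k) then 2^-1 *: (if y then elt s (- k%:R) w v else elt s k%:R v w) else 0.
Proof.
move=> k6 l6; rewrite elt_Delta //; apply: etrans (slice_pair _ _ _ _ _) _.
have -> : ip (beta (y, (t, l))) (KX s k%:R) = (~~ y && ((t, l) == (s, k)))%:R / 2.
  by rewrite -[KX s k%:R]/(beta (false, (s, k))) beta_ip ?wfc_codes // [_ == (_, (_, _))]xpair_eqE; case: y.
have -> : ip (beta (y, (t, l))) (KY s k%:R) = (y && ((t, l) == (s, k)))%:R / 2.
  by rewrite -[KY s k%:R]/(beta (true, (s, k))) beta_ip ?wfc_codes // [_ == (_, (_, _))]xpair_eqE; case: y.
case: ((t, l) == (s, k)); rewrite ?andbT ?andbF; last exact: select0.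
by case: y => /=; [apply: select2|apply: select1].
Qed.

Let additive_sum (V W : zmodType) (f : V -> W) (T : Type) (F : T -> V) (r : seq T) :
  (forall x y, f (x + y) = f x + f y) -> f (\sum_(p <- r) F p) = \sum_(p <- r) f (F p).
Proof.
move=> fD; have f0 : f 0 = 0 by apply: (addrI (f 0)); rewrite -fD !addr0.
exact: big_morph.
Qed.

Let slice_DeltaD z (x y : K) :
  slice z (Delta (x + y)) = slice z (Delta x) + slice z (Delta y).
Proof. by rewrite DeltaD; apply: sliceD. Qed.

Definition left_coideal (I : {vspace K}) := forall x, x \in I -> Delta x \in tensv fullv I.

Section Coideal.
Variables (I : {vspace K}) (coI : left_coideal I).

(** The reason why coideals are graded: among the homogeneous parts of [x] only the one
at [q] contributes to the slice of [Delta x] by a basis element of code [(y, q)], which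
returns this part ([y] false) or its exchanged form ([y] true). *)
Lemma coideal_slice y q x : q \in places -> x \in I ->
  let v := coef (false, q) x in let w := coef (true, q) x in
  (if y then elt q.1 (- q.2%:R) w v else elt q.1 q.2%:R v w) \in I.
Proof.
move=> qp xI /=; set e := (X in X \in I).
suff -> : e = 2 *: slice (beta (y, q)) (Delta x) by rewrite memvZ // slice_mem // coI.
rewrite [in RHS](decomp x) (additive_sum _ _ (slice_DeltaD (beta (y, q)))) (bigD1_seq q qp uniq_places) /=.
rewrite big_seq_cond big1 ?addr0 => [|p /andP[pp pq]].
  case: q qp @e => s k; rewrite mem_places => k6 e.
  by rewrite homogE slice_elt // eqxx; have th (u : K) : 2 *: (2^-1 *: u) = u := two_half u; rewrite th.
case: p pp pq => t l; case: q qp {e} => s k; rewrite !mem_places => k6 l6 pq.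
by rewrite homogE slice_elt // eq_sym (negPf pq).
Qed.

Lemma elt_opp s k v w : elt s k (- v) (- w) = - elt s k v w.
Proof. by rewrite /homog_elt !scaleNr -opprD. Qed.

Lemma elt_shift s k v w : elt s (k + 6%:R) v w = elt s k v (- w).
Proof. by rewrite /homog_elt KX_shift KY_shift scalerN scaleNr. Qed.

Lemma elt_coef s k v w : (k < 6)%N -> let x := elt s k%:R v w in
   coef (false, (s, k)) x = v /\ coef (true, (s, k)) x = w.
Proof.
move=> k6 /=; rewrite /homog_elt -[KX s k%:R]/(beta (false, (s, k))) -[KY s k%:R]/(beta (true, (s, k))).
by rewrite !coefD !coefZ !coef_beta ?wfc_codes // !xpair_eqE !eqxx /= !mulr1 !mulr0 addr0 add0r.
Qed.

(** The slice by b^s Y_k, for k < 6; the other k are reduced to these by a shift by 6. *)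
Lemma coideal_swap s k v w : elt s k v w \in I -> elt s (- k) w v \in I.
Proof.
have small (m : nat) v' w' : (m < 6)%N -> elt s m%:R v' w' \in I -> elt s (- m%:R) w' v' \in I.
  move=> m6 xI; have [e1 e2] := elt_coef s v' w' m6.
  have := @coideal_slice true (s, m) _ _ xI; rewrite /= e1 e2; apply.
  by rewrite mem_places.
rewrite -(natr_Zp k); have [k6|k6] := ltnP k 6; first exact: small.
have e : (k : nat)%:R = (k - 6)%:R + 6%:R :> Z12 by rewrite -natrD subnK.
have k6' : (k - 6 < 6)%N by rewrite ltn_subLR // (ltn_ord k).
rewrite e elt_shift => /(small _ _ _ k6').
have -> : - (k - 6)%:R = - ((k - 6)%:R + 6%:R) + 6%:R :> Z12 by rewrite opprD subrK.
by rewrite elt_shift elt_opp memvN.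
Qed.

Lemma coideal_elt s k x : (k < 6)%N -> x \in I ->
  elt s k%:R (coef (false, (s, k)) x) (coef (true, (s, k)) x) \in I.
Proof. by move=> k6 xI; apply: (@coideal_slice false (s, k)) xI; rewrite mem_places. Qed.
End Coideal.
End KD6.

(** * Classification of the graded families *)

(** The vectors (1, 0), (0, 1) and (1, zeta^m) of C^2, see [vval]. *)
Inductive vec := VX | VY | VZ of nat.
Definition vec_nat (x : vec) : nat := match x with VX => 0 | VY => 1 | VZ m => m.+2 end.
Definition nat_vec (m : nat) : vec := match m with 0 => VX | 1 => VY | m.+2 => VZ m end.
Lemma vec_natK : cancel vec_nat nat_vec. Proof. by case. Qed.
HB.instance Definition _ := Equality.copy vec (can_type vec_natK).

(** Spanning vectors of the blocks of the family of a node, in the order 1, b, a^3, b a^3,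
a, b a, a^2, b a^2. *)
Definition node_shapes (x : node) : seq (seq vec) :=
  let e := VZ 0 in let e' := VZ 6 in let u := VZ 3 in let u' := VZ 9 in
  let ee := [:: e; e'] in let uu := [:: u; u'] in let F := [:: VX; VY] in
  match x with
  | CC => [:: [:: e]; [::]; [::]; [::]; [::]; [::]; [::]; [::]]
  | I0 => [:: ee; [::]; [::]; [::]; [::]; [::]; [::]; [::]]
  | I1 => [:: [:: e]; [:: e']; [::]; [::]; [::]; [::]; [::]; [::]]
  | I2 => [:: [:: e]; [:: e]; [::]; [::]; [::]; [::]; [::]; [::]]
  | I3 => [:: [:: e]; [::]; [:: u']; [::]; [::]; [::]; [::]; [::]]
  | I4 => [:: [:: e]; [::]; [:: u]; [::]; [::]; [::]; [::]; [::]]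
  | L1 => [:: [:: e]; [::]; [::]; [::]; [::]; [::]; [:: VZ 2]; [::]]
  | L3 => [:: [:: e]; [::]; [::]; [::]; [::]; [::]; [:: VZ 6]; [::]]
  | L5 => [:: [:: e]; [::]; [::]; [::]; [::]; [::]; [:: VZ 10]; [::]]
  | J0 => [:: ee; ee; [::]; [::]; [::]; [::]; [::]; [::]]
  | J1 => [:: ee; [::]; [::]; [::]; [::]; [:: VX]; [::]; [::]]
  | J2 => [:: ee; [::]; [::]; [::]; [::]; [::]; [::]; [:: VX]]
  | J3 => [:: ee; [::]; [::]; uu; [::]; [::]; [::]; [::]]
  | J4 => [:: ee; [::]; [::]; [::]; [::]; [::]; [::]; [:: VY]]
  | J5 => [:: ee; [::]; [::]; [::]; [::]; [:: VY]; [::]; [::]]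
  | J20 => [:: ee; [::]; uu; [::]; [::]; [::]; [::]; [::]]
  | K1 => [:: ee; [::]; [::]; [::]; [::]; [::]; F; [::]]
  | K21 => [:: [:: e]; [::]; [:: u]; [::]; [:: VZ 1]; [::]; [:: VZ 2]; [::]]
  | K22 => [:: [:: e]; [::]; [:: u']; [::]; [:: VZ 3]; [::]; [:: VZ 6]; [::]]
  | K23 => [:: [:: e]; [::]; [:: u]; [::]; [:: VZ 5]; [::]; [:: VZ 10]; [::]]
  | K24 => [:: [:: e]; [::]; [:: u']; [::]; [:: VZ 11]; [::]; [:: VZ 10]; [::]]
  | K25 => [:: [:: e]; [::]; [:: u]; [::]; [:: VZ 9]; [::]; [:: VZ 6]; [::]]
  | K26 => [:: [:: e]; [::]; [:: u']; [::]; [:: VZ 7]; [::]; [:: VZ 2]; [::]]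
  | K41 => [:: [:: e]; [:: e']; [::]; [::]; [::]; [::]; [:: VZ 6]; [:: VZ 0]]
  | K42 => [:: [:: e]; [:: e]; [::]; [::]; [::]; [::]; [:: VZ 6]; [:: VZ 6]]
  | K0 => [:: ee; ee; uu; uu; [::]; [::]; [::]; [::]]
  | K01 => [:: ee; [::]; uu; [::]; [::]; [:: VX]; [::]; [:: VY]]
  | K02 => [:: ee; [::]; uu; [::]; [::]; [:: VY]; [::]; [:: VX]]
  | K2 => [:: ee; [::]; uu; [::]; F; [::]; F; [::]]
  | K3 => [:: ee; [::]; [::]; uu; [::]; F; F; [::]]
  | K4 => [:: ee; ee; [::]; [::]; [::]; [::]; F; F]
  | KD6 => [:: ee; ee; uu; uu; F; F; F; F]
  end.

(** In this section [U s k] is the set of the (v, w) such that b^s (v X_k + w Y_k) is in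
the coideal subalgebra to be classified. The blocks with k = 1 and k = 2 are called A, B
(k = 1, without and with flip) and E, D (k = 2, without and with flip); those with
k = 0 and k = 3 are controlled by the vectors (1, c) that they contain, which act on the
other blocks by multiplication. The vector (1, -1) of [U false 0], called [g1], is the
central element a^6. *)
Section Classification.
Variables (C : numClosedFieldType) (U : bool -> Z12 -> C -> C -> Prop).

Hypothesis U0 : forall s k, U s k 0 0.
Hypothesis UD : forall s k v w v' w', U s k v w -> U s k v' w' -> U s k (v + v') (w + w').
Hypothesis UZ : forall s k a v w, U s k v w -> U s k (a * v) (a * w).
Hypothesis U1 : U false 0 1 1.
Hypothesis Uswap : forall s k v w, U s k v w -> U s (- k) w v.
Hypothesis Ushift : forall s k v w, U s k v w -> U s (k + 6%:R) v (- w).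
Hypothesis UM : forall s k t l v w v' w', U s k v w -> U t l v' w' ->
  U (s (+) t) ((if t then - k else k) + l) (v * v') (w * w').
Hypothesis UJ : forall s k v w, U s k v w -> U s (if s then k else - k) v^* w^*.

Fixpoint in_span (l : seq (C * C)) (v w : C) : Prop :=
  if l is p :: l' then exists a, in_span l' (v - a * p.1) (w - a * p.2)
  else v = 0 /\ w = 0.

Definition spans s k l := forall v w, U s k v w <-> in_span l v w.

Lemma UB s k v w v' w' : U s k v w -> U s k v' w' -> U s k (v - v') (w - w').
Proof. by move=> h /(UZ (-1)); rewrite !mulN1r; apply: UD. Qed.

Lemma Uscale s k v w a : a != 0 -> U s k (a * v) (a * w) -> U s k v w.
Proof. by move=> a0 /(UZ a^-1); rewrite !mulKf. Qed.

Lemma U0swap s v w : U s 0 v w -> U s 0 w v.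
Proof. by move/Uswap; rewrite oppr0. Qed.

(** A block with k = 0 is stable under the exchange of coordinates, hence contains the
eigenvectors (1, 1) and (1, -1) as soon as some vector is not orthogonal to them. The
same holds below for k = 3, with the map (v, w) |-> (w, - v) and its eigenvectors (1, i)
and (1, - i). *)
Lemma Usum s v w : U s 0 v w -> v + w != 0 -> U s 0 1 1.
Proof.
move=> h n; apply: (Uscale n); rewrite !mulr1 {2}[v + w]addrC.
exact: UD h (U0swap h).
Qed.

Lemma Udif s v w : U s 0 v w -> v != w -> U s 0 1 (-1).
Proof.
move=> h n; apply: (@Uscale _ _ _ _ (v - w)); first by rewrite subr_eq0.
by rewrite mulrN !mulr1 opprB; apply: UB h (U0swap h).
Qed.

Lemma U3swap s v w : U s 3%:R v w -> U s 3%:R w (- v).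
Proof.
move/Uswap/Ushift; have -> : - 3%:R + 6%:R = 3%:R :> Z12 by apply: val_inj.
by [].
Qed.

Lemma i2 : 'i * 'i = -1 :> C. Proof. by rewrite -expr2 sqrCi. Qed.

Lemma Uisum s v w : U s 3%:R v w -> v != 'i * w -> U s 3%:R 1 'i.
Proof.
move=> h n; apply: (@Uscale _ _ _ _ (v - 'i * w)); first by rewrite subr_eq0.
rewrite mulr1; have -> : (v - 'i * w) * 'i = w - 'i * (- v).
  by rewrite mulrBl mulrAC i2; ring.
exact: UB h (UZ 'i (U3swap h)).
Qed.

Lemma Uidif s v w : U s 3%:R v w -> v != - ('i * w) -> U s 3%:R 1 (- 'i).
Proof.
move=> h n; apply: (@Uscale _ _ _ _ (v + 'i * w)); first by rewrite addr_eq0.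
rewrite mulr1; have -> : (v + 'i * w) * - 'i = w + 'i * (- v).
  by rewrite mulrN mulrDl mulrAC i2; ring.
exact: UD h (UZ 'i (U3swap h)).
Qed.

(* The products of the blocks, transported by exchange and shift to the blocks with
   k <= 3. *)
Let UMe s k t l m v w v' w' : U s k v w -> U t l v' w' ->
  m = (if t then - k else k) + l -> U (s (+) t) m (v * v') (w * w').
Proof. by move=> h h' ->; apply: UM. Qed.

Let Uswape s k m v w : U s k v w -> m = - k -> U s m w v.
Proof. by move=> h ->; apply: Uswap. Qed.

Let Uswap6 s k m v w : U s k v w -> m = - k + 6%:R -> U s m w (- v).
Proof. by move=> h ->; apply/Ushift/Uswap. Qed.

Let Uadd6 s k m v w : U s k v w -> m = k + 6%:R -> U s m v (- w).
Proof. by move=> h ->; apply: Ushift. Qed.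

Lemma Ug1 s k v w : U false 0 1 (-1) -> U s k v w -> U s k v (- w).
Proof. by move=> g h; have := UMe h g (esym (addr0 k)); rewrite addbF mulr1 mulrN1. Qed.

Lemma mul_inv k v w v' w' : U false k v w -> U false k v' w' -> U false 0 (v * w') (w * v').
Proof. by move=> h /Uswap h'; apply: (UMe h h'); rewrite subrr. Qed.
Lemma mul_flip k v w v' w' : U true k v w -> U true k v' w' -> U false 0 (v * v') (w * w').
Proof. by move=> h h'; apply: (UMe h h'); rewrite addNr. Qed.

Notation A := (U false 1).
Notation B := (U true 1).
Notation E := (U false 2%:R).
Notation D := (U true 2%:R).

Lemma AA v w v' w' : A v w -> A v' w' -> E (v * v') (w * w').
Proof. by move=> h h'; apply: (UMe h h'); apply: val_inj. Qed.
Lemma EE v w v' w' : E v w -> E v' w' -> E (w * w') (- (v * v')).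
Proof.
by move=> h h'; apply: (Uswap6 (UMe h h' erefl)); apply: val_inj.
Qed.
Lemma BB v w v' w' : B v w -> B v' w' -> E (w * v') (v * w').
Proof.
move=> h h'; have h2 := Uswape h' erefl.
by apply: (Uswape (UMe h h2 erefl)); apply: val_inj.
Qed.
Lemma DD v w v' w' : D v w -> D v' w' -> E (v * w') (- (w * v')).
Proof.
move=> h h'; have h2 := Uswape h' erefl.
by apply: (Uadd6 (UMe h h2 erefl)); apply: val_inj.
Qed.
Lemma AB v w v' w' : A v w -> B v' w' -> U true 0 (v * v') (w * w').
Proof. by move=> h h'; apply: (UMe h h'); apply: val_inj. Qed.
Lemma AE v w v' w' : A v w -> E v' w' -> U false 3%:R (v * v') (w * w').
Proof. by move=> h h'; apply: (UMe h h'); apply: val_inj. Qed.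
Lemma AD v w v' w' : A v w -> D v' w' -> B (v * v') (w * w').
Proof. by move=> h h'; apply: (UMe h h'); apply: val_inj. Qed.
Lemma BE3 v w v' w' : B v w -> E v' w' -> U true 3%:R (v * v') (w * w').
Proof. by move=> h h'; apply: (UMe h h'); apply: val_inj. Qed.
Lemma BE v w v' w' : B v w -> E v' w' -> B (w * v') (v * w').
Proof.
move=> h h'; have h2 := Uswape h' erefl.
by apply: (Uswape (UMe h h2 erefl)); apply: val_inj.
Qed.
Lemma BD v w v' w' : B v w -> D v' w' -> A (v * v') (w * w').
Proof. by move=> h h'; apply: (UMe h h'); apply: val_inj. Qed.
Lemma BD3 v w v' w' : B v w -> D v' w' -> U false 3%:R (v * w') (- (w * v')).
Proof.
move=> h h'; have h2 := Uswape h' erefl.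
by apply: (Uadd6 (UMe h h2 erefl)); apply: val_inj.
Qed.
Lemma ED0 v w v' w' : E v w -> D v' w' -> U true 0 (v * v') (w * w').
Proof. by move=> h h'; apply: (UMe h h'); apply: val_inj. Qed.
Lemma ED v w v' w' : E v w -> D v' w' -> D (v * w') (- (w * v')).
Proof.
move=> h h'; have h2 := Uswape h' erefl.
by apply: (Uadd6 (UMe h h2 erefl)); apply: val_inj.
Qed.

(** A vector (1, c) with c <> 0 in a block with k = 0 or k = 3 maps the blocks A, B, E, D
bijectively to each other; hence if one of them vanishes and another one does not, such
a vector cannot exist. *)
Lemma g2A c v w : U true 0 1 c -> A v w -> B v (c * w).
Proof. by move=> g h; rewrite -[v]mul1r; apply: (UMe g h); apply: val_inj. Qed.
Lemma g2B c v w : U true 0 1 c -> B v w -> A v (c * w).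
Proof. by move=> g h; rewrite -[v]mul1r; apply: (UMe g h); apply: val_inj. Qed.
Lemma g2E c v w : U true 0 1 c -> E v w -> D v (c * w).
Proof. by move=> g h; rewrite -[v]mul1r; apply: (UMe g h); apply: val_inj. Qed.
Lemma g2D c v w : U true 0 1 c -> D v w -> E v (c * w).
Proof. by move=> g h; rewrite -[v]mul1r; apply: (UMe g h); apply: val_inj. Qed.
Lemma g4E c v w : U false 3%:R 1 c -> E v w -> A (c * w) (- v).
Proof. by move=> g h; rewrite -[v]mul1r; apply: (Uswap6 (UMe g h erefl)); apply: val_inj. Qed.
Lemma g4B c v w : U false 3%:R 1 c -> B v w -> D (c * w) v.
Proof. by move=> g h; rewrite -[v]mul1r; apply: (Uswape (UMe g h erefl)); apply: val_inj. Qed.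
Lemma g4D c v w : U false 3%:R 1 c -> D v w -> B (c * w) v.
Proof. by move=> g h; rewrite -[v]mul1r; apply: (Uswape (UMe g h erefl)); apply: val_inj. Qed.
Lemma g6A c v w : U true 3%:R 1 c -> A v w -> D (c * w) (- v).
Proof. by move=> g h; rewrite -[v]mul1r; apply: (Uswap6 (UMe g h erefl)); apply: val_inj. Qed.
Lemma g6E c v w : U true 3%:R 1 c -> E v w -> B (c * w) (- v).
Proof. by move=> g h; rewrite -[v]mul1r; apply: (Uswap6 (UMe g h erefl)); apply: val_inj. Qed.
Lemma g6B c v w : U true 3%:R 1 c -> B v w -> E (c * w) v.
Proof. by move=> g h; rewrite -[v]mul1r; apply: (Uswape (UMe g h erefl)); apply: val_inj. Qed.
Lemma g6D c v w : U true 3%:R 1 c -> D v w -> A (c * w) v.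
Proof. by move=> g h; rewrite -[v]mul1r; apply: (Uswape (UMe g h erefl)); apply: val_inj. Qed.

Lemma gg_flip c c' : U true 0 1 c -> U true 0 1 c' -> U false 0 1 (c * c').
Proof. by move=> h h'; have := UMe h h' erefl; rewrite mulr1 oppr0 addr0. Qed.
Lemma g2_mul k c c' : U true 0 1 c -> U false k 1 c' -> U true k 1 (c * c').
Proof. by move=> h h'; have := UMe h h' erefl; rewrite mulr1 add0r. Qed.
Lemma g26 k c c' : U true 0 1 c -> U true k 1 c' -> U false k 1 (c * c').
Proof. by move=> h h'; have := UMe h h' erefl; rewrite mulr1 oppr0 add0r. Qed.
Lemma g46 c c' : U false 3%:R 1 c -> U true 3%:R 1 c' -> U true 0 1 (c * c').
Proof. by move=> h h'; have := UMe h h' erefl; rewrite mulr1 addNr. Qed.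
Lemma g45 c c' : U false 3%:R 1 c -> U false 3%:R 1 c' -> U false 0 1 (- (c * c')).
Proof.
move=> h h'; have := UMe h h' erefl => /Ushift; rewrite mulr1.
by have -> : 3%:R + 3%:R + 6%:R = 0 :> Z12 by apply: val_inj.
Qed.
Lemma g66 c c' : U true 3%:R 1 c -> U true 3%:R 1 c' -> U false 0 1 (c * c').
Proof. by move=> h h'; have := UMe h h' erefl; rewrite mulr1 addNr. Qed.

Lemma AJ v w : A v w -> A w^* v^*.
Proof. by move=> h; apply: (Uswape (UJ h)); apply: val_inj. Qed.
Lemma EJ v w : E v w -> E w^* v^*.
Proof. by move=> h; apply: (Uswape (UJ h)); apply: val_inj. Qed.
Lemma flipJ k v w : U true k v w -> U true k v^* w^*.
Proof. exact: UJ. Qed.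

Definition vanishes s k := forall v w, U s k v w -> v = 0 /\ w = 0.
Definition line s k t := U s k 1 t /\ forall v w, U s k v w -> w = v * t.
Definition line01 s k := U s k 0 1 /\ forall v w, U s k v w -> v = 0.
Definition full s k := U s k 1 0 /\ U s k 0 1.

Lemma fullE s k v w : full s k -> U s k v w.
Proof.
case=> /(UZ v) h /(UZ w) h'; have := UD h h'.
by rewrite !mulr0 !mulr1 addr0 add0r.
Qed.

Lemma trichotomy s k :
  [\/ vanishes s k, exists t, line s k t, line01 s k | full s k].
Proof.
have [[v [w [h n]]]|no] := EM (exists v w, U s k v w /\ (v, w) <> (0, 0)); last first.
  constructor 1 => v w h; apply: contrapT => n; apply: no.
  by exists v, w; split => // -[v0 w0]; apply: n.
have [[v' [w' [h' d]]]|no] := EM (exists v' w', U s k v' w' /\ v * w' != w * v').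
  constructor 4; have d0 : v * w' - w * v' != 0 by rewrite subr_eq0.
  split; apply: (Uscale d0).
    have -> : (v * w' - w * v') * 0 = w' * w - w * w' by ring.
    have -> : (v * w' - w * v') * 1 = w' * v - w * v' by ring.
    by apply: UB (UZ w' h) (UZ w h').
  have -> : (v * w' - w * v') * 0 = v * v' - v' * v by ring.
  have -> : (v * w' - w * v') * 1 = v * w' - v' * w by ring.
  by apply: UB (UZ v h') (UZ v' h).
have dep v' w' : U s k v' w' -> v * w' = w * v'.
  by move=> h'; apply/eqP; apply: contrapT => /negP n'; apply: no; exists v', w'.
have [v0|v0] := eqVneq v 0; last first.
  constructor 2; exists (w / v); split.
    by apply: (Uscale v0); rewrite mulr1 mulrCA divff ?mulr1.
  by move=> v' w' /dep e; apply: (mulfI v0); rewrite e mulrCA [v * _]mulrC divfK // mulrC.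
have w0 : w != 0 by apply/eqP => w0; apply: n; rewrite v0 w0.
constructor 3; split; first by apply: (Uscale w0); rewrite mulr0 mulr1 -v0.
by move=> v' w' /dep /eqP; rewrite v0 mul0r eq_sym mulf_eq0 (negPf w0) => /eqP.
Qed.

Notation g1 := (U false 0 1 (-1)).

(** Multiplying (1, 0) with the exchange of (0, 1), or with itself in a flipped block,
gives (1, 0) in the block of the identity. *)
Lemma full_g1 s k : full s k -> g1.
Proof.
case=> h h'; apply: (@Udif false 1 0); last exact: oner_neq0.
by case: s h h' => h h'; [have := mul_flip h h|have := mul_inv h h'];
  rewrite !(mulr0, mulr1, mul0r).
Qed.

Let char2 (t : C) : - t = t -> t = 0.
Proof. by move/eqP; rewrite eq_sym -addr_eq0 -mulr2n mulrn_eq0 => /eqP. Qed.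

(** Multiplication by a^6 changes the sign of the second coordinate. *)
Lemma line_g1 s k t : line s k t -> t != 0 -> ~ g1.
Proof.
move=> [h only] t0 g; have := only _ _ (Ug1 g h); rewrite mul1r => /char2 z.
by rewrite z eqxx in t0.
Qed.

(** The adjoint combined with the exchange maps (v, w) to its conjugate (w, v), so a line
is not a coordinate axis. *)
Lemma unflipped_line k : (forall v w, U false k v w -> U false k w^* v^*) ->
  [\/ vanishes false k, exists t, [/\ line false k t, t != 0 & ~ g1] | full false k].
Proof.
move=> J; have [n|[t l]|[h only]|f] := trichotomy false k.
- by constructor 1.
- constructor 2; exists t; have t0 : t != 0.
    case: l => h only; apply/eqP => t0; have := only _ _ (J _ _ h).
    by rewrite t0 mulr0 => /eqP; rewrite conjC1 oner_eq0.
  by split => //; apply: line_g1 l t0.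
- by have /eqP := only _ _ (J _ _ h); rewrite conjC1 oner_eq0.
- by constructor 3.
Qed.

(** The adjoint conjugates the coordinates in place, so a slope t is real; the square of
(1, t) is (1, t^2) in the block of the identity, where (1, 1) is present: either t^2 = 1
or a^6 is present, and then [line_g1] leaves only the coordinate axes. *)
Lemma flipped_line k :
  [\/ vanishes true k, [/\ line true k 0 & g1] \/ [/\ line01 true k & g1],
      [/\ line true k 1 & ~ g1] \/ [/\ line true k (-1) & ~ g1] | full true k].
Proof.
have [n|[t l]|[h only]|f] := trichotomy true k.
- by constructor 1.
- have [h only] := l; have tJ : t^* = t.
    by have := only _ _ (flipJ h); rewrite conjC1 mul1r.
  have sq : t * t = 1 \/ g1.
    have [|n] := eqVneq (t * t) 1; [by left | right].
    by apply: (Udif (mul_flip h h)); rewrite mulr1 eq_sym.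
  have [t0|t0] := eqVneq t 0.
    constructor 2; left; rewrite -t0; split => //.
    by case: sq => // /eqP; rewrite t0 mul0r eq_sym oner_eq0.
  have ng := line_g1 l t0; constructor 3; case: sq => // /eqP.
  rewrite -subr_eq0 (_ : _ - 1 = (t - 1) * (t + 1)); last ring.
  rewrite mulf_eq0 subr_eq0 addr_eq0; case/orP => /eqP e; [left | right]; by move: l ng; rewrite e.
- constructor 2; right; split => //.
  by apply: (Udif (mul_flip h h)); rewrite mul0r mulr1 eq_sym oner_neq0.
- by constructor 4.
Qed.

Lemma spans0 s k : vanishes s k -> spans s k [::].
Proof. by move=> n v w; split => [/n|[-> ->]]. Qed.

Lemma spans1 s k t : line s k t -> spans s k [:: (1, t)].
Proof.
move=> [h only] v w; split => [/only ->|/=[a []]].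
  by exists v; rewrite /= mulr1 !subrr.
rewrite mulr1 => /subr0_eq -> /subr0_eq ->.
by have := UZ a h; rewrite mulr1.
Qed.

Lemma spans01 s k : line01 s k -> spans s k [:: (0, 1)].
Proof.
move=> [h only] v w; split => [/only ->|/=[a []]].
  by exists w; rewrite /= mulr1 mulr0 !subrr.
rewrite mulr1 mulr0 => /subr0_eq -> /subr0_eq ->.
by have := UZ a h; rewrite mulr1 mulr0.
Qed.

Lemma spans_full s k : full s k -> spans s k [:: (1, 0); (0, 1)].
Proof.
move=> f v w; split => _; last exact: fullE.
by exists v, w; rewrite /= !(mulr0, mulr1) !(subrr, subr0).
Qed.

Lemma full_pair s k t : t != 0 -> U s k 1 t -> U s k 1 (- t) -> full s k.
Proof.
move=> t0 h h'; have two0 : 2 != 0 :> C by rewrite pnatr_eq0.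
split.
  by apply: (Uscale two0); have := UD h h'; rewrite subrr mulr0 mulr1.
apply: (@Uscale _ _ _ _ (2 * t)); first by rewrite mulf_neq0.
have := UB h h'; rewrite subrr opprK mulr0 mulr1.
by have -> : t + t = 2 * t by ring.
Qed.

Lemma spans_pair s k t : t != 0 -> U s k 1 t -> U s k 1 (- t) ->
  spans s k [:: (1, t); (1, - t)].
Proof.
move=> t0 h h' v w; split => _; last exact: fullE (full_pair t0 h h').
exists ((v + w / t) / 2), ((v - w / t) / 2); rewrite /= !mulr1; split; last by field.
by field.
Qed.

Lemma spansGf : (g1 /\ spans false 0 [:: (1, 1); (1, -1)]) \/ (~ g1 /\ spans false 0 [:: (1, 1)]).
Proof.
have [g|n] := EM g1; [left|right]; split=> //; first exact: spans_pair (oner_neq0 C) U1 g.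
apply: spans1; split=> // v w h; rewrite mulr1; apply/eqP; apply: contrapT => /negP vw.
by apply: n; apply: Udif h _; rewrite eq_sym.
Qed.

Lemma spansG : [\/ vanishes true 0,
   [/\ U true 0 1 1, ~ U true 0 1 (-1) & line true 0 1],
   [/\ ~ U true 0 1 1, U true 0 1 (-1) & line true 0 (-1)] |
   U true 0 1 1 /\ U true 0 1 (-1)].
Proof.
have sum v w : ~ U true 0 1 1 -> U true 0 v w -> w = - v.
  move=> n h; apply/eqP; apply: contrapT => /negP vw; apply: n; apply: (Usum h).
  by rewrite addrC addr_eq0.
have dif v w : ~ U true 0 1 (-1) -> U true 0 v w -> w = v.
  move=> n h; apply/eqP; apply: contrapT => /negP vw; apply: n; apply: (Udif h).
  by rewrite eq_sym.
have [g|n] := EM (U true 0 1 1); have [g'|n'] := EM (U true 0 1 (-1)).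
- by constructor 4.
- by constructor 2; split=> //; split=> // v w /(dif _ _ n'); rewrite mulr1.
- by constructor 3; split=> //; split=> // v w /(sum _ _ n); rewrite mulrN1.
- constructor 1 => v w h; have := sum _ _ n h; rewrite (dif _ _ n' h) => /esym/char2 ->.
  by [].
Qed.

Lemma spansF s : [\/ vanishes s 3%:R,
   [/\ U s 3%:R 1 'i, ~ U s 3%:R 1 (-'i) & line s 3%:R 'i],
   [/\ ~ U s 3%:R 1 'i, U s 3%:R 1 (-'i) & line s 3%:R (- 'i)] |
   U s 3%:R 1 'i /\ U s 3%:R 1 (-'i)].
Proof.
have sum v w : ~ U s 3%:R 1 'i -> U s 3%:R v w -> v = 'i * w.
  by move=> n h; apply/eqP; apply: contrapT => /negP vw; apply: n; apply: (Uisum h).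
have dif v w : ~ U s 3%:R 1 (- 'i) -> U s 3%:R v w -> v = - ('i * w).
  by move=> n h; apply/eqP; apply: contrapT => /negP vw; apply: n; apply: (Uidif h).
have [g|n] := EM (U s 3%:R 1 'i); have [g'|n'] := EM (U s 3%:R 1 (-'i)).
- by constructor 4.
- constructor 2; split=> //; split=> // v w /(dif _ _ n') ->.
  by rewrite mulrC mulrN mulrA i2 mulN1r opprK.
- constructor 3; split=> //; split=> // v w /(sum _ _ n) ->.
  by rewrite mulrC mulNr mulrA i2 mulN1r opprK.
- constructor 1 => v w h; have e := sum _ _ n h; have := dif _ _ n' h; rewrite -e => /esym/char2 v0.
  by split => //; move/eqP: e; rewrite v0 eq_sym mulf_eq0 (negPf (neq0Ci _)) => /eqP.
Qed.

Definition nonnil s k := exists v w, U s k v w /\ ~ (v = 0 /\ w = 0).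

Lemma line_nonnil s k t : line s k t -> nonnil s k.
Proof. by move=> [h _]; exists 1, t; split => // -[/eqP]; rewrite oner_eq0. Qed.
Lemma line01_nonnil s k : line01 s k -> nonnil s k.
Proof. by move=> [h _]; exists 0, 1; split => // -[_ /eqP]; rewrite oner_eq0. Qed.
Lemma full_nonnil s k : full s k -> nonnil s k.
Proof. by move=> [h _]; exists 1, 0; split => // -[/eqP]; rewrite oner_eq0. Qed.

Let not_nil1 s k w : vanishes s k -> ~ U s k 1 w.
Proof. by move=> n /n[/eqP]; rewrite oner_eq0. Qed.

Let G_nil : (forall c, c != 0 -> ~ U true 0 1 c) -> vanishes true 0.
Proof.
move=> no; have n1 := no 1 (oner_neq0 C); have nN1 := no (-1).
by case: spansG => [//|[]//|[_ /nN1]|[]//]; rewrite oppr_eq0 oner_neq0 => /(_ isT).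
Qed.

Let F_nil s : (forall c, c != 0 -> ~ U s 3%:R 1 c) -> vanishes s 3%:R.
Proof.
move=> no; have n1 := no 'i (neq0Ci C); have nN1 := no (- 'i).
by case: (spansF s) => [//|[]//|[_ /nN1]|[]//]; rewrite oppr_eq0 (neq0Ci C) => /(_ isT).
Qed.

Let G_nilP s k s' k' : nonnil s k -> vanishes s' k' ->
  (forall c v w, U true 0 1 c -> U s k v w -> U s' k' v (c * w)) -> vanishes true 0.
Proof.
move=> [v [w [h n]]] n' act; apply: G_nil => c c0 g; apply: n.
by have [-> /eqP] := n' _ _ (act _ _ _ g h); rewrite mulf_eq0 (negPf c0) => /eqP.
Qed.

Let F_nilP r s k s' k' : nonnil s k -> vanishes s' k' ->
  (forall c v w, U r 3%:R 1 c -> U s k v w -> U s' k' (c * w) v \/ U s' k' (c * w) (- v)) -> vanishes r 3%:R.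
Proof.
move=> [v [w [h n]]] n' act; apply: F_nil => c c0 g; apply: n.
have cw : c * w = 0 -> w = 0 by move/eqP; rewrite mulf_eq0 (negPf c0) => /eqP.
case: (act _ _ _ g h) => /n'[/cw -> /eqP]; rewrite ?oppr_eq0 => /eqP ->; by [].
Qed.

Variable zeta : C.
Hypothesis zeta4 : zeta ^+ 4 = zeta ^+ 2 - 1.
Hypothesis zeta3 : zeta ^+ 3 = 'i.

Definition vval (x : vec) : C * C :=
  match x with VX => (1, 0) | VY => (0, 1) | VZ m => (1, zeta ^+ m) end.

Definition spansv s k l := spans s k [seq vval x | x <- l].

Definition matches (x : node) : Prop :=
  let: l := node_shapes x in
  [/\ spansv false 0 (nth [::] l 0), spansv true 0 (nth [::] l 1),
      spansv false 3%:R (nth [::] l 2) & spansv true 3%:R (nth [::] l 3)] /\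
  [/\ spansv false 1 (nth [::] l 4), spansv true 1 (nth [::] l 5),
      spansv false 2%:R (nth [::] l 6) & spansv true 2%:R (nth [::] l 7)].

Let zeta6 : zeta ^+ 6 = -1. Proof. by rewrite (exprM zeta 3 2) zeta3 sqrCi. Qed.
Let zeta9 : zeta ^+ 9 = -'i. Proof. by rewrite (exprD zeta 6 3) zeta6 zeta3 mulN1r. Qed.

Lemma sv_nil s k : vanishes s k -> spansv s k [::]. Proof. exact: spans0. Qed.
Lemma sv_line s k m : line s k (zeta ^+ m) -> spansv s k [:: VZ m]. Proof. exact: spans1. Qed.
Lemma sv_line0 s k : line s k 0 -> spansv s k [:: VX]. Proof. exact: spans1. Qed.
Lemma sv_line01 s k : line01 s k -> spansv s k [:: VY]. Proof. exact: spans01. Qed.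
Lemma sv_full s k : full s k -> spansv s k [:: VX; VY]. Proof. exact: spans_full. Qed.
Lemma sv_pairG s : U s 0 1 1 -> U s 0 1 (-1) -> spansv s 0 [:: VZ 0; VZ 6].
Proof. by rewrite /spansv /= expr0 zeta6; apply: spans_pair; apply: oner_neq0. Qed.
Lemma sv_pairF s : U s 3%:R 1 'i -> U s 3%:R 1 (- 'i) -> spansv s 3%:R [:: VZ 3; VZ 9].
Proof. by rewrite /spansv /= zeta3 zeta9; apply: spans_pair; apply: neq0Ci. Qed.
Lemma sv_G : spansv false 0 (if `[< g1 >] then [:: VZ 0; VZ 6] else [:: VZ 0]).
Proof.
case: spansGf => -[g h]; first by rewrite asboolT // /spansv /= expr0 zeta6.
by rewrite asboolF // /spansv /= expr0.
Qed.

Lemma sv_g1 : g1 -> spansv false 0 [:: VZ 0; VZ 6].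
Proof. by move=> g; have := sv_G; rewrite asboolT. Qed.
Lemma sv_ng1 : ~ g1 -> spansv false 0 [:: VZ 0].
Proof. by move=> g; have := sv_G; rewrite asboolF. Qed.

Lemma root3 t : t ^+ 3 = -1 -> [\/ t = zeta ^+ 2, t = zeta ^+ 6 | t = zeta ^+ 10].
Proof.
have z10 : zeta ^+ 10 = 1 - zeta ^+ 2 by rewrite (exprD zeta 6 4) zeta6 zeta4; ring.
move/eqP; rewrite -addr_eq0 => /eqP t3.
have e : (t - zeta ^+ 2) * (t - zeta ^+ 6) * (t - zeta ^+ 10) = 0.
  rewrite zeta6 z10 -[RHS]t3.
  have -> : (t - zeta ^+ 2) * (t - -1) * (t - (1 - zeta ^+ 2))
    = t ^+ 3 - t + (zeta ^+ 2 - zeta ^+ 4) * (t + 1) by ring.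
  by rewrite zeta4; ring.
move/eqP: e; rewrite !mulf_eq0 !subr_eq0 -orbA => /or3P[]/eqP ->;
  by [constructor 1 | constructor 2 | constructor 3].
Qed.

(** By [root3], t^2 is one of three even powers of zeta, each with two opposite square
roots zeta^m and zeta^(m + 6). *)
Lemma root6 t : t ^+ 6 = -1 -> exists2 m, t = zeta ^+ m & m \in [:: 1; 3; 5; 7; 9; 11]%N.
Proof.
rewrite (exprM t 2 3) => /root3 h.
have sq m : t ^+ 2 = zeta ^+ (m * 2) -> t = zeta ^+ m \/ t = zeta ^+ (m + 6).
  move/eqP; rewrite exprM eqf_sqr exprD zeta6 mulrN1 => /orP[]/eqP; by [left|right].
by case: h => [/(sq 1%N)|/(sq 3%N)|/(sq 5%N)] [] ->; eexists; first reflexivity.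
Qed.

Ltac by_node x := exists x; split; split;
  first [ exact: sv_nil | exact: sv_full | by [] | exact: sv_g1 | exact: sv_ng1
        | exact: sv_line | exact: sv_pairG | exact: sv_pairF | exact: sv_line0 | exact: sv_line01
        | by apply: sv_line; rewrite ?expr0 ?zeta3 ?zeta6 ?zeta9 ].

(* An empty block next to a nonempty one excludes the vectors (1, c) that would map one
   to the other. *)
Let GAB : nonnil false 1 -> vanishes true 1 -> vanishes true 0.
Proof. by move=> n n'; apply: (G_nilP n n') => c v w; apply: g2A. Qed.
Let GBA : nonnil true 1 -> vanishes false 1 -> vanishes true 0.
Proof. by move=> n n'; apply: (G_nilP n n') => c v w; apply: g2B. Qed.
Let GED : nonnil false 2%:R -> vanishes true 2%:R -> vanishes true 0.
Proof. by move=> n n'; apply: (G_nilP n n') => c v w; apply: g2E. Qed.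
Let GDE : nonnil true 2%:R -> vanishes false 2%:R -> vanishes true 0.
Proof. by move=> n n'; apply: (G_nilP n n') => c v w; apply: g2D. Qed.
Let FEA : nonnil false 2%:R -> vanishes false 1 -> vanishes false 3%:R.
Proof. by move=> n n'; apply: (F_nilP n n') => c v w g h; right; apply: g4E g h. Qed.
Let FBD : nonnil true 1 -> vanishes true 2%:R -> vanishes false 3%:R.
Proof. by move=> n n'; apply: (F_nilP n n') => c v w g h; left; apply: g4B g h. Qed.
Let FDB : nonnil true 2%:R -> vanishes true 1 -> vanishes false 3%:R.
Proof. by move=> n n'; apply: (F_nilP n n') => c v w g h; left; apply: g4D g h. Qed.
Let HAD : nonnil false 1 -> vanishes true 2%:R -> vanishes true 3%:R.
Proof. by move=> n n'; apply: (F_nilP n n') => c v w g h; right; apply: g6A g h. Qed.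
Let HDA : nonnil true 2%:R -> vanishes false 1 -> vanishes true 3%:R.
Proof. by move=> n n'; apply: (F_nilP n n') => c v w g h; left; apply: g6D g h. Qed.
Let HEB : nonnil false 2%:R -> vanishes true 1 -> vanishes true 3%:R.
Proof. by move=> n n'; apply: (F_nilP n n') => c v w g h; right; apply: g6E g h. Qed.
Let HBE : nonnil true 1 -> vanishes false 2%:R -> vanishes true 3%:R.
Proof. by move=> n n'; apply: (F_nilP n n') => c v w g h; left; apply: g6B g h. Qed.

Let pairG s v w : U s 0 v w -> v != w -> v + w != 0 -> U s 0 1 1 /\ U s 0 1 (-1).
Proof. by move=> h n n'; split; [apply: Usum h n' | apply: Udif h n]. Qed.

Let pairF10 s v : v != 0 -> U s 3%:R v 0 -> U s 3%:R 1 'i /\ U s 3%:R 1 (- 'i).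
Proof.
by move=> v0 h; split; [apply: Uisum h _|apply: Uidif h _]; rewrite mulr0 ?oppr0.
Qed.
Let pairF01 s w : w != 0 -> U s 3%:R 0 w -> U s 3%:R 1 'i /\ U s 3%:R 1 (- 'i).
Proof.
move=> w0 h; split; [apply: Uisum h _|apply: Uidif h _]; rewrite eq_sym ?oppr_eq0;
  by rewrite mulf_neq0 // neq0Ci.
Qed.

Let flips_g1 : U true 0 1 1 -> U true 0 1 (-1) -> g1.
Proof. by move=> h /(gg_flip h); rewrite mul1r. Qed.

(** If A is the line of slope t, then A A gives the slope t^2 of E, and E E in E forces
t^6 = -1. A nonzero B would bring in a^6, and a nonzero D would make B nonzero, so both
vanish. The six possible t give the nodes K21 to K26. *)
Lemma case_A_line t : line false 1 t -> t != 0 -> ~ g1 -> exists x, matches x.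
Proof.
move=> lA t0 ng; have [hA oA] := lA.
have hE : E 1 (t * t) by have := AA hA hA; rewrite mulr1.
have tt0 : t * t != 0 by rewrite mulf_neq0.
have lE : line false 2%:R (t ^+ 2).
  have [n|[t' [[h' o'] _ _]]|f] := unflipped_line EJ.
  - by case: (not_nil1 n hE).
  - by split => // v w /o' ->; rewrite expr2 (o' _ _ hE) mul1r.
  - by case: ng; apply: full_g1 f.
have t6 : t ^+ 6 = -1.
  have [_ oE] := lE; have := oE _ _ (EE hE hE); rewrite mulr1 => ->.
  by ring.
have nB : vanishes true 1.
  have pm (b : C) : b * b = 1 -> B 1 b -> g1.
    move=> bb hB; have h := AB hA hB.
    have tb6 : (t * b) ^+ 6 = -1 by rewrite exprMn t6 (exprM b 2 3) expr2 bb expr1n mulr1.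
    have N11 : (-1 : C) != 1 by rewrite eq_sym -addr_eq0 -mulr2n pnatr_eq0.
    have [] := pairG h; last exact: flips_g1.
    - rewrite mulr1 eq_sym; apply: contraNneq N11 => e; move: tb6.
      by rewrite e expr1n => /eqP; rewrite eq_sym.
    - rewrite mulr1 addrC addr_eq0; apply: contraNneq N11 => e; move: tb6.
      by rewrite e (exprM _ 2 3) sqrrN !expr1n => /eqP; rewrite eq_sym.
  have [//|[] []//|[] [[hB _] _]|f] := flipped_line 1.
  - by case: ng; apply: pm hB; rewrite mulr1.
  - by case: ng; apply: pm hB; rewrite mulrNN mulr1.
  - by case: ng; apply: full_g1 f.
have nD : vanishes true 2%:R.
  have [//|[] []//|[] [[hD _] _]|f] := flipped_line 2%:R.
  - by have := AD hA hD; rewrite mul1r => /(not_nil1 nB).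
  - by have := AD hA hD; rewrite mul1r => /(not_nil1 nB).
  - by case: ng; apply: full_g1 f.
have nG := GAB (line_nonnil lA) nB.
have nH := HAD (line_nonnil lA) nD.
have hF : U false 3%:R 1 (t ^+ 3).
  by have := AE hA hE; rewrite mulr1 -expr2 -exprS.
have lF : line false 3%:R (t ^+ 3).
  have [n|[_ _ l]|[_ _ l]|[h h']] := spansF false.
  - by case: (not_nil1 n hF).
  - by have [_ /(_ _ _ hF)] := l; rewrite mul1r => ->.
  - by have [_ /(_ _ _ hF)] := l; rewrite mul1r => ->.
  - by case: ng; have := g45 h h'; rewrite mulrN i2 opprK.
have [m mt] := root6 t6; move: lA lE lF; rewrite {}mt -!exprM => lA lE lF m_in.
have red k : zeta ^+ k = zeta ^+ (k %% 12).
  by rewrite {1}(divn_eq k 12) exprD mulnC exprM (exprM zeta 6 2) zeta6 sqrrN !expr1n mul1r.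
move: m_in lE lF; rewrite !inE !(red (m * _)%N) => m_in.
case/or4P: m_in lA => [||| /or3P[]] /eqP -> lA /= lE lF.
- by_node K21.
- by_node K22.
- by_node K23.
- by_node K26.
- by_node K25.
- by_node K24.
Qed.

(** A full A fills E and the unflipped block k = 3; one vector of B is then enough to fill
everything. *)
Lemma case_A_full : full false 1 -> exists x, matches x.
Proof.
move=> fA; have [a1 a2] := fA; have g := full_g1 fA.
have fE : full false 2%:R.
  by split; [have := AA a1 a1|have := AA a2 a2]; rewrite !(mulr1, mulr0).
have [f f'] : U false 3%:R 1 'i /\ U false 3%:R 1 (- 'i).
  apply: (pairF10 (oner_neq0 _)).
  by have [e1 _] := fE; have := AE a1 e1; rewrite mulr1 mulr0.
have nonB v w : B v w -> ~ (v = 0 /\ w = 0) -> U true 0 1 1 /\ U true 0 1 (-1).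
  move=> hB n; have [v0|v0] := eqVneq v 0.
    have w0 : w != 0 by apply/eqP => w0; apply: n.
    apply: (pairG (v := 0) (w := w)); rewrite ?add0r // 1?eq_sym //.
    by have := AB a2 hB; rewrite mul0r mul1r.
  apply: (pairG (v := v) (w := 0)); rewrite ?addr0 //.
  by have := AB a1 hB; rewrite mul0r mul1r.
have [nB|[v [w [hB n]]]] : vanishes true 1 \/ nonnil true 1.
- by have [n|[t l]|l|f0] := trichotomy true 1; [left|right; apply: line_nonnil l|
    right; apply: line01_nonnil l|right; apply: full_nonnil f0].
- have nD : vanishes true 2%:R.
    move=> v w hD; have := AD a1 hD; have := AD a2 hD.
    by rewrite !mul0r !mul1r => /nB[_ ->] /nB[->].
  have nG := GAB (full_nonnil fA) nB; have nH := HAD (full_nonnil fA) nD.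
  by_node K2.
- have [p p'] := nonB _ _ hB n.
  have fB : full true 1.
    by split; [have := g2A p a1|have := g2A p a2]; rewrite mul1r.
  have [e1 e2] := fE; have fD : full true 2%:R.
    by split; [have := g2E p e1|have := g2E p e2]; rewrite mul1r.
  have h := g2_mul p f; have h' := g2_mul p f'; rewrite !mul1r in h h'.
  by_node KD6.
Qed.

(** Products of B with B fill E and those of B with D fall into A, which is zero. *)
Lemma case_B_full : vanishes false 1 -> full true 1 -> exists x, matches x.
Proof.
move=> nA fB; have g := full_g1 fB; have [b1 b2] := fB.
have fE : full false 2%:R.
  by split; [have := BB b2 b1|have := BB b1 b2]; rewrite !(mulr1, mulr0).
have nD : vanishes true 2%:R.
  move=> v w hD; have := BD b1 hD; have := BD b2 hD.
  by rewrite !mul0r !mul1r => /nA[_ ->] /nA[->].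
have nG := GBA (full_nonnil fB) nA; have nF := FBD (full_nonnil fB) nD.
have [h h'] : U true 3%:R 1 'i /\ U true 3%:R 1 (- 'i).
  apply: (pairF10 (oner_neq0 _)).
  by have [e1 _] := fE; have := BE3 b1 e1; rewrite mulr1 mulr0.
by_node K3.
Qed.

Lemma case_B_line0 : vanishes false 1 -> line true 1 0 -> g1 -> exists x, matches x.
Proof.
move=> nA lB g; have [hB oB] := lB.
have nE : vanishes false 2%:R.
  have [//|[t [_ _ ng]]|f] := unflipped_line EJ; first by case: ng.
  have := oB _ _ (BE hB (fullE 1 1 f)); rewrite !(mulr0, mul0r, mulr1) => /eqP.
  by rewrite oner_eq0.
have nG := GBA (line_nonnil lB) nA; have nH := HBE (line_nonnil lB) nE.
have [nD|[[[h _] _]|[lD _]]|[[_ ng]|[_ ng]]|[h _]] := flipped_line 2%:R.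
- have nF := FBD (line_nonnil lB) nD.
  by_node J1.
- by have := BD hB h; rewrite mulr1 => /(not_nil1 nA).
- have [hD _] := lD; have [f f'] : U false 3%:R 1 'i /\ U false 3%:R 1 (- 'i).
    by apply: (pairF10 (oner_neq0 _)); have := BD3 hB hD; rewrite mulr1 mulr0 oppr0.
  by_node K01.
- by case: ng.
- by case: ng.
- by have := BD hB h; rewrite mulr1 => /(not_nil1 nA).
Qed.

Lemma case_B_line01 : vanishes false 1 -> line01 true 1 -> g1 -> exists x, matches x.
Proof.
move=> nA lB g; have [hB oB] := lB.
have no1 w : ~ A w 1 by move=> /nA[_ /eqP]; rewrite oner_eq0.
have nE : vanishes false 2%:R.
  have [//|[t [_ _ ng]]|f] := unflipped_line EJ; first by case: ng.
  have := oB _ _ (BE hB (fullE 1 1 f)); rewrite !(mulr0, mul0r, mulr1) => /eqP.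
  by rewrite oner_eq0.
have nG := GBA (line01_nonnil lB) nA; have nH := HBE (line01_nonnil lB) nE.
have [nD|[[lD _]|[[h _] _]]|[[_ ng]|[_ ng]]|[_ h]] := flipped_line 2%:R.
- have nF := FBD (line01_nonnil lB) nD.
  by_node J5.
- have [hD _] := lD; have [f f'] : U false 3%:R 1 'i /\ U false 3%:R 1 (- 'i).
    apply: (@pairF01 _ (-1)); first by rewrite oppr_eq0 oner_eq0.
    by have := BD3 hB hD; rewrite !mulr1 mulr0.
  by_node K02.
- by have := BD hB h; rewrite mulr1 => /no1.
- by case: ng.
- by case: ng.
- by have := BD hB h; rewrite mulr1 => /no1.
Qed.

(** B B in E gives a line of slope 1 there, and E E in E would then contain (1, -1). *)
Lemma no_B_line b : b * b = 1 -> line true 1 b -> ~ g1 -> False.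
Proof.
move=> bb [hB oB] ng; have hE := BB hB hB; rewrite mulr1 mul1r in hE.
have b0 : b != 0 by apply: contra_eq_neq bb => ->; rewrite mul0r eq_sym oner_eq0.
have [n|[t [[h o] _ _]]|f] := unflipped_line EJ.
- by have [/eqP] := n _ _ hE; rewrite (negPf b0).
- have t1 : t = 1 by apply: (mulfI b0); rewrite -(o _ _ hE) mulr1.
  rewrite t1 in h o; have := o _ _ (EE h h); rewrite !mulr1 => /char2/eqP.
  by rewrite oner_eq0.
- by apply: ng; apply: full_g1 f.
Qed.

Lemma case_D_full : vanishes false 1 -> vanishes true 1 -> full true 2%:R -> exists x, matches x.
Proof.
move=> nA nB fD; have g := full_g1 fD; have [d1 d2] := fD.
have fE : full false 2%:R.
  split; first by have := DD d1 d2; rewrite !(mulr1, mulr0) oppr0.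
  by have := UZ (-1) (DD d2 d1); rewrite !(mulr1, mulr0) mulrNN mulr1.
have nF := FDB (full_nonnil fD) nB; have nH := HDA (full_nonnil fD) nA.
have [h h'] : U true 0 1 1 /\ U true 0 1 (-1).
  apply: (pairG (v := 1) (w := 0)); rewrite ?addr0 ?oner_neq0 //.
  by have [e1 _] := fE; have := ED0 e1 d1; rewrite mulr1 mulr0.
by_node K4.
Qed.

Lemma case_D_line0 : vanishes false 1 -> vanishes true 1 -> line true 2%:R 0 -> g1 -> exists x, matches x.
Proof.
move=> nA nB lD g; have [hD oD] := lD.
have nE : vanishes false 2%:R.
  have [//|[t [_ _ ng]]|f] := unflipped_line EJ; first by case: ng.
  have := oD _ _ (ED (fullE 1 1 f) hD); rewrite !(mulr0, mul0r, mulr1) => /eqP.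
  by rewrite oppr_eq0 oner_eq0.
have nF := FDB (line_nonnil lD) nB; have nH := HDA (line_nonnil lD) nA.
have nG := GDE (line_nonnil lD) nE.
by_node J2.
Qed.

Lemma case_D_line01 : vanishes false 1 -> vanishes true 1 -> line01 true 2%:R -> g1 -> exists x, matches x.
Proof.
move=> nA nB lD g; have [hD oD] := lD.
have nE : vanishes false 2%:R.
  have [//|[t [_ _ ng]]|f] := unflipped_line EJ; first by case: ng.
  have := oD _ _ (ED (fullE 1 1 f) hD); rewrite !(mulr0, mul0r, mulr1) => /eqP.
  by rewrite oner_eq0.
have nF := FDB (line01_nonnil lD) nB; have nH := HDA (line01_nonnil lD) nA.
have nG := GDE (line01_nonnil lD) nE.
by_node J4.
Qed.

(** D D in E gives the line of slope -1 there, and E D in [U true 0] gives (1, -d). *)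
Lemma case_D_line d : vanishes false 1 -> vanishes true 1 -> line true 2%:R d -> d = 1 \/ d = -1 ->
  ~ g1 -> exists x, matches x.
Proof.
move=> nA nB lD d1 ng; have [hD oD] := lD.
have d0 : d != 0 by case: d1 => ->; rewrite ?oppr_eq0 oner_neq0.
have hE := DD hD hD; rewrite mulr1 mul1r in hE.
have lE : line false 2%:R (-1).
  have [n|[t [l _ _]]|f] := unflipped_line EJ.
  - by have [/eqP] := n _ _ hE; rewrite (negPf d0).
  - have [_ o] := l; have <- : t = -1 by apply: (mulfI d0); rewrite -(o _ _ hE) mulrN1.
    by [].
  - by case: ng; apply: full_g1 f.
have nF := FDB (line_nonnil lD) nB; have nH := HDA (line_nonnil lD) nA.
have hG : U true 0 1 (- d) by have [e1 _] := lE; have := ED0 e1 hD; rewrite mulr1 mulN1r.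
have lG : line true 0 (- d).
  have [n|[_ _ l]|[_ _ l]|[h h']] := spansG.
  - by case: (not_nil1 n hG).
  - by have [_ /(_ _ _ hG)] := l; rewrite mul1r => ->.
  - by have [_ /(_ _ _ hG)] := l; rewrite mul1r => ->.
  - by case: ng; apply: flips_g1.
case: d1 => e; rewrite e ?opprK in lD lG; [by_node K41 | by_node K42].
Qed.

(** E E in E, with the exchange, gives t^3 = -1. *)
Lemma case_E_line t : vanishes false 1 -> vanishes true 1 -> vanishes true 2%:R -> line false 2%:R t ->
  ~ g1 -> exists x, matches x.
Proof.
move=> nA nB nD lE ng; have [hE oE] := lE.
have t3 : t ^+ 3 = -1.
  by have := oE _ _ (EE hE hE); rewrite mulr1 => ->; ring.
have nG := GED (line_nonnil lE) nD; have nF := FEA (line_nonnil lE) nA.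
have nH := HEB (line_nonnil lE) nB.
by case: (root3 t3) => e; rewrite e in lE; [by_node L1 | by_node L3 | by_node L5].
Qed.

Lemma case_E_full : vanishes false 1 -> vanishes true 1 -> vanishes true 2%:R -> full false 2%:R ->
  exists x, matches x.
Proof.
move=> nA nB nD fE; have g := full_g1 fE.
have nG := GED (full_nonnil fE) nD; have nF := FEA (full_nonnil fE) nA.
have nH := HEB (full_nonnil fE) nB.
by_node K1.
Qed.

(** What remains is a choice of vectors (1, c) in the four blocks k = 0 and k = 3 that is
closed under multiplication, where a^6 acts by c |-> - c. *)
Lemma case_grouplike : vanishes false 1 -> vanishes true 1 -> vanishes true 2%:R -> vanishes false 2%:R ->
  exists x, matches x.
Proof.
move=> nA nB nD nE; have [g|ng] := EM g1.
  have [nG|[h n _]|[n h _]|[h h']] := spansG.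
  - have [nF|[f n _]|[n f _]|[f f']] := spansF false.
    + have [nH|[k n _]|[n k _]|[k k']] := spansF true.
      * by_node I0.
      * by case: n; apply: Ug1.
      * by case: n; rewrite -['i]opprK; apply: Ug1.
      * by_node J3.
    + by case: n; apply: Ug1.
    + by case: n; rewrite -['i]opprK; apply: Ug1.
    + have nH : vanishes true 3%:R.
        by apply: F_nil => c c0 k; have := g46 f k; apply: not_nil1.
      by_node J20.
  - by case: n; apply: Ug1.
  - by case: n; have := Ug1 g h; rewrite opprK.
  - have [nF|[f n _]|[n f _]|[f f']] := spansF false.
    + have nH : vanishes true 3%:R.
        by apply: F_nil => c c0 k; have := g26 h k; apply: not_nil1.
      by_node J0.
    + by case: n; apply: Ug1.
    + by case: n; rewrite -['i]opprK; apply: Ug1.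
    + have k := g2_mul h f; have k' := g2_mul h f'; rewrite !mul1r in k k'.
      by_node K0.
have nH : vanishes true 3%:R.
  have [//|[k _ _]|[_ k _]|[k _]] := spansF true; case: ng; have := g66 k k;
  by rewrite ?mulrNN i2.
have noF c : vanishes false 3%:R \/ ~ U true 0 1 c.
  have [g|n] := EM (U true 0 1 c); [left|by right].
  by apply: F_nil => c' c0 f; have := g2_mul g f; apply: not_nil1.
have [nG|[h _ lG]|[_ h lG]|[h h']] := spansG; last by case: ng; apply: flips_g1.
- have [nF|[_ _ lF]|[_ _ lF]|[f f']] := spansF false.
  + by_node CC.
  + by_node I4.
  + by_node I3.
  + by case: ng; have := g45 f f'; rewrite mulrN i2 opprK.
- by have [nF|//] := noF 1; by_node I2.
- by have [nF|//] := noF (-1); by_node I1.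
Qed.

(** The first nonzero block in the order A, B, D, E decides most of the family. *)
Theorem classification : exists x, matches x.
Proof.
have [nA|[t [l t0 ng]]|f] := unflipped_line AJ; last exact: case_A_full.
  have [nB|[[l g]|[l g]]|[[l ng]|[l ng]]|f] := flipped_line 1.
  - have [nD|[[l g]|[l g]]|[[l ng]|[l ng]]|f] := flipped_line 2%:R.
    + have [nE|[t [l t0 ng]]|f] := unflipped_line EJ.
      * exact: case_grouplike.
      * exact: case_E_line l ng.
      * exact: case_E_full.
    + exact: case_D_line0.
    + exact: case_D_line01.
    + by apply: (case_D_line nA nB l) => //; left.
    + by apply: (case_D_line nA nB l) => //; right.
    + exact: case_D_full.
  - exact: case_B_line0.
  - exact: case_B_line01.
  - by case: (no_B_line (mulr1 1) l ng).
  - by case: (@no_B_line (-1) _ l ng); rewrite mulrNN mulr1.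
  - exact: case_B_full.
exact: case_A_line l t0 ng.
Qed.

End Classification.

(** * The family of a coideal subalgebra *)

Section AbstractProduct.
Variables (F : fieldType) (A : falgType F).

Lemma mul_orth_pairs (x y x' y' : A) v w v' w' : x * y' = 0 -> y * x' = 0 ->
  (v *: x + w *: y) * (v' *: x' + w' *: y') = (v * v') *: (x * x') + (w * w') *: (y * y').
Proof.
move=> xy yx; rewrite mulrDl !mulrDr -!scalerAl -!scalerAr xy yx.
by rewrite !scaler0 addr0 add0r !scalerA.
Qed.

Lemma span_mul_closed (s : seq A) :
    (forall x y, x \in s -> y \in s -> x * y \in <<s>>%VS) ->
  forall x y, x \in <<s>>%VS -> y \in <<s>>%VS -> x * y \in <<s>>%VS.
Proof.
move=> closed x y /span_sum -> /span_sum ->; rewrite mulr_suml.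
apply: memv_suml => i _; rewrite mulr_sumr; apply: memv_suml => j _.
by rewrite -scalerAl -scalerAr scalerA memvZ // closed ?mem_nth.
Qed.

Lemma span_closed (V : vectType F) (f : A -> V) (a : F -> F) (U : {vspace V}) (s : seq A) :
    (forall x y, f (x + y) = f x + f y) -> (forall c x, f (c *: x) = a c *: f x) ->
    (forall x, x \in s -> f x \in U) ->
  forall x, x \in <<s>>%VS -> f x \in U.
Proof.
move=> fD fZ fs x /span_sum ->.
have f0 : f 0 = 0 by apply: (addrI (f 0)); rewrite -fD !addr0.
rewrite (big_morph f fD f0); apply: memv_suml => i _.
by rewrite fZ memvZ // fs // mem_nth.
Qed.

Lemma span_right_mul (s : seq A) (p : A) (f : A -> F) :
    (forall x y, f (x + y) = f x + f y) -> (forall c x, f (c *: x) = c * f x) ->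
    (forall x, x \in s -> x * p = f x *: p) ->
  forall x, x \in <<s>>%VS -> x * p = f x *: p.
Proof.
move=> fD fZ fs x /span_sum ->.
have f0 : f 0 = 0 by apply: (addrI (f 0)); rewrite -fD !addr0.
rewrite (big_morph f fD f0) mulr_suml scaler_suml; apply: eq_bigr => i _.
by rewrite -scalerAl fs ?mem_nth // fZ scalerA.
Qed.
End AbstractProduct.

Section KD6.
Variable R : realType.
Local Notation C := R[i].
Local Notation K := (KD R 6).
Local Notation KX := (KD_X R).
Local Notation KY := (KD_Y R).
Local Notation beta := (basis_elt R).
Local Notation zeta := (eps R 6).
Local Notation elt := (@homog_elt R).

Lemma eltD s k v w v' w' : elt s k (v + v') (w + w') = elt s k v w + elt s k v' w'.
Proof. exact: (@pairD_abs _ K). Qed.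

Lemma eltZ s k a v w : elt s k (a * v) (a * w) = a *: elt s k v w.
Proof. exact: (@pairZ_abs _ K). Qed.

Lemma eltM s k t l v w v' w' : elt s k v w * elt t l v' w' =
  elt (s (+) t) ((if t then - k else k) + l) (v * v') (w * w').
Proof.
rewrite /homog_elt -KXM -KYM.
by apply: (@mul_orth_pairs _ K); [exact: KXY0|exact: KYX0].
Qed.

Lemma eltJ s k v w : star (elt s k v w) = elt s (if s then k else - k) v^* w^*.
Proof. by rewrite /homog_elt starD !starZ KXJ KYJ. Qed.

Let lr1_abs (V : lmodType C) (x y z : V) :
  x + 2^-1 *: (y + y) + ('i / 2) *: (z - z) = 1 *: x + 1 *: y.
Proof.
rewrite subrr scaler0 addr0 !scale1r -mulr2n -(scaler_nat 2 y) scalerA mulVf ?scale1r //.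
by rewrite pnatr_eq0.
Qed.

Lemma elt1 : elt false 0 1 1 = 1.
Proof.
rewrite -(lr1 R) lr_KXY oppr0; apply: esym; exact: (@lr1_abs K).
Qed.

Definition inU (I : {vspace K}) s k v w : Prop := elt s k v w \in I.

(** The hypotheses of the classification are the relations of the twisted basis. *)
Lemma coideal_matches (I : {vspace K}) : coideal_subalgebra I ->
  exists x, matches (inU I) zeta x.
Proof.
move=> [I1 IM IJ IDelta]; apply: (@classification C (inU I)).
- move=> s k; suff -> : inU I s k 0 0 = (0 \in I) by apply: mem0v.
  by rewrite /inU -[X in elt s k X _](mul0r 0) -[X in elt s k _ X](mul0r 0) eltZ scale0r.
- move=> s k v w v' w' h h'.
  rewrite /inU.
  rewrite (eltD s k v w v' w').
  exact: (memvD h h').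
- by move=> s k a v w h; rewrite /inU eltZ; apply: memvZ.
- by rewrite /inU elt1.
- by move=> s k v w; apply: coideal_swap.
- by move=> s k v w h; rewrite /inU elt_shift opprK.
- by move=> s k t l v w v' w' h h'; rewrite /inU -(eltM s k t l v w v' w'); exact: IM h h'.
- by move=> s k v w h; rewrite /inU -(eltJ s k v w); exact: IJ h.
- exact: zeta4.
- exact: zeta3.
Qed.

End KD6.

(** * The coideal subalgebra of a node *)

(** ((s, k), (v, w)) codes b^s (v X_k + w Y_k). *)
Definition hom : Type := ((bool * nat) * (cyc * cyc))%type.
Definition Hom s k v w : hom := ((s, k), (v, w)).
Definition hs (h : hom) := h.1.1.
Definition hk (h : hom) := h.1.2.
Definition hv (h : hom) := h.2.1.
Definition hw (h : hom) := h.2.2.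

Definition cyc0 := cyc_int 0.
Definition cyc1 := cyc_int 1.
Definition cycN (c : cyc) := cyc_mul (cyc_int (-1)) c.

Definition vcode (x : vec) : cyc * cyc :=
  match x with VX => (cyc1, cyc0) | VY => (cyc0, cyc1) | VZ m => (cyc1, cyc_pow m) end.

Definition hform (h : hom) : form code :=
  [:: (hv h, (false, (hs h, hk h))); (hw h, (true, (hs h, hk h)))].

(** The element with exchanged coordinates in the block of -k, written with 6 - k. *)
Definition hflip (h : hom) : hom :=
  if hk h == 0%N then Hom (hs h) 0 (hw h) (hv h)
  else Hom (hs h) (6 - hk h) (hw h) (cycN (hv h)).

Definition vhom s k (x : vec) : hom := let p := vcode x in Hom s k p.1 p.2.

(** The blocks k = 1 and k = 2 also determine k = 5 and k = 4, by exchange. *)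
Definition node_homs (x : node) : seq hom :=
  let l := node_shapes x in
  let one s k i := [seq vhom s k v | v <- nth [::] l i] in
  let two s k i := flatten [seq [:: vhom s k v; hflip (vhom s k v)] | v <- nth [::] l i] in
  one false 0%N 0%N ++ one true 0%N 1%N ++ one false 3 2 ++ one true 3 3
  ++ two false 1%N 4 ++ two true 1%N 5 ++ two false 2 6 ++ two true 2 7.

Definition node_gens (x : node) : seq (form code) := [seq hform h | h <- node_homs x].

(** The order of this list is the one of [node_idx], which is used as a comparison of nodes
that evaluates. *)
Definition nodes : seq node :=
  [:: CC; I0; I1; I2; I3; I4; L1; L3; L5; J0; J1; J2; J3; J4; J5; J20;
      K1; K21; K22; K23; K24; K25; K26; K41; K42; K0; K01; K02; K2; K3; K4; KD6].
Definition node_idx (x : node) : nat :=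
  match x with
  | CC => 0 | I0 => 1 | I1 => 2 | I2 => 3 | I3 => 4 | I4 => 5 | L1 => 6 | L3 => 7 | L5 => 8
  | J0 => 9 | J1 => 10 | J2 => 11 | J3 => 12 | J4 => 13 | J5 => 14 | J20 => 15
  | K1 => 16 | K21 => 17 | K22 => 18 | K23 => 19 | K24 => 20 | K25 => 21 | K26 => 22
  | K41 => 23 | K42 => 24 | K0 => 25 | K01 => 26 | K02 => 27 | K2 => 28 | K3 => 29 | K4 => 30
  | KD6 => 31
  end.

Lemma node_idxK : cancel node_idx (nth CC nodes). Proof. by case. Qed.
Lemma node_idx_inj : injective node_idx. Proof. exact: can_inj node_idxK. Qed.
Lemma mem_nodes x : x \in nodes.
Proof. by rewrite -(node_idxK x) mem_nth //; case: x. Qed.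

(** Twice the inner product, as the basis elements have squared norm 1/2. *)
Definition ipd (l m : form code) : cyc :=
  foldr (fun p c => foldr (fun q c' =>
    if p.2 == q.2 then cyc_add (cyc_mul (cyc_conj p.1) q.1) c' else c') c m) (cyc_int 0) l.

(** The projection of 2 y on a vector g is (2 <g, y> / <g, g>) g, and [ipd g g] is 1 or 2, the
value 1 occurring for (1, 0) and (0, 1): hence the weights -2 and -1 in front of
[ipd g y]. *)
Definition weighted (gens : seq (form code)) : seq (cyc * form code) :=
  [seq (if cyc_eq (ipd g g) cyc1 then cyc_int (-2) else cyc_int (-1), g) | g <- gens].

(** Twice the component of [y] orthogonal to the family. *)
Definition residual (wgens : seq (cyc * form code)) (y : form code) : form code :=
  collect (scalef (cyc_int 2) y
    ++ flatten [seq scalef (cyc_mul wg.1 (ipd wg.2 y)) wg.2 | wg <- wgens]).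

Definition memf wgens y := all (fun p => cyc_eq0 p.1) (residual wgens y).
(** A vector orthogonal to the family but not to [y] shows that [y] is not in its span. *)
Definition nmemf (wgens : seq (cyc * form code)) y := let r := residual wgens y in
  all (fun wg => cyc_eq0 (ipd r wg.2)) wgens && cyc_neq0 (ipd r y).

Definition onef : form code := [:: (cyc1, (false, (false, 0%N))); (cyc1, (true, (false, 0%N)))].

Definition algebra_check (x : node) : bool :=
  let gens := node_gens x in let wgens := weighted gens in
  [&& all (fun g => all (fun p => (p.2.2.2 < 6)%N) g) gens, memf wgens onef,
      all (fun g => all (fun h => memf wgens (mulx g h)) gens) gens,
      all (fun g => memf wgens (starx g)) gens,
      all (fun h => (hk h < 6)%N && memf wgens (hform (hflip h))) (node_homs x) &
      size gens == node_dim x].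

Lemma algebra_checks : all algebra_check nodes.
Proof. by vm_compute. Qed.

Fixpoint orth (l : seq (form code)) : bool :=
  if l is g :: l' then
    [&& cyc_neq0 (ipd g g), all (fun h => cyc_eq0 (ipd g h) && cyc_eq0 (ipd h g)) l' & orth l']
  else true.
Lemma orth_checks : all (fun x => orth (node_gens x)) nodes.
Proof. by vm_compute. Qed.

Definition up_step (l : seq nat) : seq nat :=
  undup (l ++ flatten [seq [seq node_idx y | y <- upper (nth CC nodes i)] | i <- l]).
(** Upward paths of the diagram have at most four edges. *)
Definition above (x : node) : seq nat := iter 4 up_step [:: node_idx x].
Definition leb (x y : node) : bool := node_idx y \in above x.

(** Without a path from [x] to [y], dimensions exclude an inclusion unless
[node_dim x < node_dim y]. *)
Definition order_pair (x y : node) (up : bool) gx wy : bool :=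
  if up then all (memf wy) gx
  else if (node_dim x < node_dim y)%N then has (nmemf wy) gx else true.

Definition order_check : bool :=
  let ws := [seq weighted (node_gens y) | y <- nodes] in
  all (fun x => let ax := above x in let gx := node_gens x in
    all (fun y => order_pair x y (node_idx y \in ax) gx (nth [::] ws (node_idx y))) nodes)
    nodes.
Lemma order_checks : order_check.
Proof. by vm_compute. Qed.

Definition covers_check : bool :=
  let table := [seq above x | x <- nodes] in
  let le i j := j \in nth [::] table i in
  all (fun i => let ui := [seq node_idx y | y <- upper (nth CC nodes i)] in
    all (fun j => (j \in ui) ==
     [&& le i j, j != i & all (fun k => le i k ==> le k j ==> (k == i) || (k == j)) (iota 0 32)])
      (iota 0 32)) (iota 0 32).
Lemma covers_checks : covers_check.
Proof. by vm_compute. Qed.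

Section KD6.
Variable R : realType.
Local Notation C := R[i].
Local Notation K := (KD R 6).
Local Notation KX := (KD_X R).
Local Notation KY := (KD_Y R).
Local Notation beta := (basis_elt R).
Local Notation zeta := (eps R 6).
Local Notation cval := (cyc_val zeta).
Local Notation ev := (evf zeta beta).
Local Notation elt := (@homog_elt R).
Notation wf := (all (fun p : cyc * code => wfc p.2)).

Lemma ipDl (x y z : K) : ip (x + y) z = ip x z + ip y z.
Proof.
rewrite !ipE -big_split; apply: eq_bigr => g _ /=.
by rewrite ffunE rmorphD mulrDl.
Qed.
Lemma ipZl a (x y : K) : ip (a *: x) y = a^* * ip x y.
Proof.
rewrite !ipE mulr_sumr; apply: eq_bigr => g _ /=.
rewrite ffunE; have -> : (a *: x g)^* = a^* * (x g)^* by apply: (rmorphM (@Num.conj C)).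
by rewrite mulrA.
Qed.
Lemma ip0l (x : K) : ip 0 x = 0.
Proof. by rewrite ipE big1 // => g _; rewrite ffunE conjC0 mul0r. Qed.

Lemma ev_ipd l m : wf l -> wf m -> ip (ev l) (ev m) = 2^-1 * cval (ipd l m).
Proof.
move=> wl wm; elim: l wl => [_|p l IH]; first by rewrite evf_nil ip0l [ipd _ _]/(cyc_int 0) cval_int mulr0.
case/andP=> /wfc_codes pc /IH{}IH; rewrite evf_cons ipDl ipZl IH [ipd (p :: l) m]/=.
rewrite -/(ipd l m); move: (ipd l m) => c {IH l}.
elim: m wm => [_|q m IH] /=; first by rewrite evf_nil ip0 mulr0 add0r.
case/andP=> /wfc_codes qc /IH{}IH; rewrite evf_cons ipD ipZ beta_ip // mulrDr.
rewrite -addrA IH; case: eqP => [->|_]; last by rewrite mul0r !mulr0 add0r.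
by rewrite cvalD (cvalM (zeta4 R)) (cvalJ (zeta4 R) (zetaJ R)) mul1r; ring.
Qed.

Lemma wf_cat l m : wf (l ++ m) = wf l && wf m. Proof. exact: all_cat. Qed.
Lemma wf_scale c l : wf l -> wf (scalef c l).
Proof. by rewrite /scalef all_map. Qed.
Lemma wf_collect l : wf l -> wf (collect l).
Proof.
have wf_insert p m : wfc p.2 -> wf m -> wf (insertf p m).
  move=> pw; elim: m => [|q m IH] /=; first by rewrite pw.
  by case/andP=> qw mw; case: eqP => _ /=; rewrite qw ?IH.
by elim: l => //= p l IH /andP[pw /IH]; apply: wf_insert.
Qed.

Section Family.
Variable gens : seq (form code).
Hypothesis wgens : all (fun g => wf g) gens.
Let span := <<[seq ev g | g <- gens]>>%VS.

Lemma residualE y : exists2 z, z \in span & ev (residual (weighted gens) y) = 2 *: ev y - z.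
Proof.
pose a g := if cyc_eq (ipd g g) cyc1 then cyc_int 2 else cyc_int 1.
exists (\sum_(g <- gens) (cval (a g) * cval (ipd g y)) *: ev g).
  rewrite big_seq; apply: memv_suml => g gin; apply: memvZ; apply: memv_span.
  exact: map_f.
rewrite evf_collect evf_cat (evfZ (zeta4 R)) cval_int; congr (_ + _).
rewrite evf_flatten !big_map -sumrN; apply: eq_bigr => g _ /=.
rewrite (evfZ (zeta4 R)) (cvalM (zeta4 R)) -scaleNr -mulNr; congr (_ * _ *: _).
by rewrite /a; case: ifP => _; rewrite !cval_int.
Qed.

(** The residual differs from 2 y by an element of the span. *)
Lemma memfP y : memf (weighted gens) y -> ev y \in span.
Proof.
have [z zin e] := residualE y => m0.
have e0 : ev (residual (weighted gens) y) = 0.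
  move: m0; rewrite /memf; elim: (residual _ _) => [|p l IH] /=; first by rewrite evf_nil.
  by case/andP=> /(cyc_eq0P zeta) c0 /IH l0; rewrite evf_cons c0 l0 scale0r addr0.
have -> : ev y = 2^-1 *: z.
  apply: (scalerI (a := 2)); first by rewrite pnatr_eq0.
  rewrite scalerA mulfV ?pnatr_eq0 // scale1r; apply/eqP; rewrite -subr_eq0 -e e0 eqxx //.
exact: memvZ.
Qed.

Lemma nmemfP y : wf y -> nmemf (weighted gens) y -> ev y \notin span.
Proof.
move=> wy /andP[r0 ry]; set r := residual _ _ in r0 ry.
have wr : wf r.
  apply: wf_collect; rewrite wf_cat wf_scale //= /weighted.
  elim: gens wgens => //= g l IH /andP[wg /IH wl]; by rewrite wf_cat wf_scale.
have orth0 z : z \in [seq ev g | g <- gens] -> ip (ev r) z = 0.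
  case/mapP=> g gin ->; rewrite (ev_ipd wr (allP wgens _ gin)).
  have : cyc_eq0 (ipd r g) by move: r0; rewrite /weighted all_map => /allP; apply.
  by move/(cyc_eq0P zeta) => ->; rewrite mulr0.
apply/negP => /(ip_span orth0) h0; move: ry; apply/negP.
move/eqP: h0; rewrite ev_ipd // mulf_eq0 invr_eq0 pnatr_eq0 /=.
by apply: contraL => /(cyc_neq0P (zeta4 R)).
Qed.

End Family.

Lemma orth_family l : all (fun g => wf g) l -> orth l ->
  orthogonal_family [seq ev g | g <- l].
Proof.
elim: l => [|g l IH] //= /andP[wg wl] /and3P[gg /allP gl /(IH wl) [nz ort]].
have two0 : (2^-1 : C) != 0 by rewrite invr_eq0 pnatr_eq0.
have hg j : (j < size l)%N -> ip (ev g) [seq ev g | g <- l]`_j = 0 /\ ip [seq ev g | g <- l]`_j (ev g) = 0.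
  move=> jl; rewrite (nth_map [::]) //; have hin := mem_nth [::] jl.
  have /andP[/(cyc_eq0P zeta) e1 /(cyc_eq0P zeta) e2] := gl _ hin.
  by rewrite !ev_ipd ?(allP wl _ hin) // e1 e2 mulr0.
split; [case=> [_|i il] | case=> [|i] [|j] //= il jl ij] => /=.
- by rewrite ev_ipd // mulf_neq0 // (cyc_neq0P (zeta4 R)).
- exact: nz.
- by rewrite ltnS size_map in jl; case: (hg j jl).
- by rewrite ltnS size_map in il; case: (hg i il).
- exact: ort.
Qed.

Definition node_space (x : node) : {vspace K} := <<[seq ev g | g <- node_gens x]>>%VS.

Local Notation L := node_space.

Lemma ev_hform h : ev (hform h) = elt (hs h) (hk h)%:R (cval (hv h)) (cval (hw h)).
Proof. by rewrite evf2. Qed.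

Let nodeP x : algebra_check x. Proof. exact: (allP algebra_checks _ (mem_nodes x)). Qed.

Lemma wf_gens x : all (fun g => wf g) (node_gens x).
Proof. by have /andP[] := nodeP x. Qed.

Lemma memL x y : memf (weighted (node_gens x)) y -> ev y \in L x.
Proof. exact: memfP. Qed.

Lemma gen_mem x g : g \in node_gens x -> ev g \in L x.
Proof. by move=> gx; apply/memv_span/map_f. Qed.

Lemma L_one x : 1 \in L x.
Proof.
have /and3P[_ /memL h _] := nodeP x.
have c1 : cval cyc1 = 1 by apply: cval1.
have e : ev onef = elt false 0 (cval cyc1) (cval cyc1) by rewrite evf2.
by rewrite c1 elt1 in e; rewrite -e.
Qed.

Lemma L_mul x u v : u \in L x -> v \in L x -> u * v \in L x.
Proof.
apply: (@span_mul_closed _ K) => {u v} _ _ /mapP[g gx ->] /mapP[h hx ->].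
rewrite -ev_mulx; apply: memL; have /and4P[_ _ /allP/(_ _ gx)/allP/(_ _ hx)] := nodeP x.
by [].
Qed.

Lemma L_star x u : u \in L x -> star u \in L x.
Proof.
apply: (@span_closed _ K K (@star _ _) (@Num.conj C) (L x)).
- exact: starD.
- exact: starZ.
- move=> _ /mapP[g gx ->]; rewrite -ev_starx; apply: memL.
  by have /and5P[_ _ _ /allP/(_ _ gx)] := nodeP x.
Qed.

Lemma hflipE h : (hk h < 6)%N -> ev (hform (hflip h)) =
  elt (hs h) (- (hk h)%:R) (cval (hw h)) (cval (hv h)).
Proof.
case: h => [[s k] [v w]]; rewrite /hk /hs /hv /hw /= => k6; rewrite ev_hform /hflip /hk /hs /hv /hw /=; case: eqP => [->|/eqP k0] /=.
  by rewrite oppr0.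
have -> : (6 - k)%:R = - k%:R + 6%:R :> Z12 by rewrite natrB ?(ltnW k6) // addrC.
by rewrite elt_shift /cycN (cvalM (zeta4 R)) cval_int mulN1r opprK.
Qed.

(** By [elt_Delta], exactly the generators and their exchanged forms occur in the second
leg. *)
Lemma L_Delta x u : u \in L x -> Delta u \in tensv fullv (L x).
Proof.
apply: (@span_closed _ K (KD2 R 6) (@Delta R 6) id).
- exact: DeltaD.
- exact: DeltaZ.
- move=> _ /mapP[_ /mapP[h hx ->] ->].
  have /and5P[_ _ _ _ /andP[/allP/(_ _ hx)/andP[k6 hh] _]] := nodeP x.
  rewrite ev_hform (elt_Delta _ _ _ k6) -hflipE //.
  apply: memvD; apply: tens_mem; rewrite ?memvf //; last exact: memL.
  by rewrite -ev_hform; apply: gen_mem; apply: map_f.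
Qed.

Lemma L_coideal x : coideal_subalgebra (L x).
Proof. by split; [exact: L_one|exact: L_mul|exact: L_star|exact: L_Delta]. Qed.

Lemma L_dim x : \dim (L x) = node_dim x.
Proof.
have ort := orth_family (wf_gens x) (allP orth_checks _ (mem_nodes x)).
have /orthogonal_free := ort; rewrite /free => /eqP e; rewrite /node_space e size_map.
by have /and5P[_ _ _ _ /andP[_ /eqP]] := nodeP x.
Qed.

End KD6.

(** * Every coideal subalgebra belongs to a node *)

Section InSpan.
Variable C : numClosedFieldType.
Implicit Types l : seq (C * C).

Lemma in_span0 l : in_span l 0 0.
Proof. by elim: l => [|p l IH] //=; exists 0; rewrite !mul0r !subr0. Qed.

Lemma in_span_mem l p : p \in l -> in_span l p.1 p.2.
Proof.
elim: l => [|q l IH] //=; rewrite inE => /predU1P[->|/IH h].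
  by exists 1; rewrite !mul1r !subrr; apply: in_span0.
by exists 0; rewrite !mul0r !subr0.
Qed.
End InSpan.

Section KD6.
Variable R : realType.
Local Notation C := R[i].
Local Notation K := (KD R 6).
Local Notation zeta := (eps R 6).
Local Notation cval := (cyc_val zeta).
Local Notation beta := (basis_elt R).
Local Notation ev := (evf zeta beta).
Local Notation elt := (@homog_elt R).
Local Notation L := (node_space R).
Implicit Types I J : {vspace K}.

Lemma elt00 s k : elt s k 0 0 = 0.
Proof. by rewrite -[X in elt s k X _](mul0r 0) -[X in elt s k _ X](mul0r 0) eltZ scale0r. Qed.

Lemma elt_in_span I s k l v w :
    (forall p, p \in l -> elt s k p.1 p.2 \in I) -> in_span l v w -> elt s k v w \in I.
Proof.
elim: l v w => [|p l IH] v w lI /= => [[-> ->]|[a h]].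
  by rewrite elt00 mem0v.
have hl : elt s k (v - a * p.1) (w - a * p.2) \in I.
  by apply: IH h => q ql; apply: lI; rewrite inE ql orbT.
have hp : elt s k (a * p.1) (a * p.2) \in I.
  by rewrite eltZ; apply: memvZ; apply: lI; rewrite inE eqxx.
have := memvD hl hp; rewrite -(eltD s k (v - a * p.1) (w - a * p.2)).
by rewrite !subrK.
Qed.

Lemma left_coideal_of I : coideal_subalgebra I -> left_coideal I.
Proof. by case. Qed.

(** A coideal is the sum of its homogeneous parts, and the exchange and shift bring all of
them to 0 <= k < 4. *)
Lemma coideal_sub I J : left_coideal I -> left_coideal J ->
    (forall s (k : nat) v w, (k < 4)%N -> elt s k%:R v w \in I -> elt s k%:R v w \in J) ->
  (I <= J)%VS.
Proof.
move=> coI coJ IJ; apply/subvP => x xI; rewrite (decomp x) big_seq.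
apply: memv_suml => -[s k]; rewrite mem_places => k6; rewrite homogE.
have := coideal_elt coI s k6 xI; move: (coef _ x) (coef _ x) => v w h.
have [k4|k4] := ltnP k 4; first exact: IJ.
have e : - k%:R = (6 - k)%:R + 6%:R :> Z12.
  apply: (addIr k%:R); rewrite addNr addrAC -natrD subnK ?(ltnW k6) //.
  by rewrite six2.
have k2 : (6 - k < 4)%N by clear -k4 k6; case: k k4 k6 => [|[|[|[|[|[|]]]]]].
have := coideal_swap coI h; rewrite e elt_shift => /(IJ _ _ _ _ k2) h'.
have := coideal_swap coJ h'.
have -> : - (6 - k)%:R = k%:R + 6%:R :> Z12.
  by apply: oppr_inj; rewrite opprK opprD e -addrA -[X in _ + (_ - X)]opprK opprK subrr addr0.
by rewrite elt_shift elt_opp memvN.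
Qed.

Lemma vcodeE x : (cval (vcode x).1, cval (vcode x).2) = vval zeta x.
Proof.
have c0 : cval cyc0 = 0 by apply: cval_int.
have c1 : cval cyc1 = 1 by apply: cval1.
by case: x => [||m]; rewrite /vcode [(_, _).1]/fst [(_, _).2]/snd ?c0 ?c1 ?(cval_pow (zeta4 R)).
Qed.

Lemma ev_vhom s k x : ev (hform (vhom s k x)) = elt s k%:R (vval zeta x).1 (vval zeta x).2.
Proof. by rewrite ev_hform -vcodeE. Qed.

Definition node_places : seq (bool * nat * nat) :=
  [:: (false, 0%N, 0%N); (true, 0%N, 1%N); (false, 3, 2); (true, 3, 3);
      (false, 1%N, 4); (true, 1%N, 5); (false, 2, 6); (true, 2, 7)].

Lemma mem_node_homs x s k i v : (s, k, i) \in node_places ->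
  v \in nth [::] (node_shapes x) i -> vhom s k v \in node_homs x.
Proof.
move=> ski vx; have two : vhom s k v \in flatten [seq [:: vhom s k v; hflip (vhom s k v)] |
    v <- nth [::] (node_shapes x) i].
  by apply/flatten_mapP; exists v; rewrite ?inE ?eqxx.
have one := map_f (vhom s k) vx.
rewrite /node_homs !mem_cat; move: ski two one; rewrite !inE.
by do 7?[case/orP]; case/eqP=> -> -> -> t o; rewrite ?t ?o ?orbT.
Qed.

Lemma node_homsP x h : h \in node_homs x ->
  exists s k i v, [/\ (s, k, i) \in node_places, v \in nth [::] (node_shapes x) i &
    h = vhom s k v \/ h = hflip (vhom s k v)].
Proof.
rewrite /node_homs !mem_cat.
do 4![case/orP => [/mapP[v vx ->]|];
  first by do 4!eexists; split; [|exact: vx|by left; reflexivity]; rewrite !inE eqxx ?orbT].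
do 3?[case/orP]; case/flatten_mapP=> v vx; rewrite !inE => /orP vh;
  do 4!eexists; (split; [|exact: vx|case: vh => /eqP ->; by [left|right]]); by rewrite !inE eqxx ?orbT.
Qed.

Lemma matches_spans I x : matches (inU I) zeta x -> forall s k i, (s, k, i) \in node_places ->
  spans (inU I) s k%:R [seq vval zeta v | v <- nth [::] (node_shapes x) i].
Proof.
move=> [[h0 h1 h2 h3] [h4 h5 h6 h7]] s k i; rewrite !inE.
by do 7?[case/orP]; case/eqP=> -> -> ->.
Qed.

Lemma matches_eq I x : coideal_subalgebra I -> matches (inU I) zeta x -> I = L x.
Proof.
move=> /left_coideal_of coI /matches_spans sp.
have coL := left_coideal_of (L_coideal R x).
apply/eqP; rewrite eqEsubv; apply/andP; split.
  apply: coideal_sub => // s k v w k4 h.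
  have [i ski] : exists i, (s, k, i) \in node_places.
    by case: s k k4 {h} => [] [|[|[|[|]]]] // _;
      [exists 1%N|exists 5|exists 7|exists 3|exists 0%N|exists 4|exists 6|exists 2].
  apply: elt_in_span ((sp _ _ _ ski v w).1 h) => p /mapP[u ux ->].
  by rewrite -ev_vhom; apply/gen_mem/map_f/(mem_node_homs ski).
apply/span_subvP => _ /mapP[_ /mapP[h /node_homsP[s [k [i [v [ski vx hv]]]]] ->] ->].
have vI : elt s k%:R (vval zeta v).1 (vval zeta v).2 \in I.
  by apply/(sp _ _ _ ski)/in_span_mem/map_f.
case: hv => ->; first by rewrite ev_vhom.
have k6 : (hk (vhom s k v) < 6)%N.
  by move: ski; rewrite !inE /hk /=; do 7?[case/orP]; case/eqP=> _ -> _.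
rewrite -ev_vhom ev_hform in vI.
by rewrite (hflipE R k6); exact: (coideal_swap coI vI).
Qed.

Lemma coideal_subalgebraP I : coideal_subalgebra I <-> exists x, I = L x.
Proof.
split=> [cI|[x ->]]; last exact: L_coideal.
by have [x /(matches_eq cI)] := coideal_matches cI; exists x.
Qed.
End KD6.

(** * The Jones projections in coordinates *)

(** Twice the group element b^s a^k in the twisted basis, from [lr_KXY]. *)
Definition lamf (s : bool) (k : nat) : form code :=
  scalef (cyc_int 2) (reduce false s k)
  ++ (reduce true s k ++ reduce true s (rotn k))
  ++ scalef (cyc_pow 3) (reduce true (~~ s) k ++ oppf (reduce true (~~ s) (rotn k))).

Definition prune (l : form code) := [seq p <- l | ~~ cyc_eq0 p.1].

Definition fourier (s : bool) (f : nat -> cyc) : form code :=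
  flatten [seq scalef (f k) (lamf s k) | k <- iota 0 12].

(** 48 e_1, ..., 48 e_4, then 24 e^j_11, 24 e^j_22, 24 e^j_12 and 24 e^j_21 for j = 1..5. *)
Definition unit_table : seq (form code) :=
  let pos k := cyc1 in let neg k := cyc_pow 6 in
  let alt k := cyc_pow (6 * k) in let nalt k := cyc_pow (6 + 6 * k) in
  let chi j k := cyc_pow (j * k) in let chi' j k := cyc_pow (11 * (j * k)) in
  [seq prune (collect l) | l <-
    [:: fourier false pos ++ fourier true pos; fourier false pos ++ fourier true neg;
        fourier false alt ++ fourier true nalt; fourier false alt ++ fourier true alt]
    ++ [seq fourier false (chi' j) | j <- iota 1 5] ++ [seq fourier false (chi j) | j <- iota 1 5]
    ++ [seq fourier true (chi j) | j <- iota 1 5] ++ [seq fourier true (chi' j) | j <- iota 1 5]]%N.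

Section ProjectionForms.
Variable T : seq (form code).
Local Notation "f +++ g" := (f ++ g) (at level 50, left associativity, only parsing).
Local Open Scope nat_scope.

Definition charf i := nth [::] T i.
Definition e11f j := nth [::] T (3 + j).
Definition e22f j := nth [::] T (8 + j).
Definition e12f j := nth [::] T (13 + j).
Definition e21f j := nth [::] T (18 + j).
(** 48 times the projection (e_11 + zeta^u e_12 + zeta^v e_21 + e_22) / 2. *)
Definition rankf u v j :=
  e11f j ++ scalef (cyc_pow u) (e12f j) ++ scalef (cyc_pow v) (e21f j) ++ e22f j.
Definition doublef : form code -> form code := scalef (cyc_int 2).

Definition node_projf (x : node) : form code :=
  let e1f := charf 0 in let e2f := charf 1 in let e3f := charf 2 in let e4f := charf 3 in
  let r11f := rankf 9 3 in let r22f := rankf 3 9 in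
  let p11f := rankf 0 0 in let p22f := rankf 6 6 in
  let p1f := p11f 1 ++ p11f 3 ++ p11f 5 in let p2f := p22f 1 ++ p22f 3 ++ p22f 5 in
  let q1f := p11f 2 ++ p11f 4 in let q2f := p22f 2 ++ p22f 4 in
  let s m := rankf (12 - m) m in
  match x with
  | CC => scalef (cyc_int 48) onef
  | I0 => e1f +++ e2f +++ e3f +++ e4f +++ q1f +++ q2f
  | I1 => e1f +++ e4f +++ q1f +++ p2f
  | I2 => e1f +++ e4f +++ q1f +++ p1f
  | I3 => e1f +++ e2f +++ doublef (e11f 4) +++ doublef (e22f 4) +++ r22f 1 +++ r11f 3 +++ r22f 5
  | I4 => e1f +++ e2f +++ doublef (e11f 4) +++ doublef (e22f 4) +++ r11f 1 +++ r22f 3 +++ r11f 5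
  | L1 => e1f +++ e2f +++ e3f +++ e4f +++ r11f 1 +++ r22f 5
  | L3 => e1f +++ e2f +++ e3f +++ e4f +++ r11f 3 +++ r22f 3
  | L5 => e1f +++ e2f +++ e3f +++ e4f +++ r11f 5 +++ r22f 1
  | J0 => e1f +++ e4f +++ q1f
  | J1 => e1f +++ e3f +++ s 2 2 +++ s 4 4
  | J2 => e1f +++ e4f +++ s 4 2 +++ s 8 4
  | J3 => e1f +++ e3f +++ p22f 2 +++ p11f 4
  | J4 => e1f +++ e4f +++ s 8 2 +++ s 4 4
  | J5 => e1f +++ e3f +++ s 10 2 +++ s 8 4
  | J20 => e1f +++ e2f +++ doublef (e11f 4) +++ doublef (e22f 4)
  | K1 => e1f +++ e2f +++ e3f +++ e4f
  | K21 => e1f +++ e2f +++ r11f 1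
  | K22 => e1f +++ e2f +++ r11f 3
  | K23 => e1f +++ e2f +++ r11f 5
  | K24 => e1f +++ e2f +++ r22f 1
  | K25 => e1f +++ e2f +++ r22f 3
  | K26 => e1f +++ e2f +++ r22f 5
  | K41 => e1f +++ e4f +++ p22f 3
  | K42 => e1f +++ e4f +++ p11f 3
  | K0 => e1f +++ p11f 4
  | K01 => e1f +++ s 4 4
  | K02 => e1f +++ s 8 4
  | K2 => e1f +++ e2f
  | K3 => e1f +++ e3f
  | K4 => e1f +++ e4f
  | KD6 => e1f
  end.
End ProjectionForms.

Definition projf_table : seq (form code) :=
  let T := unit_table in [seq prune (collect (node_projf T x)) | x <- nodes].

(** The defining properties of a Jones projection, for 1/48 of the value of [P], on the
generators. *)
Definition jones_check (P : form code) (x : node) : bool :=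
  let gens := node_gens x in
  [&& all (fun p => (p.2.2.2 < 6)%N) P, memf (weighted gens) P, eqf (starx P) P,
      all (fun g => eqf (mulx g P) (scalef (counitf g) P)) gens
    & cyc_eq (counitf P) (cyc_int 48)].

(** The conditional avoids computing the norm when the difference is zero. *)
Definition distinct (v w : seq cyc) : bool :=
  has (fun q => let c := cyc_add q.1 (cycN q.2) in if cyc_eq0 c then false else cyc_neq0 c)
    (zip v w).
Definition projections_check : bool :=
  let T := projf_table in
  all (fun i => jones_check (nth [::] T i) (nth CC nodes i)) (iota 0 32)
  && pairwise distinct [seq [seq ipd [:: (cyc1, p)] P | p <- codes] | P <- T].
Lemma projections_checks : projections_check.
Proof. by vm_compute. Qed.

Section Abstract.
Variables (C : numClosedFieldType) (V : lmodType C).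
Implicit Types x y z u v w : V.

Lemma double_lam x y y' z z' :
  2 *: (x + 2^-1 *: (y + y') + ('i / 2) *: (z - z')) = 2 *: x + ((y + y') + 'i *: (z - z')).
Proof.
rewrite !scalerDr !scalerA mulfV ?pnatr_eq0 // [2 * _]mulrC divfK ?pnatr_eq0 //.
by rewrite !scale1r -!scalerDr -!addrA.
Qed.

Lemma scale_quarter n x : (2 * n%:R) *: (n%:R^-1 *: x) = if n == 0%N then 0 else 2 *: x.
Proof.
case: eqP => [->|/eqP n0]; first by rewrite mulr0 scale0r.
by rewrite scalerA mulfK // pnatr_eq0.
Qed.

Lemma half48 x : 48 *: (2^-1 *: x) = 24 *: x.
Proof. by rewrite scalerA; congr (_ *: _); field. Qed.

Lemma rank_one x y z w a b : 48 *: (2^-1 *: (x + a *: y + b *: z + w)) =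
  24 *: x + (a *: (24 *: y) + (b *: (24 *: z) + 24 *: w)).
Proof. by rewrite half48 !scalerDr !scalerA ![24 * _]mulrC !addrA. Qed.

Lemma double24 x : 48 *: x = 2 *: (24 *: x).
Proof. by rewrite scalerA -natrM. Qed.

Lemma average_sum m (x y : 'I_m -> V) :
  48 *: ((4 * 6)%:R^-1 *: \sum_k (x k + y k)) = 2 *: \sum_k x k + 2 *: \sum_k y k.
Proof.
rewrite -[48](_ : 2 * (4 * 6)%:R = _); last by rewrite -natrM.
by rewrite scale_quarter /= big_split -scalerDr.
Qed.
End Abstract.

Section KD6.
Variable R : realType.
Local Notation C := R[i].
Local Notation K := (KD R 6).
Local Notation zeta := (eps R 6).
Local Notation cval := (cyc_val zeta).
Local Notation beta := (basis_elt R).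
Local Notation ev := (evf zeta beta).

Lemma evN l : ev (oppf l) = - ev l. Proof. by apply: evfN; apply: zeta4. Qed.

Lemma lamfE s k : (k < 12)%N -> ev (lamf s k) = 2 *: lr R s k%:R.
Proof.
move=> k12; rewrite lr_KXY double_lam /lamf !evf_cat.
have r12 : (rotn k < 12)%N by rewrite ltn_mod.
have e2 : cval (cyc_int 2) = 2 by rewrite cval_int.
rewrite !(evfZ (zeta4 R)) evf_cat evN (cval_pow (zeta4 R)) zeta3 e2.
rewrite (ev_reduce R false s k12) (ev_reduce R true s k12) (ev_reduce R true s r12).
rewrite (ev_reduce R true (~~ s) k12) (ev_reduce R true (~~ s) r12) rotnE.
by [].
Qed.

Lemma fourierE s f : ev (fourier s f) = 2 *: \sum_(k < 6.*2) cval (f k) *: lr R s k%:R.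
Proof.
rewrite /fourier evf_flatten big_map -[iota 0 12]/(index_iota 0 6.*2) big_mkord.
rewrite scaler_sumr; apply: eq_bigr => k _.
by rewrite (evfZ (zeta4 R)) (lamfE s (ltn_ord k)) !scalerA mulrC.
Qed.

Lemma lam_rot k : lam C (dih_a 6 ^+ k)%g = lr R false k%:R.
Proof. by rewrite gv_rot. Qed.
Lemma lam_flip k : lam C (dih_b 6 * dih_a 6 ^+ k)%g = lr R true k%:R.
Proof. by rewrite gv_flip. Qed.

Lemma zeta12 : zeta ^+ 12 = 1.
Proof. by rewrite (exprM zeta 3 4) zeta3 (exprM _ 2 2) sqrCi sqrrN expr1n. Qed.

Lemma zetaV m : zeta ^- m = zeta ^+ (11 * m).
Proof.
have z0 : zeta ^+ m != 0.
  by apply: contra_eq_neq (zeta12) => /eqP; rewrite expf_eq0 => /andP[_ /eqP ->];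
    rewrite expr0n /= eq_sym oner_eq0.
by apply: (mulfI z0); rewrite divff // -exprD -mulSn exprM zeta12 expr1n.
Qed.

Lemma e11E j : 24 *: e11 R 6 j = ev (fourier false (fun k => cyc_pow (11 * (j * k)))).
Proof.
rewrite fourierE /e11 -[24](_ : 2 * (2 * 6)%:R = _); last by rewrite -natrM.
rewrite scale_quarter /=; congr (_ *: _); apply: eq_bigr => k _.
by rewrite lam_rot zetaV (cval_pow (zeta4 R)).
Qed.
Lemma e22E j : 24 *: e22 R 6 j = ev (fourier false (fun k => cyc_pow (j * k))).
Proof.
rewrite fourierE /e22 -[24](_ : 2 * (2 * 6)%:R = _); last by rewrite -natrM.
rewrite scale_quarter /=; congr (_ *: _); apply: eq_bigr => k _.
by rewrite lam_rot (cval_pow (zeta4 R)).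
Qed.
Lemma e12E j : 24 *: e12 R 6 j = ev (fourier true (fun k => cyc_pow (j * k))).
Proof.
rewrite fourierE /e12 -[24](_ : 2 * (2 * 6)%:R = _); last by rewrite -natrM.
rewrite scale_quarter /=; congr (_ *: _); apply: eq_bigr => k _.
by rewrite lam_flip (cval_pow (zeta4 R)).
Qed.
Lemma e21E j : 24 *: e21 R 6 j = ev (fourier true (fun k => cyc_pow (11 * (j * k)))).
Proof.
rewrite fourierE /e21 -[24](_ : 2 * (2 * 6)%:R = _); last by rewrite -natrM.
rewrite scale_quarter /=; congr (_ *: _); apply: eq_bigr => k _.
by rewrite lam_flip zetaV (cval_pow (zeta4 R)).
Qed.

Lemma linear_char (f g : nat -> cyc) (s t : nat -> C) (e : K) :
    e = (4 * 6)%:R^-1 *: \sum_(k < 6.*2) (s k *: lr R false k%:R + t k *: lr R true k%:R) ->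
    (forall k, cval (f k) = s k) -> (forall k, cval (g k) = t k) ->
  48 *: e = ev (fourier false f ++ fourier true g).
Proof.
move=> -> fs gt; rewrite evf_cat !fourierE.
have ef : \sum_(k < 6.*2) cval (f k) *: lr R false k%:R = \sum_(k < 6.*2) s k *: lr R false k%:R.
  by apply: eq_bigr => k _; rewrite fs.
have eg : \sum_(k < 6.*2) cval (g k) *: lr R true k%:R = \sum_(k < 6.*2) t k *: lr R true k%:R.
  by apply: eq_bigr => k _; rewrite gt.
rewrite ef eg.
exact: (@average_sum C K 6.*2 (fun k : 'I_6.*2 => s k *: lr R false k%:R) (fun k : 'I_6.*2 => t k *: lr R true k%:R)).
Qed.

Let c1 : cval cyc1 = 1. Proof. exact: cval1. Qed.
Let sgnE k : cval (cyc_pow (6 * k)) = (-1) ^+ k.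
Proof.
have z6 : zeta ^+ 6 = -1 by rewrite (exprM zeta 3 2) zeta3 sqrCi.
by rewrite (cval_pow (zeta4 R)) exprM z6.
Qed.
Let nsgnE k : cval (cyc_pow (6 + 6 * k)) = - (-1) ^+ k.
Proof. by rewrite -mulnS sgnE exprS mulN1r. Qed.
Let nE : cval (cyc_pow 6) = -1. Proof. by have := sgnE 1; rewrite muln1 expr1. Qed.

Let add11 (V : lmodType C) (x y : V) : x + y = 1 *: x + 1 *: y.
Proof. by rewrite !scale1r. Qed.
Let sub11 (V : lmodType C) (x y : V) : x - y = 1 *: x + (-1) *: y.
Proof. by rewrite scale1r scaleN1r. Qed.
Let addss (V : lmodType C) s (x y : V) : s *: (x + y) = s *: x + s *: y.
Proof. by rewrite scalerDr. Qed.
Let subss (V : lmodType C) s (x y : V) : s *: (x - y) = s *: x + (- s) *: y.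
Proof. by rewrite scalerBr scaleNr. Qed.

Notation pos := (fun=> cyc1).
Notation neg := (fun=> cyc_pow 6).
Notation alt := (fun k => cyc_pow (6 * k)).
Notation nalt := (fun k => cyc_pow (6 + 6 * k)).

Lemma e1E : 48 *: e1 R 6 = ev (fourier false pos ++ fourier true pos).
Proof.
refine (@linear_char pos pos (fun=> 1) (fun=> 1) _ _ (fun=> c1) (fun=> c1)).
rewrite /e1; congr (_ *: _).
apply: eq_bigr => k _; rewrite lam_rot lam_flip; exact: add11.
Qed.
Lemma e2E : 48 *: e2 R 6 = ev (fourier false pos ++ fourier true neg).
Proof.
refine (@linear_char pos neg (fun=> 1) (fun=> -1) _ _ (fun=> c1) (fun=> nE)).
rewrite /e2; congr (_ *: _).
apply: eq_bigr => k _; rewrite lam_rot lam_flip; exact: sub11.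
Qed.
Lemma e3E : 48 *: e3 R 6 = ev (fourier false alt ++ fourier true nalt).
Proof.
refine (@linear_char alt nalt (fun k => (-1) ^+ k) (fun k => - (-1) ^+ k) _ _ sgnE nsgnE).
rewrite /e3; congr (_ *: _).
apply: eq_bigr => k _; rewrite lam_rot lam_flip; exact: subss.
Qed.
Lemma e4E : 48 *: e4 R 6 = ev (fourier false alt ++ fourier true alt).
Proof.
refine (@linear_char alt alt (fun k => (-1) ^+ k) (fun k => (-1) ^+ k) _ _ sgnE sgnE).
rewrite /e4; congr (_ *: _).
apply: eq_bigr => k _; rewrite lam_rot lam_flip; exact: addss.
Qed.
Notation chi j := (fun k => cyc_pow (j * k)).
Notation chi' j := (fun k => cyc_pow (11 * (j * k))).

Definition is48 (p : K) (f : form code) := 48 *: p = ev f.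

Lemma is48D p q f g : is48 p f -> is48 q g -> is48 (p + q) (f ++ g).
Proof. by rewrite /is48 evf_cat => <- <-; apply: scalerDr. Qed.

Lemma ev_prune f : ev (prune (collect f)) = ev f.
Proof.
apply: esym; rewrite -[LHS]evf_collect; elim: (collect f) => [|q l IH] //=.
case: ifP => [_|/negbT]; first by rewrite !evf_cons IH.
by rewrite negbK => /(cyc_eq0P zeta) q0; rewrite evf_cons q0 scale0r IH; apply: add0r.
Qed.

Lemma double_is48 p f : 24 *: p = ev f -> is48 p (scalef (cyc_int 2) f).
Proof.
move=> e; rewrite /is48 (evfZ (zeta4 R)) -e; apply: etrans (double24 _) _.
by rewrite cval_int.
Qed.

Lemma rank_is48 u v j (a b : C) f f12 f21 f22 :
    a = zeta ^+ u -> b = zeta ^+ v ->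
    24 *: e11 R 6 j = ev f -> 24 *: e12 R 6 j = ev f12 ->
    24 *: e21 R 6 j = ev f21 -> 24 *: e22 R 6 j = ev f22 ->
  is48 (2^-1 *: (e11 R 6 j + a *: e12 R 6 j + b *: e21 R 6 j + e22 R 6 j))
    (f ++ scalef (cyc_pow u) f12 ++ scalef (cyc_pow v) f21 ++ f22).
Proof.
move=> -> -> h1 h2 h3 h4; rewrite /is48 3!evf_cat 2!(evfZ (zeta4 R)).
rewrite 2!(cval_pow (zeta4 R)) -h1 -h2 -h3 -h4.
exact: (@rank_one C K).
Qed.
End KD6.

Section Abstract.
Variables (C : numClosedFieldType) (V : lmodType C).
Implicit Types x y z u v w : V.

Lemma rank_subl x y z w (a b : C) :
  2^-1 *: (x - a *: y + b *: z + w) = 2^-1 *: (x + (- a) *: y + b *: z + w).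
Proof. by rewrite scaleNr. Qed.
Lemma rank_subr x y z w (a b : C) :
  2^-1 *: (x + a *: y - b *: z + w) = 2^-1 *: (x + a *: y + (- b) *: z + w).
Proof. by rewrite scaleNr. Qed.
Lemma rank_add x y z w :
  2^-1 *: (x + y + z + w) = 2^-1 *: (x + (1 : C) *: y + (1 : C) *: z + w).
Proof. by rewrite !scale1r. Qed.
Lemma rank_sub x y z w :
  2^-1 *: (x - y - z + w) = 2^-1 *: (x + (-1 : C) *: y + (-1 : C) *: z + w).
Proof. by rewrite !scaleN1r. Qed.
Lemma sum_odd (F : nat -> V) : \sum_(1 <= j < 6 | odd j) F j = F 1 + (F 3 + F 5).
Proof. by rewrite unlock /= addr0. Qed.
Lemma sum_even (F : nat -> V) : \sum_(1 <= j < 6 | ~~ odd j) F j = F 2 + F 4.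
Proof. by rewrite unlock /= addr0. Qed.
End Abstract.

Section KD6.
Variable R : realType.
Local Notation C := R[i].
Local Notation K := (KD R 6).
Local Notation zeta := (eps R 6).
Local Notation cval := (cyc_val zeta).
Local Notation beta := (basis_elt R).
Local Notation ev := (evf zeta beta).

Definition node_proj (x : node) : K :=
  if node_projection R x is Some p then p else if x is CC then 1 else e1 R 6.

Local Notation proj := node_proj.

Section Table.
Variable T : seq (form code).
Local Notation is48 := (@is48 R).
Hypothesis e1T : is48 (e1 R 6) (charf T 0).
Hypothesis e2T : is48 (e2 R 6) (charf T 1).
Hypothesis e3T : is48 (e3 R 6) (charf T 2).
Hypothesis e4T : is48 (e4 R 6) (charf T 3).
Hypothesis e11T : forall j, (0 < j < 6)%N -> 24 *: e11 R 6 j = ev (e11f T j).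
Hypothesis e22T : forall j, (0 < j < 6)%N -> 24 *: e22 R 6 j = ev (e22f T j).
Hypothesis e12T : forall j, (0 < j < 6)%N -> 24 *: e12 R 6 j = ev (e12f T j).
Hypothesis e21T : forall j, (0 < j < 6)%N -> 24 *: e21 R 6 j = ev (e21f T j).

Lemma rankT u v j (a b : C) : (0 < j < 6)%N -> a = zeta ^+ u -> b = zeta ^+ v ->
  is48 (2^-1 *: (e11 R 6 j + a *: e12 R 6 j + b *: e21 R 6 j + e22 R 6 j)) (rankf T u v j).
Proof.
move=> j6 ea eb.
exact: (rank_is48 ea eb (e11T j6) (e12T j6) (e21T j6) (e22T j6)).
Qed.

Lemma zeta6 : zeta ^+ 6 = -1.
Proof. by rewrite (exprM zeta 3 2) zeta3 sqrCi. Qed.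
Lemma zeta9 : zeta ^+ 9 = - 'i.
Proof. by rewrite (exprD zeta 6 3) zeta6 zeta3 mulN1r. Qed.

Lemma r11T j : (0 < j < 6)%N -> is48 (r11 R 6 j) (rankf T 9 3 j).
Proof. by move=> j6; rewrite /r11 rank_subl; apply: rankT; rewrite ?zeta9 ?zeta3. Qed.
Lemma r22T j : (0 < j < 6)%N -> is48 (r22 R 6 j) (rankf T 3 9 j).
Proof. by move=> j6; rewrite /r22 rank_subr; apply: rankT; rewrite ?zeta9 ?zeta3. Qed.
Lemma p11T j : (0 < j < 6)%N -> is48 (p11 R 6 j) (rankf T 0 0 j).
Proof. by move=> j6; rewrite /p11 rank_add; apply: rankT; rewrite ?expr0. Qed.
Lemma p22T j : (0 < j < 6)%N -> is48 (p22 R 6 j) (rankf T 6 6 j).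
Proof. by move=> j6; rewrite /p22 rank_sub; apply: rankT; rewrite ?zeta6. Qed.
Lemma q0T j m (t : R) : (0 < j < 6)%N -> (m <= 12)%N -> t = pi / 6%:R *+ m ->
  is48 (q0 6 t j) (rankf T (12 - m) m j).
Proof.
move=> j6 m12 ->; apply: rankT => //; last by rewrite zetaX.
have e12 : zeta ^+ m * zeta ^+ (12 - m) = 1 by rewrite -exprD subnKC // zeta12.
by rewrite -[LHS]mulr1 -e12 mulrA zetaX -expiD addNr expi0 mul1r.
Qed.

Lemma p1T : is48 (p1 R 6) (rankf T 0 0 1 ++ rankf T 0 0 3 ++ rankf T 0 0 5).
Proof. by rewrite /p1 sum_odd; do 2?apply: is48D; apply: p11T. Qed.
Lemma p2T : is48 (p2 R 6) (rankf T 6 6 1 ++ rankf T 6 6 3 ++ rankf T 6 6 5).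
Proof. by rewrite /p2 sum_odd; do 2?apply: is48D; apply: p22T. Qed.
Lemma q1T : is48 (q1 R 6) (rankf T 0 0 2 ++ rankf T 0 0 4).
Proof. by rewrite /q1 sum_even; apply: is48D; apply: p11T. Qed.
Lemma q2T : is48 (q2 R 6) (rankf T 6 6 2 ++ rankf T 6 6 4).
Proof. by rewrite /q2 sum_even; apply: is48D; apply: p22T. Qed.
Lemma double11T j : (0 < j < 6)%N -> is48 (e11 R 6 j) (doublef (e11f T j)).
Proof. by move=> j6; apply/double_is48/e11T. Qed.
Lemma double22T j : (0 < j < 6)%N -> is48 (e22 R 6 j) (doublef (e22f T j)).
Proof. by move=> j6; apply/double_is48/e22T. Qed.
Lemma oneT : is48 1 (scalef (cyc_int 48) onef).
Proof.
rewrite /is48 (evfZ (zeta4 R)) cval_int; congr (_ *: _).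
by rewrite -elt1 evf2 (_ : cyc_val zeta cyc1 = 1) //; apply: cval1.
Qed.

Ltac is48_tac := repeat match goal with
  | |- is48 (_ + _) _ => refine (is48D _ _)
  | |- is48 (e1 _ _) _ => exact: e1T
  | |- is48 (e2 _ _) _ => exact: e2T
  | |- is48 (e3 _ _) _ => exact: e3T
  | |- is48 (e4 _ _) _ => exact: e4T
  | |- is48 (p1 _ _) _ => exact: p1T
  | |- is48 (p2 _ _) _ => exact: p2T
  | |- is48 (q1 _ _) _ => exact: q1T
  | |- is48 (q2 _ _) _ => exact: q2T
  | |- is48 (r11 _ _ _) _ => exact: r11T
  | |- is48 (r22 _ _ _) _ => exact: r22T
  | |- is48 (p11 _ _ _) _ => exact: p11T
  | |- is48 (p22 _ _ _) _ => exact: p22T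
  | |- is48 (e11 _ _ _) _ => exact: double11T
  | |- is48 (e22 _ _ _) _ => exact: double22T
  | |- is48 (q0 _ _ _) _ => by apply: q0T => //; field
  end.

Lemma projT x : is48 (proj x) (node_projf T x).
Proof. case: x; rewrite /node_proj /node_projection /node_projf; cbv zeta; try exact: oneT; is48_tac. Qed.

End Table.

Lemma proj_table x : 48 *: proj x = ev (nth [::] projf_table (node_idx x)).
Proof.
rewrite /projf_table (nth_map CC); last by case: x.
rewrite node_idxK ev_prune; apply: projT; rewrite ?/is48.
- by rewrite ev_prune; exact: e1E.
- by rewrite ev_prune; exact: e2E.
- by rewrite ev_prune; exact: e3E.
- by rewrite ev_prune; exact: e4E.
- by case=> [|[|[|[|[|[|]]]]]] // _; rewrite ev_prune; exact: e11E.
- by case=> [|[|[|[|[|[|]]]]]] // _; rewrite ev_prune; exact: e22E.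
- by case=> [|[|[|[|[|[|]]]]]] // _; rewrite ev_prune; exact: e12E.
- by case=> [|[|[|[|[|[|]]]]]] // _; rewrite ev_prune; exact: e21E.
Qed.
End KD6.

(** * Identification by Jones projections and the covering relation *)

Lemma eigen_scaled (C : fieldType) (A : algType C) (y q : A) (a e : C) :
  y * q = e *: q -> y * (a *: q) = e *: (a *: q).
Proof. by move=> yq; rewrite -scalerAr yq !scalerA mulrC. Qed.

Section Jones.
Variables (R : realType) (n : nat).
Local Notation C := R[i].
Local Notation K := (KD R n).
Implicit Types (I : {vspace K}) (p q : K).

(** A Jones projection has counit 1, so p q = q and q p = p; the adjoint of the first
equation is q p = q. *)
Lemma jones_unique I p q : jones_projection I p -> jones_projection I q -> p = q.
Proof.
have counit1 r : jones_projection I r -> counit r = 1.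
  case=> rI r0 rr _ /(_ _ rI); rewrite rr => e; apply/eqP; rewrite -subr_eq0.
  have : (counit r - 1) *: r == 0 by rewrite scalerBl scale1r -e subrr.
  by rewrite scaler_eq0 (negPf r0) orbF.
move=> jp jq; have p1 := counit1 _ jp; have q1 := counit1 _ jq.
case: jp jq => pI _ _ ps pabs [qI _ _ qs qabs].
have pq : p * q = q by rewrite (qabs _ pI) p1 scale1r.
have qp : q * p = p by rewrite (pabs _ qI) q1 scale1r.
by rewrite -[RHS]qs -pq starM ps qs qp.
Qed.

Lemma jones_scaled I q m : m != 0%N -> q \in I -> star q = q ->
    (forall y, y \in I -> y * q = counit y *: q) -> counit q = m%:R ->
  jones_projection I (m%:R^-1 *: q).
Proof.
move=> m0 qI qs qabs qm; set p := _ *: q.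
have mC : m%:R != 0 :> C by rewrite pnatr_eq0.
have p1 : counit p = 1 by rewrite /p counitZ qm mulVf.
have pabs y : y \in I -> y * p = counit y *: p.
  by move=> yI; apply: (@eigen_scaled C K); apply: qabs.
have pI : p \in I by apply: memvZ.
split=> //; last by rewrite /p starZ qs fmorphV /= conjC_nat.
  apply/eqP => p0; have := p1; rewrite p0 /counit big1 => [|g _]; last by rewrite ffunE.
  by move/eqP; rewrite eq_sym oner_eq0.
by rewrite pabs // p1 scale1r.
Qed.

Lemma coideal_fullv : coideal_subalgebra (fullv : {vspace K}).
Proof.
split=> [|x y _ _|x _|x _]; rewrite ?memvf //.
rewrite (galg_lam (Delta x)); apply: memv_suml => -[g h] _.
by apply: memvZ; rewrite -tens_lam; apply: tens_mem; apply: memvf.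
Qed.

End Jones.

Section KD6.
Variable R : realType.
Local Notation C := R[i].
Local Notation K := (KD R 6).
Local Notation zeta := (eps R 6).
Local Notation cval := (cyc_val zeta).
Local Notation beta := (basis_elt R).
Local Notation ev := (evf zeta beta).
Local Notation L := (node_space R).
Local Notation proj := (node_proj R).
Notation wf := (all (fun p : cyc * code => wfc p.2)).

Let projf x := nth [::] projf_table (node_idx x).

Lemma node_idx_lt x : (node_idx x < 32)%N. Proof. by case: x. Qed.

Lemma jones_checkP x : jones_check (projf x) x.
Proof.
have /andP[/allP /(_ (node_idx x)) h _] := projections_checks.
by rewrite mem_iota node_idx_lt node_idxK in h; apply: (h isT).
Qed.

Lemma wf_projf x : wf (projf x). Proof. by have /andP[] := jones_checkP x. Qed.

Lemma L_jones x : jones_projection (L x) (proj x).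
Proof.
have eP := proj_table R x; rewrite -/(projf x) in eP.
have wP := wf_projf x.
have /and5P[_ mP sP aP cP] := jones_checkP x.
have -> : proj x = 48%:R^-1 *: ev (projf x).
  by rewrite -eP scalerK // pnatr_eq0.
apply: jones_scaled => //.
- exact: memL.
- by rewrite -ev_starx; apply: eqfP; [exact: zeta4|exact: sP].
- apply: (@span_right_mul _ K) => [u v|c u|_ /mapP[g gx ->]]; first exact: counitD.
    exact: counitZ.
  rewrite -ev_mulx (eqfP _ _ (allP aP _ gx)); last exact: zeta4.
  rewrite (evfZ (zeta4 R)) ev_counit //; exact: (allP (wf_gens x) _ gx).
- by rewrite ev_counit // (cyc_eqP R cP) cval_int.
Qed.

Lemma proj_inj : injective proj.
Proof.
move=> x y exy; apply: node_idx_inj.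
have /andP[_ /(pairwiseP [::]) dis] := projections_checks.
rewrite size_map in dis.
have sP : size projf_table = 32 by rewrite size_map.
have inP z : node_idx z \in gtn (size projf_table) by rewrite sP inE node_idx_lt.
have main z t : proj z = proj t -> (node_idx z < node_idx t)%N -> False.
  move=> ezt /(dis _ _ (inP z) (inP t)).
  rewrite !(nth_map [::]) ?sP ?node_idx_lt // /distinct -/(projf z) -/(projf t) zip_map has_map.
  case/hasP=> p pc /=; case: ifP => // _ /(cyc_neq0P (zeta4 R)); apply/negP; rewrite negbK.
  have wp : wfc p by move: pc; apply: (allP (isT : all wfc codes)).
  have ip48 u : ip (beta p) (48 *: proj u) = 2^-1 * cval (ipd [:: (cyc1, p)] (projf u)).
    by rewrite proj_table -ev_ipd ?wf_projf //= ?wp // ev_code.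
  have two0 : (2^-1 : C) != 0 by rewrite invr_eq0 pnatr_eq0.
  have := ip48 z; rewrite ezt ip48 => /(mulfI two0) e.
  by rewrite cvalD /cycN (cvalM (zeta4 R)) cval_int e mulN1r subrr.
case: (ltngtP (node_idx x) (node_idx y)) => // xy.
  by case: (main _ _ exy).
by case: (main _ _ (esym exy)).
Qed.

Lemma L_inj : injective L.
Proof.
move=> x y exy; apply: proj_inj; have jx := L_jones x.
by rewrite exy in jx; apply: jones_unique jx (L_jones y).
Qed.

Lemma leb_refl x : leb x x. Proof. by case: x. Qed.

Lemma order_checkP x y :
  order_pair x y (leb x y) (node_gens x) (weighted (node_gens y)).
Proof.
have := order_checks; rewrite /order_check => /allP/(_ x (mem_nodes x)).
move/allP/(_ y (mem_nodes y)).
by rewrite (nth_map CC) ?node_idxK // node_idx_lt.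
Qed.

(** Paths give inclusions; without a path, a generator outside or the dimensions exclude
them, equal dimensions because distinct nodes have distinct subspaces. *)
Lemma L_le x y : (L x <= L y)%VS = leb x y.
Proof.
have := order_checkP x y; rewrite /order_pair; case: ifP => [_ /allP gx|xy].
  by apply/span_subvP => _ /mapP[g /gx gy ->]; apply: memfP gy; apply: wf_gens.
case: ifP => [_ /hasP[g gx gy]|/negbT].
  apply/negP => /subvP/(_ _ (gen_mem R gx)); apply/negP.
  apply: nmemfP gy; [exact: wf_gens|exact: (allP (wf_gens x))].
rewrite -leqNgt -!(L_dim R) => dxy _; apply/negP => Lxy.
have /L_inj exy : L x = L y by apply/eqP; rewrite eqEdim Lxy.
by rewrite exy leb_refl in xy.
Qed.

Lemma L_one_vspace : L CC = 1%VS.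
Proof.
apply/esym/eqP; rewrite eqEdim dimv1 L_dim leqnn andbT.
by apply/subvP => _ /vlineP[a ->]; apply/memvZ/L_one.
Qed.

(** The whole algebra is a coideal subalgebra, so it belongs to a node, and every node is
below KD6. *)
Lemma L_full : L KD6 = fullv.
Proof.
have /coideal_subalgebraP[y e] := coideal_fullv R 6.
by apply/eqP; rewrite eqEsubv subvf e L_le; case: y e.
Qed.

Lemma denotesP x I : denotes x I <-> I = L x.
Proof.
have Lp p : proj x = p -> (coideal_subalgebra I /\ jones_projection I p <-> I = L x).
  move=> <-; split=> [[/coideal_subalgebraP[y ->] jy]|->]; last first.
    by split; [exact: L_coideal|exact: L_jones].
  by congr (L _); apply: proj_inj; apply: jones_unique (L_jones y) jy.
have := Lp (proj x) erefl; rewrite /denotes /node_proj.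
case e: (node_projection R x) => [p|] // _.
by case: x e {Lp} => // _; rewrite ?L_one_vspace ?L_full.
Qed.

Lemma covers_upper x y : covers (L x) (L y) <-> y \in upper x.
Proof.
have /(allP covers_checks) : node_idx x \in iota 0 32 by rewrite mem_iota node_idx_lt.
move/allP/(_ (node_idx y)); rewrite mem_iota node_idx_lt => /(_ isT)/eqP.
have tab z : nth [::] [seq above x | x <- nodes] (node_idx z) = above z.
  by rewrite (nth_map CC) ?node_idxK // node_idx_lt.
rewrite node_idxK (mem_map node_idx_inj) !tab -/(leb x y) (inj_eq node_idx_inj) => ->.
split=> [[_ _ Lxy nxy between]|/and3P[xy nxy between]].
  apply/and3P; split; first by rewrite -L_le.
    by apply: contraNneq nxy => ->.
  apply/allP => k; rewrite mem_iota => /= k32.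
  have zk : node_idx (nth CC nodes k) = k.
    by do 32?[case: k k32 => [|k] k32 //].
  move: (nth CC nodes k) zk => z <-; rewrite tab !(inj_eq node_idx_inj) -/(leb x z) -/(leb z y).
  apply/implyP => xz; apply/implyP => zy; rewrite -!L_le in xz zy.
  by case: (between _ (L_coideal R z) xz zy) => /L_inj ->; rewrite eqxx ?orbT.
split; [exact: L_coideal|exact: L_coideal|by rewrite L_le| |].
  by apply: contra_neq nxy => /L_inj.
move=> M /coideal_subalgebraP[z ->]; rewrite !L_le => xz zy.
have /(allP between) : node_idx z \in iota 0 32 by rewrite mem_iota node_idx_lt.
rewrite tab -/(leb x z) -/(leb z y) xz zy !(inj_eq node_idx_inj) /=.
by case/orP=> /eqP ->; [left|right].
Qed.

End KD6.

Theorem theorem7p7 (R : realType) :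
  exists L : node -> {vspace KD R 6},
    [/\ forall (x : node) (I : {vspace KD R 6}), denotes x I <-> I = L x,
        forall I : {vspace KD R 6},
          coideal_subalgebra I <-> exists x : node, I = L x,
        injective L,
        forall x : node, \dim (L x) = node_dim x
      & forall x y : node, covers (L x) (L y) <-> y \in upper x].
Proof.
exists (node_space R); split.
- exact: denotesP.
- exact: coideal_subalgebraP.
- exact: L_inj.
- exact: L_dim.
- exact: covers_upper.
Qed.
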